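(* Let $w(x,y)=R(|x-y|)$ for all $x,y\in[0,1]$, where $R:[0,1]\to(0,1]$ is $\mathcal{C}^1$ with $R'(x)<0$ for all $x\in(0,1)$. For each $N$ let $G^{(N)}\sim w$ and let $\hat\sigma^{(N)}$ be the output of the spectral seriation algorithm with input $G^{(N)}$. (i) For every $\varepsilon\in(0,1)$ and $\eta\in(0,1/3)$ there exist $C=C(w)>0$ and $N_0=N_0(w,\varepsilon,\eta)$ such that for all $N\ge N_0$, $\mathbb{P}(\|\hat\sigma^{(N)}-\mathrm{id}_N\|_1\le CN^{2-\eta})>1-\varepsilon$. (ii) Let $\tilde\sigma^{(N)}$ be the output of the post-processing algorithm with input $G^{(N)}$ and parameters $\alpha=0.05$, $\beta=0.31$. Then for every $\gamma>1$ and $\epsilon>0$ there exist $\delta=\delta(w,\gamma,\epsilon)>0$ and $N_0=N_0(w,\gamma,\epsilon)$ such that for all $N\ge N_0$, $\mathbb{P}(\|\tilde\sigma^{(N)}-\mathrm{id}_N\|_\infty\le\epsilon\sqrt{N(\log N)^\gamma})>1-\varepsilon_\gamma(N)^\delta$.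
   Context: Random graph $G\sim w$ on $V=\{v_1,\dots,v_N\}$, $v_i=i/N$: edges $\{v_i,v_j\}$, $i<j$, present independently with probability $w(v_i,v_j)$. For a finite set $S$ and $f:S\to\mathbb{R}$, $\sigma_f(s)=|\{s'\in S: f(s')\le f(s)\}|$ (ties broken arbitrarily to get a bijection $S\to[|S|]$); for an ordering $\sigma:S\to[|S|]$, $\mathrm{rev}(\sigma)=|S|+1-\sigma$. Spectral seriation algorithm: given a graph with adjacency matrix $A$, take an eigenvector $\phi$ of its Laplacian $D-A$ ($D$ diagonal degree matrix) for the second-smallest eigenvalue and output $\sigma_\phi$. Subroutine (input $G$, disjoint $T,S\subset V$, $\alpha,\beta$): (1) $\hat\sigma_T$ = spectral seriation of the induced subgraph $G|_T$; (2) $R=\{u\in T:\hat\sigma_T(u)\ge(1-\alpha)|T|\}$, $L=\{u\in T:\hat\sigma_T(u)\le\alpha|T|\}$; (3) for $v\in S$, $\psi_R(v)=|T|^{-1}|\{u\in R:\{u,v\}\in E\}|$, $\psi_L(v)=|T|^{-1}|\{u\in L:\{u,v\}\in E\}|$; (4) $c_R=\inf\{c\ge0:|\{v\in S:\psi_R(v)\le c\}|\ge(1-\beta)|S|\}$, $c_L$ analogously with $\psi_L$; (5) define antisymmetric $\hat F:S^2\to\{-1,0,1\}$ ($\hat F(v,u)=-\hat F(u,v)$, $\hat F(u,u)=0$) by, for $u<v$: $\hat F(u,v)=1-2\cdot\mathbf{1}[\psi_R(u)>\psi_R(v)]$ if $\psi_R(u),\psi_R(v)<c_R$; otherwise $1-2\cdot\mathbf{1}[\psi_L(u)<\psi_L(v)]$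 if $\psi_L(u),\psi_L(v)<c_L$; otherwise $1$ if $\psi_R(u)<c_R$; otherwise $-1$; (6) $\hat f(v)=\sum_{u\in S}\hat F(u,v)$; (7) output $\sigma_{\hat f}:S\to[|S|]$. A partition $(S_1,S_2,S_3)$ of $V$ is good if $n\le|S_3|\le|S_2|\le|S_1|\le n+1$, $n=\lfloor N/3\rfloor$. Orderings $\sigma_1:S_1\to[|S_1|]$, $\sigma_2:S_2\to[|S_2|]$ are aligned if $\max_{i\in S_1\cap S_2}|\sigma_1(i)/|S_1|-\sigma_2(i)/|S_2||\le\max_{i\in S_1\cap S_2}|\mathrm{rev}(\sigma_1)(i)/|S_1|-\sigma_2(i)/|S_2||$ (aligned if $S_1\cap S_2=\emptyset$). The merged ordering of $(\sigma_1,\sigma_2,\sigma_3)$ on a good partition is $\sigma:[N]\to[N]$ with $\sigma^{-1}(3k+j)=N\sigma_j^{-1}(k+1)$ for $k\in\{0,\dots,n\}$, $j\in\{1,2,3\}$, $3k+j\le N$. Post-processing algorithm (input $G$, $\alpha,\beta$): choose uniformly at random a good partition $(S_1,S_2,S_3)$ and independently another $(S_1',S_2',S_3')$; run the subroutine on $(T,S)=(S_3,S_1),(S_1,S_2),(S_2,S_3)$ to get $\hat\sigma_1,\hat\sigma_2,\hat\sigma_3$, and on $(S_1',S_2')$ to get $\hat\sigma_{\mathrm{ref}}$; replace each $\hat\sigma_j$ by $\mathrm{rev}(\hat\sigma_j)$ if it is not aligned with $\hat\sigma_{\mathrm{ref}}$; output the merged ordering of $(\hat\sigma_1,\hat\sigma_2,\hat\sigma_3)$.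 Distances are symmetrized under reversal: for a permutation $\sigma$ of $[N]$, $\|\sigma-\mathrm{id}_N\|_p:=\min(\|\sigma-\mathrm{id}_N\|_p,\|\mathrm{rev}(\sigma)-\mathrm{id}_N\|_p)$ for $p\in\{1,\infty\}$, with $\mathrm{rev}(\sigma)(i)=N+1-\sigma(i)$. $\varepsilon_\gamma(N)=\exp(-(\log N)^\gamma)$. *)

(* Defs.v *)
From HB Require Import structures.
From mathcomp Require Import all_boot all_order all_algebra.
From mathcomp Require Import all_classical all_reals all_analysis.

Set Implicit Arguments.
Unset Strict Implicit.
Unset Printing Implicit Defensive.

Import Order.TTheory GRing.Theory Num.Theory.
Import numFieldNormedType.Exports.
Local Open Scope classical_set_scope.
Local Open Scope ring_scope.

Definition C1_on01 (R : realType) (rho : R -> R) : Prop :=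
  [/\ {within [set x : R | 0 <= x <= 1], continuous rho},
      (forall x : R, 0 < x < 1 -> derivable rho x 1)
    & exists g : R -> R, {within [set x : R | 0 <= x <= 1], continuous g} /\
        (forall x : R, 0 < x < 1 -> derive1 rho x = g x)].

Definition wfun (R : realType) (rho : R -> R) (x y : R) : R := rho `|x - y|.

(* Vertex v_{i+1} = (i+1)/N is represented by i : 'I_N (0-based).
   A graph is an edge indicator on ordered pairs; only pairs (i,j), i<j, are
   used (pairs with i >= j must be absent, they carry weight 0 otherwise). *)
Definition graph (N : nat) := {ffun 'I_N * 'I_N -> bool}.

Definition adj (N : nat) (e : graph N) (u v : 'I_N) : bool :=
  if (u < v)%N then e (u, v) else if (v < u)%N then e (v, u) else false.

Definition vpos (R : realType) (N : nat) (i : 'I_N) : R := (i.+1)%:R / N%:R.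

Definition edge_prob (R : realType) (N : nat) (w : R -> R -> R) (e : graph N) : R :=
  \prod_(p : 'I_N * 'I_N)
    (if (p.1 < p.2)%N then
       (if e p then w (vpos R p.1) (vpos R p.2) else 1 - w (vpos R p.1) (vpos R p.2))
     else (if e p then 0 else 1)).

(* An ordering sigma : S -> [|S|] is represented by a function 'I_N -> nat
   which is a bijection from S onto {0,...,|S|-1} (0-based ranks: the paper's
   value sigma(s) is our sigma s + 1); values outside S are irrelevant. *)
Definition is_ordering (N : nat) (S : {set 'I_N}) (sigma : 'I_N -> nat) : Prop :=
  {in S &, injective sigma} /\ {in S, forall s, (sigma s < #|S|)%N}.

(* sigma is a possible value of sigma_f (ties broken arbitrarily) *)
Definition ordered_by (R : realType) (N : nat) (f : 'I_N -> R)
    (S : {set 'I_N}) (sigma : 'I_N -> nat) : Prop :=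
  is_ordering S sigma /\
  {in S &, forall s s', f s < f s' -> (sigma s < sigma s')%N}.

Definition revo (N : nat) (S : {set 'I_N}) (sigma : 'I_N -> nat) : 'I_N -> nat :=
  fun i => (#|S| - (sigma i).+1)%N.

Definition lapT (R : realType) (N : nat) (e : graph N) (T : {set 'I_N}) : 'M[R]_#|T| :=
  \matrix_(i, j) ((i == j)%:R * (#|[set v in T | adj e (enum_val i) v]|)%:R
                   - (adj e (enum_val i) (enum_val j))%:R).

Definition second_smallest_eig (R : realType) (n : nat) (M : 'M[R]_n) (lam : R) : Prop :=
  exists s : seq R, [/\ sorted <=%R s, char_poly M = \prod_(x <- s) ('X - x%:P),
                        (1 < size s)%N & lam = s`_1].

Definition spec_ser (R : realType) (N : nat) (e : graph N) (T : {set 'I_N})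
    (sigma : 'I_N -> nat) : Prop :=
  exists (lam : R) (phi : 'rV[R]_#|T|),
    [/\ second_smallest_eig (lapT R e T) lam, phi != 0,
        phi *m lapT R e T = lam *: phi, is_ordering T sigma
      & forall i j : 'I_#|T|, phi 0 i < phi 0 j ->
          (sigma (enum_val i) < sigma (enum_val j))%N].

Definition psi (R : realType) (N : nat) (e : graph N) (T X : {set 'I_N}) (v : 'I_N) : R :=
  (#|[set u in X | adj e u v]|)%:R / (#|T|)%:R.

Definition thresh (R : realType) (N : nat) (S : {set 'I_N}) (beta : R) (f : 'I_N -> R) : R :=
  inf [set c : R | 0 <= c /\
         (1 - beta) * (#|S|)%:R <= (#|[set v in S | f v <= c]|)%:R].

Definition Fup (R : realType) (N : nat) (pR pL : 'I_N -> R) (cR cL : R) (u v : 'I_N) : R :=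
  if (pR u < cR) && (pR v < cR) then (if pR v < pR u then -1 else 1)
  else if (pL u < cL) && (pL v < cL) then (if pL u < pL v then -1 else 1)
  else if pR u < cR then 1 else -1.

Definition Fhat (R : realType) (N : nat) (pR pL : 'I_N -> R) (cR cL : R) (u v : 'I_N) : R :=
  if (u < v)%N then Fup pR pL cR cL u v
  else if (v < u)%N then - Fup pR pL cR cL v u else 0.

Definition subroutine (R : realType) (N : nat) (e : graph N) (T S : {set 'I_N})
    (alpha beta : R) (sigma : 'I_N -> nat) : Prop :=
  exists sigT : 'I_N -> nat, spec_ser R e T sigT /\
    let Rs := [set u in T | (1 - alpha) * (#|T|)%:R <= ((sigT u).+1)%:R] in
    let Ls := [set u in T | ((sigT u).+1)%:R <= alpha * (#|T|)%:R] in
    let pR := psi R e T Rs in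
    let pL := psi R e T Ls in
    let cR := thresh S beta pR in
    let cL := thresh S beta pL in
    ordered_by (fun v => \sum_(u in S) Fhat pR pL cR cL u v) S sigma.

Definition part3 (N : nat) := ({set 'I_N} * {set 'I_N} * {set 'I_N})%type.

Definition good (N : nat) (P : part3 N) : bool :=
  let S1 := P.1.1 in let S2 := P.1.2 in let S3 := P.2 in
  [&& S1 :|: S2 :|: S3 == [set: 'I_N]%SET, [disjoint S1 & S2], [disjoint S1 & S3],
      [disjoint S2 & S3], (N %/ 3 <= #|S3|)%N, (#|S3| <= #|S2|)%N,
      (#|S2| <= #|S1|)%N & (#|S1| <= (N %/ 3).+1)%N].

Definition aligned (R : realType) (N : nat) (A B : {set 'I_N}) (s1 s2 : 'I_N -> nat) : bool :=
  \big[Num.max/(0:R)]_(i in A :&: B)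
      `| ((s1 i).+1)%:R / (#|A|)%:R - ((s2 i).+1)%:R / (#|B|)%:R |
  <= \big[Num.max/(0:R)]_(i in A :&: B)
      `| ((#|A| - s1 i)%N)%:R / (#|A|)%:R - ((s2 i).+1)%:R / (#|B|)%:R |.

Definition merged (N : nat) (P : part3 N) (s1 s2 s3 : 'I_N -> nat) : 'I_N -> nat :=
  fun u => if u \in P.1.1 then (3 * s1 u)%N
           else if u \in P.1.2 then (3 * s2 u + 1)%N else (3 * s3 u + 2)%N.

(* sigma is a possible output of post-processing on G, given the two random
   good partitions P and P' *)
Definition postproc (R : realType) (N : nat) (e : graph N) (P P' : part3 N)
    (alpha beta : R) (sigma : 'I_N -> nat) : Prop :=
  exists s1 s2 s3 sref : 'I_N -> nat,
    [/\ subroutine e P.2 P.1.1 alpha beta s1,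
        subroutine e P.1.1 P.1.2 alpha beta s2,
        subroutine e P.1.2 P.2 alpha beta s3,
        subroutine e P'.1.1 P'.1.2 alpha beta sref
      & let fix_ (S : {set 'I_N}) (s : 'I_N -> nat) :=
            if aligned R S P'.1.2 s sref then s else revo S s in
        forall u, sigma u = merged P (fix_ P.1.1 s1) (fix_ P.1.2 s2) (fix_ P.2 s3) u].

Definition adist (m n : nat) : nat := (m - n + (n - m))%N.

Definition dist1 (N : nat) (sigma : 'I_N -> nat) : nat :=
  minn (\sum_(i : 'I_N) adist (sigma i) i)
       (\sum_(i : 'I_N) adist (N - (sigma i).+1) i).

Definition distinf (N : nat) (sigma : 'I_N -> nat) : nat :=
  minn (\max_(i : 'I_N) adist (sigma i) i)
       (\max_(i : 'I_N) adist (N - (sigma i).+1) i).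

Definition eps_gamma (R : realType) (gamma : R) (N : nat) : R :=
  expR (- ((ln (N%:R : R)) `^ gamma)).

Definition ngood (N : nat) : nat := #|[set P : part3 N | good P]|.

(* Main.v *)
Require Import Defs.
From HB Require Import structures.
From mathcomp Require Import all_boot all_order all_algebra all_fingroup.
From mathcomp Require Import all_classical all_reals all_analysis.
From mathcomp Require Import complex ring lra zify.
Import Order.TTheory GRing.Theory Num.Theory.
Import numFieldNormedType.Exports.
Local Open Scope ring_scope.

(** The second eigenvector of the Laplacian of the mean Toeplitz matrix is
    strictly monotone with slopes of order 1/n, and the spectral gap above it is
    linear in n.  When all degrees and all weighted degrees of the random graph
    are within n tau of their means and the cut norm of the noise is at most a
    small constant times n^2, comparing the eigenvalue equations coordinate by
    coordinate gives an error O(tau) in sup norm for the random eigenvector.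
    Hence every pair of vertices at distance at least K tau is ordered correctly
    by spectral seriation, whatever the tie-breaking.  On a part T this already
    makes the end sets R and L of the subroutine accurate, and the scores
    psi_R and psi_L decrease at a linear rate away from R and L, so the
    comparison F is right for all pairs at distance at least K' tau.  Since this is
    deterministic on the good event, no independence between the ordering of T and
    the edges from T to S is used.  The parts of a random good
    partition are uniformly spread by a negative-correlation bound for exchangeable
    sets.  Taking tau of order sqrt((log N)^gamma / N) gives both claims. *)

(** * Laplacian spectra *)

(** The sup-norm step divides the equation at each vertex by its degree minus the eigenvalue, so the
    second eigenvalue of the mean has to lie below the least degree by a multiple of n; a two-block
    test vector provides this margin. The same margin drives the slope bounds: subtracting
    consecutive rows makes the increments of an eigenvector, up to positive factors, a fixed point
    of a nonnegative matrix, whose entries have a lower bound only in columns away from both ends.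
    The two kinds of noise cost differently. Vertex sums must be small at scale tau; they fail with
    probability about N exp(-c N tau^2), and gamma > 1 lets the exponent beat the factor N. The cut
    norm is a supremum over 4^N sign choices, but it only has to preserve the spectral gap, so a
    constant fraction of N^2 suffices and the exponent is quadratic in N. Every weight in a vertex
    sum is fixed before the graph is drawn: this is why the mean eigenvector is a function of size
    and rank alone, and why the ideal end sets are cut at given positions instead of computed
    ranks. *)

Lemma symmetric_unitary_diag {R : realType} {n : nat} (M : 'M[R]_n) :
  M^T = M -> exists (P : 'M[R[i]]_n) (d : 'rV[R]_n),
    P \is unitarymx /\
    map_mx (real_complex R) M =
      invmx P *m diag_mx (map_mx (real_complex R) d) *m P.
Proof.
move=> symM; set MC := map_mx _ M.
have MCh : MC \is hermsymmx.
  apply: realsym_hermsym.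
    apply/is_hermitianmxP; rewrite expr0 scale1r map_mx_id //.
    by rewrite map_trmx symM.
  by apply/mxOverP => i j; rewrite mxE; apply/complex_realP; exists (M i j).
have := hermitian_normalmx MCh => /orthomx_spectralP E.
have /mxOverP dr := hermitian_spectral_diag_real MCh.
exists (spectralmx MC), (map_mx (@complex.Re R) (spectral_diag MC)).
split; first exact: spectral_unitarymx.
apply: etrans E _; set D := spectral_diag MC.
have -> : map_mx (real_complex R) (map_mx (@complex.Re R) D) = D; last by [].
by apply/rowP => i; rewrite !mxE RRe_real.
Qed.


Lemma symmetric_char_poly {R : realType} {n : nat} (M : 'M[R]_n)
    (P : 'M[R[i]]_n) (d : 'rV[R]_n) :
  P \is unitarymx ->
  map_mx (real_complex R) M =
      invmx P *m diag_mx (map_mx (real_complex R) d) *m P ->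
  char_poly M = \prod_i ('X - (d 0 i)%:P).
Proof.
move=> Pu E.
have Pun := unitarymx_unit Pu.
apply: (@map_poly_inj _ _ (real_complex R)).
rewrite map_char_poly E.
set D := diag_mx _.
have -> : char_poly (invmx P *m D *m P) = char_poly D.
  have HP : map_mx polyC (invmx P) *m map_mx polyC P = 1%:M.
    by rewrite -map_mxM mulVmx // map_mx1.
  rewrite /char_poly.
  have -> : char_poly_mx (invmx P *m D *m P) =
      map_mx polyC (invmx P) *m char_poly_mx D *m map_mx polyC P.
    rewrite /char_poly_mx mulmxBr mulmxBl !map_mxM; congr (_ - _).
    by rewrite -mulmxA mul_scalar_mx -scalemxAr HP scalemx1.
  by rewrite !det_mulmx mulrAC -det_mulmx HP det1 mul1r.
rewrite char_poly_trig ?diag_mx_is_trig // rmorph_prod.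
by apply: eq_bigr => i _; rewrite rmorphB /= map_polyX map_polyC /= !mxE eqxx.
Qed.

(** In the unitary eigenbasis the form is a sum of the entries of [d] weighted by squared moduli of
    the coordinates. The row [x] is real, so its transpose can stand for the adjoint. *)
Lemma symmetric_form_ge {R : realType} {n : nat} (M : 'M[R]_n)
    (P : 'M[R[i]]_n) (d : 'rV[R]_n) (l : R) (x : 'rV[R]_n) :
  P \is unitarymx ->
  map_mx (real_complex R) M =
      invmx P *m diag_mx (map_mx (real_complex R) d) *m P ->
  (forall i, l <= d 0 i) ->
  l * (x *m x^T) 0 0 <= (x *m M *m x^T) 0 0.
Proof.
move=> Pu E Hl.
have Pun := unitarymx_unit Pu.
pose xC := map_mx (real_complex R) x.
have xCT : xC^T = map_mx Num.conj xC^T.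
  by apply/matrixP => i j; rewrite !mxE; exact: (esym (conjc_real _)).
pose c := xC *m invmx P.
have cT : map_mx Num.conj c^T = P *m xC^T.
  rewrite /c invmx_unitary // trmx_mul map_mxM map_trmx trmxK -xCT.
  by congr (_ *m _); apply/matrixP => i j; rewrite !mxE /= conjCK.
have E1 : real_complex R ((x *m M *m x^T) 0 0) =
   \sum_i real_complex R (d 0 i) * (c 0 i * Num.conj (c 0 i)).
  transitivity ((map_mx (real_complex R) (x *m M *m x^T)) 0 0); first by rewrite [RHS]mxE.
  rewrite !map_mxM E -!mulmxA -map_trmx -/xC -cT !mulmxA -/c.
  rewrite mxE; apply: eq_bigr => j _; rewrite mul_mx_diag !mxE.
  by rewrite mulrAC mulrC mulrA.
have E2 : real_complex R ((x *m x^T) 0 0) = \sum_i (c 0 i * Num.conj (c 0 i)).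
  transitivity ((map_mx (real_complex R) (x *m x^T)) 0 0); first by rewrite [RHS]mxE.
  rewrite !map_mxM -map_trmx -/xC.
  have -> : xC *m xC^T = c *m map_mx Num.conj c^T.
    by rewrite cT /c mulmxA mulmxKV.
  by rewrite mxE; apply: eq_bigr => j _; rewrite !mxE.
rewrite -(lecR (R := R)) rmorphM /= E1 E2 mulr_sumr.
apply: ler_sum => i _; apply: ler_wpM2r; first exact: mul_conjC_ge0.
by rewrite lecR.
Qed.

(** This replaces compactness of the sphere: the least entry of [d] is a root of the real
    characteristic polynomial, hence has a real eigenvector, and it bounds the form from below. *)
Lemma symmetric_min_eigen {R : realType} {n : nat} (M : 'M[R]_n) :
  (0 < n)%N -> M^T = M -> exists (l : R) (v : 'rV[R]_n),
    [/\ v != 0, v *m M = l *: v &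
     forall x : 'rV[R]_n, l * (x *m x^T) 0 0 <= (x *m M *m x^T) 0 0].
Proof.
move=> n0 symM; have [P [d [Pu E]]] := symmetric_unitary_diag M symM.
pose i0 : 'I_n := Ordinal n0.
pose i1 := [arg min_(i < i0 | true) d 0 i]%O.
have Hi i : d 0 i1 <= d 0 i.
  by rewrite /i1; case: arg_minP => //= j _ Hj; exact: Hj.
have : eigenvalue M (d 0 i1).
  rewrite eigenvalue_root_char (symmetric_char_poly M P d Pu E).
  by rewrite (bigD1 i1) //= rootM root_XsubC eqxx.
move=> /eigenvalueP [v vM v0]; exists (d 0 i1), v; split => // x.
exact: (symmetric_form_ge M P d _ x Pu E).
Qed.

(** The root list is sorted, so its head is at most [a]; hence [b] occurs at a positive index, and
    the entry at index 1 is no larger. *)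
Lemma second_smallest_eig_le {R : realType} {n : nat} (M : 'M[R]_n) (lam a b : R) :
  second_smallest_eig M lam -> eigenvalue M a -> eigenvalue M b -> a < b -> lam <= b.
Proof.
move=> [s [so E sz ->]].
rewrite !eigenvalue_root_char E !root_prod_XsubC => /(nthP 0) [ia la ea] /(nthP 0) [ib lb eb] ab.
rewrite -eb; apply: (sorted_leq_nth le_trans le_refl) => //; rewrite ?inE //.
rewrite lt0n; apply/eqP => ib0; move: ab; rewrite -ea -eb ib0 ltNge => /negP; apply.
by apply: (sorted_leq_nth le_trans le_refl); rewrite ?inE // (leq_trans _ sz).
Qed.

(** If the second root vanished, 0 would be a double root and two distinct rows of the unitary
    matrix would be kernel vectors. Both would be constant, and nonzero constant rows cannot be
    orthogonal. *)
Lemma second_smallest_eig_gt0 {R : realType} {n : nat} (M : 'M[R]_n) (lam : R) :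
  M^T = M ->
  (forall x : 'rV[R]_n, 0 <= (x *m M *m x^T) 0 0) ->
  (forall x : 'rV[R]_n, x *m M = 0 -> exists a, x = const_mx a) ->
  second_smallest_eig M lam -> 0 < lam.
Proof.
move=> symM psd ker [s [so E sz ->]].
have [P [d [Pu Ed]]] := symmetric_unitary_diag M symM.
have Pun := unitarymx_unit Pu.
have s_ge0 a : a \in s -> 0 <= a.
  rewrite -root_prod_XsubC -E -eigenvalue_root_char => /eigenvalueP[v vM v0].
  have := psd v; rewrite vM -scalemxAl mxE.
  have : 0 < (v *m v^T) 0 0.
    rewrite mxE lt_neqAle eq_sym; apply/andP; split; last first.
      by apply: sumr_ge0 => i _; rewrite mxE -expr2 sqr_ge0.
    apply: contra v0; rewrite psumr_eq0; last by move=> i _; rewrite mxE -expr2 sqr_ge0.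
    move=> /allP h; apply/eqP/rowP => i; rewrite mxE.
    have := h i (mem_index_enum _); rewrite mxE -expr2 sqrf_eq0 /=; exact/eqP.
  by move=> vv; rewrite pmulr_lge0.
rewrite lt_neqAle s_ge0 ?mem_nth // andbT; apply/negP => /eqP s1.
have s0 : s`_0 = 0.
  apply/eqP; rewrite eq_le s_ge0 ?mem_nth ?(leq_trans _ sz) // andbT [leRHS]s1.
  by apply: (sorted_leq_nth le_trans le_refl); rewrite ?inE ?(leq_trans _ sz).
have : perm_eq s [seq d 0 i | i <- enum 'I_n].
  apply: prod_XsubC_eq; rewrite -E (symmetric_char_poly M P d Pu Ed).
  by rewrite big_map big_enum.
move=> /seq.permP /(_ (pred1 0)).
have : (2 <= count (pred1 (0%R : R)) s)%N.
  by case: (s) sz s0 s1 => [|x [|y t]] //= _ -> <-; rewrite eqxx.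
move=> h2 Ec; move: h2; rewrite Ec count_map -size_filter => h2.
pose z := [seq x <- enum 'I_n | preim (fun i => d 0 i) (pred1 0) x].
rewrite -/z in h2.
have uz : uniq z by rewrite filter_uniq // enum_uniq.
have [i [j [ij di dj]]] : exists i j : 'I_n, [/\ i != j, d 0 i = 0 & d 0 j = 0].
  have zin i : i \in z -> d 0 i = 0 by rewrite mem_filter /= => /andP[/eqP].
  move: zin uz h2; case: z => [|i [|j t]] //= zin /andP[ni _] _.
  exists i, j; split; [|by apply: zin; rewrite inE eqxx|].
    by apply: contra ni => /eqP ->; rewrite inE eqxx.
  by apply: zin; rewrite !inE eqxx orbT.
(* The real kernel determines the complex one, because [kermx] commutes with the embedding of
   scalars. *)
have kerC k : d 0 k = 0 -> exists a : R[i], row k P = const_mx a.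
  move=> dk.
  have : (row k P <= kermx (map_mx (real_complex R) M))%MS.
    apply/sub_kermxP; rewrite Ed -row_mul mulmxA mulmxA mulmxV // mul1mx.
    by rewrite row_mul row_diag_mx !mxE dk /= scale0r mul0mx.
  rewrite -map_kermx => /submx_trans H.
  have : (row k P <= (const_mx 1 : 'rV[R[i]]_n))%MS.
    apply: H.
    have -> : (const_mx 1 : 'rV[R[i]]_n) = map_mx (real_complex R) (const_mx 1).
      by apply/rowP => l; rewrite !mxE.
    rewrite map_submx; apply/row_subP => l.
    have [a ->] : exists a, row l (kermx M) = const_mx a.
      by apply: ker; rewrite -row_mul mulmx_ker row0.
    apply/sub_rVP; exists a; apply/rowP => q; by rewrite !mxE mulr1.
  by move=> /sub_rVP [a ->]; exists a; apply/rowP => q; rewrite !mxE mulr1.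
have [a Ha] := kerC i di; have [b Hb] := kerC j dj.
have PP := unitarymxP Pu.
have Pia k : P i k = a by have := congr1 (fun A : 'rV_n => A 0 k) Ha; rewrite !mxE.
have Pjb k : P j k = b by have := congr1 (fun A : 'rV_n => A 0 k) Hb; rewrite !mxE.
have dot k l (u v : R[i]) : (forall q, P k q = u) -> (forall q, P l q = v) ->
    u * Num.conj v *+ n = (k == l)%:R.
  move=> Hu Hv; have := congr1 (fun A : 'M[R[i]]_n => A k l) PP.
  rewrite !mxE => <-; under [RHS]eq_bigr do rewrite !mxE Hu Hv.
  by rewrite sumr_const card_ord.
have /eqP := dot i j a b Pia Pjb.
rewrite (negbTE ij) mulrn_eq0 mulf_eq0 conjC_eq0 => /orP[/eqP n0|/orP[] /eqP z0].
- by have := ltn_ord i; rewrite [in X in (_ < X)%N]n0.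
- by have /eqP := dot i i a a Pia Pia; rewrite z0 mul0r mul0rn eqxx eq_sym oner_eq0.
- by have /eqP := dot j j b b Pjb Pjb; rewrite z0 mul0r mul0rn eqxx eq_sym oner_eq0.
Qed.

(* Vectors and kernels are functions on [nat], of which only the first [n] values matter;
   this gives the shift [i.+1] without dependent types. *)
Definition dotn {R : realType} (n : nat) (f g : nat -> R) : R := \sum_(i < n) f i * g i.

Definition lap {R : realType} (n : nat) (W : nat -> nat -> R) (f : nat -> R) (i : nat) : R :=
  \sum_(j < n) W i j * (f i - f j).

Lemma kernel_min_eigen {R : realType} (n : nat) (S : nat -> nat -> R) :
  (0 < n)%N -> (forall i j, S i j = S j i) ->
  exists (l : R) (h : nat -> R), [/\ exists2 i, (i < n)%N & h i != 0,
    forall i, (i < n)%N -> \sum_(j < n) S i j * h j = l * h i &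
    forall x : nat -> R, l * dotn n x x <= dotn n x (fun i => \sum_(j < n) S i j * x j)].
Proof.
move=> n0 symS; pose M : 'M[R]_n := \matrix_(i, j) S i j.
have symM : M^T = M by apply/matrixP => i j; rewrite !mxE symS.
have [l [v [v0 vM form]]] := symmetric_min_eigen M n0 symM.
exists l, (fun i => if insub i is Some k then v 0 k else 0); split.
- have /rV0Pn [i vi] := v0; exists i => //; by rewrite valK.
- move=> i lin; rewrite insubT /=; have := congr1 (fun A : 'rV[R]_n => A 0 (Ordinal lin)) vM.
  rewrite !mxE => <-; apply: eq_bigr => j _.
  by rewrite valK mxE mulrC symS.
move=> x; have := form (\row_i x i); rewrite !mxE.
set a := \sum_j _; set b := \sum_j _.
have -> : a = dotn n x x by apply: eq_bigr => i _; rewrite !mxE.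
suff -> : b = dotn n x (fun i => \sum_(j < n) S i j * x j) by [].
apply: eq_bigr => i _; rewrite !mxE mulrC; congr (_ * _).
by apply: eq_bigr => j _; rewrite !mxE symS mulrC.
Qed.

Lemma dotnC {R : realType} n (f g : nat -> R) : dotn n f g = dotn n g f.
Proof. by apply: eq_bigr => i _; rewrite mulrC. Qed.

Lemma dotnDr {R : realType} n (f g h : nat -> R) :
  dotn n f (fun i => g i + h i) = dotn n f g + dotn n f h.
Proof. by rewrite -big_split; apply: eq_bigr => i _; rewrite mulrDr. Qed.

Lemma dotnZr {R : realType} n (c : R) (f g : nat -> R) :
  dotn n f (fun i => c * g i) = c * dotn n f g.
Proof. by rewrite mulr_sumr; apply: eq_bigr => i _; rewrite mulrCA. Qed.

Lemma dotnBr {R : realType} n (f g h : nat -> R) :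
  dotn n f (fun i => g i - h i) = dotn n f g - dotn n f h.
Proof. by rewrite -sumrB; apply: eq_bigr => i _; rewrite mulrBr. Qed.

Lemma eq_dotn {R : realType} n (f g f' g' : nat -> R) :
  (forall i, (i < n)%N -> f i = f' i) -> (forall i, (i < n)%N -> g i = g' i) ->
  dotn n f g = dotn n f' g'.
Proof. by move=> Hf Hg; apply: eq_bigr => i _; rewrite Hf ?Hg. Qed.

Lemma dotn_ge0 {R : realType} n (f : nat -> R) : 0 <= dotn n f f.
Proof. by apply: sumr_ge0 => i _; rewrite -expr2 sqr_ge0. Qed.

Lemma dotn_gt0 {R : realType} n (f : nat -> R) i :
  (i < n)%N -> f i != 0 -> 0 < dotn n f f.
Proof.
move=> lin fi; rewrite /dotn (bigD1 (Ordinal lin)) //=.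
apply: ltr_wpDr; last by rewrite -expr2 lt_neqAle eq_sym sqrf_eq0 fi sqr_ge0.
by apply: sumr_ge0 => j _; rewrite -expr2 sqr_ge0.
Qed.

Lemma dotn_CS {R : realType} n (f g : nat -> R) :
  dotn n f g ^+ 2 <= dotn n f f * dotn n g g.
Proof.
have -> : dotn n f g ^+ 2 = \sum_(i < n) \sum_(j < n) (f i * g j) * (f j * g i).
  rewrite expr2 {1}/dotn mulr_suml; apply: eq_bigr => i _.
  by rewrite mulr_sumr; apply: eq_bigr => j _; ring.
have E1 : dotn n f f * dotn n g g = \sum_(i < n) \sum_(j < n) (f i * g j) ^+ 2.
  rewrite {1}/dotn mulr_suml; apply: eq_bigr => i _.
  by rewrite mulr_sumr; apply: eq_bigr => j _; ring.
have E2 : dotn n f f * dotn n g g = \sum_(i < n) \sum_(j < n) (f j * g i) ^+ 2.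
  by rewrite E1 exchange_big.
suff : \sum_(i < n) \sum_(j < n) f i * g j * (f j * g i) *+ 2 <=
   dotn n f f * dotn n g g + dotn n f f * dotn n g g.
  by under eq_bigr do rewrite sumrMnl; rewrite sumrMnl -mulr2n lerMn2r.
rewrite {1}E1 E2 -big_split; apply: ler_sum => i _ /=.
rewrite -big_split; apply: ler_sum => j _ /=.
have := sqr_ge0 (f i * g j - f j * g i); lra.
Qed.

Lemma sum_lap {R : realType} n W (f : nat -> R) : (forall i j, W i j = W j i) ->
  \sum_(i < n) lap n W f i = 0.
Proof.
move=> symW.
have E : \sum_(i < n) lap n W f i = - \sum_(i < n) lap n W f i.
  rewrite -sumrN {1}/lap exchange_big; apply: eq_bigr => i _ /=.
  by rewrite /lap -sumrN; apply: eq_bigr => j _; rewrite (symW j i); ring.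
by apply/eqP; rewrite -[_ == 0](mulrn_eq0 _ 2) mulr2n {1}E addNr.
Qed.

Lemma dotn_lap {R : realType} n W (f g : nat -> R) : (forall i j, W i j = W j i) ->
  2 * dotn n f (lap n W g) = \sum_(i < n) \sum_(j < n) W i j * ((f i - f j) * (g i - g j)).
Proof.
move=> symW.
have E1 : dotn n f (lap n W g) = \sum_(i < n) \sum_(j < n) W i j * (f i * (g i - g j)).
  apply: eq_bigr => i _; rewrite mulr_sumr; apply: eq_bigr => j _; ring.
have E2 : dotn n f (lap n W g) = \sum_(i < n) \sum_(j < n) W i j * (f j * (g j - g i)).
  by rewrite E1 exchange_big; apply: eq_bigr => i _; apply: eq_bigr => j _; rewrite symW.
have -> : 2 * dotn n f (lap n W g) = dotn n f (lap n W g) + dotn n f (lap n W g) by ring.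
rewrite {1}E1 E2 -big_split; apply: eq_bigr => i _ /=.
rewrite -big_split; apply: eq_bigr => j _ /=; ring.
Qed.

Lemma dotn_lapC {R : realType} n W (f g : nat -> R) : (forall i j, W i j = W j i) ->
  dotn n f (lap n W g) = dotn n g (lap n W f).
Proof.
move=> symW; apply: (@mulfI _ (2 : R)); first by rewrite pnatr_eq0.
rewrite !dotn_lap //; apply: eq_bigr => i _; apply: eq_bigr => j _; ring.
Qed.

(** Chebyshev's identity. It yields the sum inequality for monotone vectors, the contradiction in
    the gap estimate, and the comparison of a Laplacian form with that of the complete graph. *)
Lemma dotn_cov {R : realType} n (f g : nat -> R) :
  2 * (n%:R * dotn n f g - (\sum_(i < n) f i) * (\sum_(i < n) g i)) =
  \sum_(i < n) \sum_(j < n) (f i - f j) * (g i - g j).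
Proof.
have E1 : \sum_(i < n) \sum_(j < n) (f i * g i) = n%:R * dotn n f g.
  by rewrite mulr_sumr; apply: eq_bigr => i _; rewrite sumr_const card_ord mulr_natl.
have E2 : \sum_(i < n) \sum_(j < n) (f j * g j) = n%:R * dotn n f g.
  by rewrite exchange_big.
have E3 : \sum_(i < n) \sum_(j < n) (f i * g j) = (\sum_(i < n) f i) * (\sum_(i < n) g i).
  by rewrite mulr_suml; apply: eq_bigr => i _; rewrite mulr_sumr.
have E4 : \sum_(i < n) \sum_(j < n) (f j * g i) = (\sum_(i < n) f i) * (\sum_(i < n) g i).
  by rewrite exchange_big.
have -> : \sum_(i < n) \sum_(j < n) (f i - f j) * (g i - g j) =
   \sum_(i < n) \sum_(j < n) (f i * g i) + \sum_(i < n) \sum_(j < n) (f j * g j)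
   - \sum_(i < n) \sum_(j < n) (f i * g j) - \sum_(i < n) \sum_(j < n) (f j * g i).
  rewrite -!big_split -!sumrB; apply: eq_bigr => i _ /=.
  rewrite -!big_split -!sumrB; apply: eq_bigr => j _ /=; ring.
rewrite E1 E2 E3 E4; ring.
Qed.

(* The second alternative comes from the least eigenvector of the form perturbed by
   multiples of the projections on the constants and on [f]. *)
Lemma lap_constrained_min {R : realType} n W (f : nat -> R) (lam theta : R) :
  (0 < n)%N -> (forall i j, W i j = W j i) ->
  \sum_(i < n) f i = 0 -> (forall i, (i < n)%N -> lap n W f i = lam * f i) ->
  (forall x : nat -> R, \sum_(i < n) x i = 0 -> dotn n f x = 0 ->
      theta * dotn n x x <= dotn n x (lap n W x)) \/
  exists (l : R) (h : nat -> R), [/\ l < theta, exists2 i, (i < n)%N & h i != 0,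
     \sum_(i < n) h i = 0 /\ dotn n f h = 0,
     forall i, (i < n)%N -> lap n W h i = l * h i &
     forall x : nat -> R, \sum_(i < n) x i = 0 -> dotn n f x = 0 ->
       l * dotn n x x <= dotn n x (lap n W x)].
Proof.
move=> n0 symW f1 fe.
have nR : 0 < n%:R :> R by rewrite ltr0n.
(* These weights move the eigenvalues of the constants and of [f] to at least [theta], so an
   eigenvector of the perturbed form below [theta] is orthogonal to both. The value 0 covers a
   vanishing [f], for which orthogonality is automatic. *)
pose t : R := `|theta|.
pose s : R := if dotn n f f == 0 then 0 else (`|theta| + `|lam|) / dotn n f f.
pose S (i j : nat) : R := (i == j)%:R * (\sum_(k < n) W i k) - W i j + t + s * (f i * f j).
have symS (i j : nat) : S i j = S j i.
  rewrite /S (symW i j) (mulrC (f i)) (eq_sym i j); case: eqP => [->//|_].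
  by rewrite !mul0r.
have SE (x : nat -> R) (i : nat) : (i < n)%N -> \sum_(j < n) S i j * x j =
    lap n W x i + t * (\sum_(j < n) x j) + s * f i * dotn n f x.
  move=> lin.
  have -> : lap n W x i = \sum_(j < n) ((i == j)%:R * (\sum_(k < n) W i k) * x j - W i j * x j).
    rewrite sumrB.
    have -> : \sum_(j < n) (i == j)%:R * (\sum_(k < n) W i k) * x j =
        (\sum_(k < n) W i k) * x i.
      rewrite (bigD1 (Ordinal lin)) //= eqxx mul1r [X in _ + X]big1 ?addr0 //.
      by move=> j /negbTE; rewrite -(inj_eq val_inj) /= eq_sym => ->; rewrite !mul0r.
    by rewrite mulr_suml -sumrB; apply: eq_bigr => j _; ring.
  rewrite !mulr_sumr -!big_split; apply: eq_bigr => j _ /=; rewrite /S; ring.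
have formE (x : nat -> R) : dotn n x (fun i => \sum_(j < n) S i j * x j) =
   dotn n x (lap n W x) + t * (\sum_(j < n) x j) ^+ 2 + s * dotn n f x ^+ 2.
  rewrite (@eq_dotn _ _ _ _ x (fun i => lap n W x i + (t * (\sum_(j < n) x j) + s * dotn n f x * f i))) //; last first.
    by move=> i lin; rewrite SE //; ring.
  rewrite dotnDr dotnDr dotnZr -addrA; congr (_ + (_ + _)).
    rewrite /dotn -mulr_suml; ring.
  rewrite dotnZr (dotnC n x f); ring.
have [l [h [hn0 he hmin]]] := kernel_min_eigen n S n0 symS.
have Hmin (x : nat -> R) : \sum_(i < n) x i = 0 -> dotn n f x = 0 ->
       l * dotn n x x <= dotn n x (lap n W x).
  move=> x1 xf; have := hmin x; rewrite formE x1 xf; lra.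
have [tl|lt] := leP theta l.
  left => x x1 xf; apply: le_trans (Hmin x x1 xf).
  by apply: ler_wpM2r => //; exact: dotn_ge0.
right; exists l, h.
have he' i : (i < n)%N -> lap n W h i + t * (\sum_(j < n) h j) + s * f i * dotn n f h = l * h i.
  by move=> lin; rewrite -SE // he.
have h1 : \sum_(i < n) h i = 0.
  have : \sum_(i < n) (lap n W h i + t * (\sum_(j < n) h j) + s * f i * dotn n f h) = \sum_(i < n) l * h i.
    by apply: eq_bigr => i _; rewrite he'.
  rewrite !big_split /= sum_lap // -!mulr_sumr sumr_const card_ord.
  have -> : \sum_(i < n) s * f i * dotn n f h = s * dotn n f h * (\sum_(i < n) f i).
    by rewrite mulr_sumr; apply: eq_bigr => i _; ring.
  rewrite f1 mulr0 addr0 add0r -mulr_natl => E.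
  apply/eqP; have /eqP : (n%:R * t - l) * (\sum_(i < n) h i) = 0 by rewrite mulrBl -E; ring.
  rewrite mulf_eq0 => /orP[|//]; rewrite subr_eq0 => /eqP El.
  have : t <= n%:R * t by rewrite ler_peMl ?ler1n // normr_ge0.
  have := ler_norm theta; rewrite -/t; lra.
have hf : dotn n f h = 0.
  have [ff|ff] := eqVneq (dotn n f f) 0.
    apply/eqP; rewrite -sqrf_eq0 eq_le sqr_ge0 andbT.
    by have := dotn_CS n f h; rewrite ff mul0r.
  have ffp : 0 < dotn n f f by rewrite lt_neqAle eq_sym ff dotn_ge0.
  have : dotn n f (fun i => lap n W h i + (s * dotn n f h) * f i) = dotn n f (fun i => l * h i).
    by apply: eq_dotn => // i lin; rewrite -he' // h1; ring.
  rewrite dotnDr !dotnZr dotn_lapC // (@eq_dotn _ _ h (lap n W f) h (fun i => lam * f i)) //.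
  rewrite dotnZr (dotnC n h f) => E.
  have /eqP : (lam + s * dotn n f f - l) * dotn n f h = 0.
    by rewrite !mulrBl !mulrDl -E; ring.
  rewrite mulf_eq0 => /orP[|/eqP//]; rewrite /s (negbTE ff) divfK // => /eqP El.
  have := ler_norm theta; have := ler_norm (- lam); rewrite normrN; lra.
split => // i lin; rewrite -he' // h1 hf; ring.
Qed.

(** * Toeplitz Laplacians *)

Definition toep {R : realType} (r : nat -> R) (i j : nat) : R := r (adist i j).

Definition deg {R : realType} (n : nat) (W : nat -> nat -> R) (i : nat) : R :=
  \sum_(j < n) W i j.

Lemma toep_sym {R : realType} (r : nat -> R) i j : toep r i j = toep r j i.
Proof. by rewrite /toep /adist addnC. Qed.

Lemma deg_toep {R : realType} n (r : nat -> R) i : (i < n)%N ->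
  deg n (toep r) i = \sum_(0 <= k < i.+1) r k + \sum_(1 <= k < n - i) r k.
Proof.
move=> lin; rewrite /deg -(big_mkord xpredT (fun j => toep r i j)).
rewrite (@big_cat_nat _ _ _ i.+1) //=; congr (_ + _).
  rewrite big_nat_rev /=; apply: eq_big_nat => k /andP[_ ki].
  by rewrite /toep /adist; congr r; lia.
rewrite -{1}(add1n i) big_addn; apply: eq_big_nat => k /andP[k0 kn].
by rewrite /toep /adist; congr r; lia.
Qed.

Lemma deg_toepS {R : realType} n (r : nat -> R) i : (i.+1 < n)%N ->
  deg n (toep r) i.+1 = deg n (toep r) i + (r i.+1 - r (n - i.+1)%N).
Proof.
move=> lin; rewrite !deg_toep //; last exact: ltnW.
rewrite [in LHS]big_nat_recr //= (_ : (n - i = (n - i.+1).+1)%N); last lia.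
rewrite [in RHS](@big_nat_recr _ _ _ (n - i.+1)%N 1) //=; last lia.
ring.
Qed.

Lemma deg_toep0 {R : realType} n (r : nat -> R) : (0 < n)%N ->
  deg n (toep r) 0 = \sum_(k < n) r k.
Proof. by move=> n0; apply: eq_bigr => k _; rewrite /toep /adist; congr r; lia. Qed.

(** Moving away from the end trades distances beyond [i] for distances starting at 1, where [r] is
    larger. An eigenvalue bound thus only has to beat the degree at 0. *)
Lemma deg_toep_ge {R : realType} n (r : nat -> R) i : (i < n)%N ->
  (forall k l, (k <= l)%N -> (l < n)%N -> r l <= r k) ->
  deg n (toep r) 0 <= deg n (toep r) i.
Proof.
move=> lin rdec; rewrite deg_toep0; last lia.
rewrite deg_toep // -(big_mkord xpredT r) (@big_cat_nat _ _ _ i.+1) //= lerD2l.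
rewrite -{1}(add1n i) big_addn; apply: ler_sum_nat => k /andP[k0 kn].
by apply: rdec; lia.
Qed.

Lemma deg_toep_le {R : realType} n (r : nat -> R) i : (i < n)%N ->
  (forall k l, (k <= l)%N -> (l < n)%N -> r l <= r k) ->
  deg n (toep r) i <= deg n (toep r) 0 + i%:R * (r 0%N - r n.-1).
Proof.
move=> lin rdec; elim: i lin => [|i IH] lin; first by rewrite mul0r addr0.
rewrite deg_toepS //.
have := IH (ltnW lin); have := rdec 0%N i.+1 isT lin.
have : r n.-1 <= r (n - i.+1)%N by apply: rdec; lia.
rewrite -natr1; lra.
Qed.

(** Entries of the matrix that acts on increments when two consecutive rows of the Laplacian are
    subtracted. They are nonnegative for decreasing [r], which gives the increments of an
    eigenvector a Perron-Frobenius structure. *)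
Definition toep_diff {R : realType} (n : nat) (r : nat -> R) (i k : nat) : R :=
  if (i <= k)%N then r (k - i)%N - r (n.-1 - i)%N else r (i - k)%N - r i.+1.

Lemma sum_ord_ltn {R : realType} (n a b : nat) (f : nat -> R) : (a <= b)%N -> (b <= n)%N ->
  \sum_(k < n) ((a <= k < b)%N)%:R * f k = \sum_(a <= k < b) f k.
Proof.
move=> ab bn; rewrite -(big_mkord xpredT (fun k => ((a <= k < b)%N)%:R * f k)).
rewrite (@big_cat_nat _ _ _ a) //=; last exact: leq_trans bn.
rewrite (@big_cat_nat _ _ _ b a n) //= big_nat big1 ?add0r; last first.
  by move=> k /andP[_ ka]; rewrite leqNgt ka mul0r.
rewrite [X in _ + X]big_nat [X in _ + X]big1 ?addr0; last first.
  by move=> k /andP[kb _]; rewrite ltnNge kb andbF mul0r.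
by apply: eq_big_nat => k ->; rewrite mul1r.
Qed.

Lemma toep_lapS {R : realType} n (r f : nat -> R) i : (i.+1 < n)%N ->
  lap n (toep r) f i.+1 - lap n (toep r) f i =
  deg n (toep r) i.+1 * (f i.+1 - f i) -
  \sum_(k < n.-1) toep_diff n r i k * (f k.+1 - f k).
Proof.
move=> lin.
(* Signed indicator of the steps between [i] and [j]; it writes [f j - f i] as a sum of increments
   for either order of [i] and [j]. *)
pose c j k : R := ((i <= k < j)%N)%:R - ((j <= k < i)%N)%:R.
have fc j : (j < n)%N -> f j - f i = \sum_(k < n.-1) c j k * (f k.+1 - f k).
  move=> ljn.
  under eq_bigr do rewrite /c mulrBl.
  rewrite sumrB; have [ij|ji] := leqP i j.
    rewrite [X in _ = _ - X]big1 ?subr0; last first.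
      by move=> k _; rewrite (_ : (j <= k < i)%N = false) ?mul0r //; lia.
    by rewrite (@sum_ord_ltn _ _ _ _ (fun k => f k.+1 - f k)) ?telescope_sumr //; lia.
  rewrite [X in _ = X - _]big1 ?sub0r; last first.
    by move=> k _; rewrite (_ : (i <= k < j)%N = false) ?mul0r //; lia.
  by rewrite (@sum_ord_ltn _ _ _ _ (fun k => f k.+1 - f k)) ?telescope_sumr ?opprB //; lia.
(* After exchanging sums, the coefficient of an increment is a telescoping sum of differences of [r]
   over all [j] on the far side of the step. *)
have -> : \sum_(k < n.-1) toep_diff n r i k * (f k.+1 - f k) =
   \sum_(j < n) (toep r i.+1 j - toep r i j) * (f j - f i).
  under [RHS]eq_bigr => j _ do rewrite fc // mulr_sumr.
  rewrite exchange_big; apply: eq_bigr => k _ /=.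
  under [RHS]eq_bigr do rewrite mulrA.
  rewrite -mulr_suml; congr (_ * _); rewrite /toep_diff /c.
  have kn := ltn_ord k.
  case: leqP => [ik|ki].
    transitivity (\sum_(j < n) ((k.+1 <= j < n)%N)%:R * (r (j - i.+1)%N - r (j - i)%N)).
      rewrite (@sum_ord_ltn _ _ _ _ (fun j => r (j - i.+1)%N - r (j - i)%N)) ?leqnn //; last lia.
      rewrite (@telescope_sumr_eq _ k.+1 n (fun j => - r (j - i.+1)%N)) //; last 2 first.
      - lia.
      - by move=> j jj; rewrite opprK [RHS]addrC subSS.
      rewrite opprK [RHS]addrC subSS; congr (_ - r _); lia.
    apply: eq_bigr => j _; rewrite ltn_ord andbT andbF subr0 /=.
    case: (leqP j k) => jk; first by rewrite mul0r mulr0.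
    by rewrite mulr1 mul1r /toep /adist; congr (r _ - r _); lia.
  transitivity (\sum_(j < n) ((0 <= j < k.+1)%N)%:R * (r (i - j)%N - r (i.+1 - j)%N)).
    rewrite (@sum_ord_ltn _ _ _ _ (fun j => r (i - j)%N - r (i.+1 - j)%N)) //; last lia.
    rewrite (@telescope_sumr_eq _ 0 k.+1 (fun j => r (i.+1 - j)%N)) //.
  apply: eq_bigr => j _; rewrite ltnS leq0n /=.
  rewrite /= andbT; case: (leqP j k) => jk.
    rewrite mul1r sub0r mulrN1 opprB /toep /adist; congr (r _ - r _); lia.
  by rewrite subr0 mulr0 mul0r.
rewrite /lap /deg mulr_suml -!sumrB; apply: eq_bigr => j _; ring.
Qed.

Lemma toep_diff_ge0 {R : realType} n (r : nat -> R) i k : (i.+1 < n)%N -> (k < n.-1)%N ->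
  (forall k l, (k <= l)%N -> (l < n)%N -> r l <= r k) -> 0 <= toep_diff n r i k.
Proof.
move=> lin lkn rdec; rewrite /toep_diff; case: leqP => ik; rewrite subr_ge0; apply: rdec; lia.
Qed.

Lemma monotone_le {R : realType} n (f : nat -> R) :
  (forall i, (i.+1 < n)%N -> f i <= f i.+1) ->
  forall i j, (i <= j)%N -> (j < n)%N -> f i <= f j.
Proof.
move=> mf i j; elim: j => [|j IH]; first by rewrite leqn0 => /eqP ->.
rewrite leq_eqVlt => /orP[/eqP -> //|ij jn].
exact: le_trans (IH ij (ltnW jn)) (mf j jn).
Qed.

Lemma monotone_dotn_ge0 {R : realType} n (f g : nat -> R) :
  (0 < n)%N -> \sum_(i < n) f i = 0 ->
  (forall i, (i.+1 < n)%N -> f i <= f i.+1) ->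
  (forall i, (i.+1 < n)%N -> g i <= g i.+1) -> 0 <= dotn n f g.
Proof.
move=> n0 f0 mf mg; have := dotn_cov n f g; rewrite f0 mul0r subr0 => E.
have nR : 0 < n%:R :> R by rewrite ltr0n.
suff : 0 <= 2 * (n%:R * dotn n f g) by rewrite !pmulr_rge0.
rewrite E; apply: sumr_ge0 => i _; apply: sumr_ge0 => j _.
have [ij|ji] := leqP i j.
  rewrite mulr_le0 // subr_le0; exact: monotone_le ij (ltn_ord _).
by rewrite mulr_ge0 // subr_ge0; apply: (monotone_le n) (ltnW ji) (ltn_ord _).
Qed.

Lemma lapB {R : realType} n W (f g : nat -> R) i :
  lap n W (fun k => f k - g k) i = lap n W f i - lap n W g i.
Proof. rewrite /lap -sumrB; apply: eq_bigr => j _; ring. Qed.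

Lemma lapZ {R : realType} n W (c : R) (f : nat -> R) i :
  lap n W (fun k => c * f k) i = c * lap n W f i.
Proof. rewrite /lap mulr_sumr; apply: eq_bigr => j _; ring. Qed.

Lemma lapD {R : realType} n W (f g : nat -> R) i :
  lap n W (fun k => f k + g k) i = lap n W f i + lap n W g i.
Proof. rewrite /lap -big_split; apply: eq_bigr => j _ /=; ring. Qed.

(** First-order optimality: moving [f] by [s] times the residual [x] changes the form minus [l]
    times the square norm by [s * (2 * a + s * p)], which is negative for small negative [s] unless
    [x] vanishes. *)
Lemma minimizer_eigen {R : realType} n W (l : R) (f : nat -> R) :
  (forall i j, W i j = W j i) -> \sum_(i < n) f i = 0 ->
  (forall x : nat -> R, \sum_(i < n) x i = 0 -> l * dotn n x x <= dotn n x (lap n W x)) ->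
  dotn n f (lap n W f) <= l * dotn n f f ->
  forall i, (i < n)%N -> lap n W f i = l * f i.
Proof.
move=> symW f0 minl fle i lin; apply/eqP; rewrite -subr_eq0; apply/negPn/negP => ri.
pose x k := lap n W f k - l * f k.
have x0 : \sum_(k < n) x k = 0.
  by rewrite /x sumrB sum_lap // -mulr_sumr f0 mulr0 subr0.
have a0 : 0 < dotn n x x by exact: (dotn_gt0 n x i).
set a := dotn n x x in a0.
have q0 := minl x x0; set q := dotn n x (lap n W x) in q0; rewrite -/a in q0.
have xf : dotn n x (lap n W f) = a + l * dotn n x f.
  by rewrite -dotnZr -dotnDr; apply: eq_dotn => // k _; rewrite /x; ring.
pose p := q - l * a; have p0 : 0 <= p by rewrite subr_ge0.
pose s := - a / (p + 1).
have ps : 0 < p + 1 by lra.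
have y0 : \sum_(k < n) (f k + s * x k) = 0 by rewrite big_split -mulr_sumr /= f0 x0 mulr0 addr0.
have := minl (fun k => f k + s * x k) y0.
have dotDl (u v w : nat -> R) : dotn n (fun k => u k + v k) w = dotn n u w + dotn n v w.
  by rewrite dotnC dotnDr !(dotnC n w).
have dotZl (c : R) (v w : nat -> R) : dotn n (fun k => c * v k) w = c * dotn n v w.
  by rewrite dotnC dotnZr (dotnC n w).
rewrite [X in _ <= X](@eq_dotn _ _ _ _ (fun k => f k + s * x k)
   (fun k => lap n W f k + s * lap n W x k)) //; last by move=> k _; rewrite lapD lapZ.
rewrite !dotDl !dotnDr !dotZl !dotnZr (dotn_lapC n W f x) // -/q xf -/a (dotnC n f x) => H.
have {}H : 0 <= s * (2 * a + s * p).
  rewrite /p; move: fle H; set ff := dotn n f f; set lf := dotn n f _; set fx := dotn n x f.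
  by move: q0; clearbody q a lf ff fx s => q0 h1 h2; lra.
have s0 : s < 0 by rewrite /s mulNr oppr_lt0 divr_gt0.
have : 0 < 2 * a + s * p.
  rewrite /s !mulNr mulrAC subr_gt0 ltr_pdivrMr //; nra.
by by move=> p2; move: H; rewrite nmulr_rge0 // leNgt p2.
Qed.

(* Replacing the increments of an eigenvector by their absolute values produces a vector
   [f] with [lap f = l f - (monotone)]; by Chebyshev's sum inequality its Rayleigh
   quotient does not exceed [l]. *)
Lemma toep_monotone_eigen {R : realType} n (r : nat -> R) (l : R) (h : nat -> R) :
  (0 < n)%N ->
  (forall k l, (k <= l)%N -> (l < n)%N -> r l <= r k) ->
  (forall i, (i < n)%N -> l <= deg n (toep r) i) ->
  (exists2 i, (i < n)%N & h i != 0) -> \sum_(i < n) h i = 0 ->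
  (forall i, (i < n)%N -> lap n (toep r) h i = l * h i) ->
  (forall x : nat -> R, \sum_(i < n) x i = 0 -> l * dotn n x x <= dotn n x (lap n (toep r) x)) ->
  exists f : nat -> R, [/\ forall i, (i.+1 < n)%N -> f i <= f i.+1, f 0%N < f n.-1,
    \sum_(i < n) f i = 0 & forall i, (i < n)%N -> lap n (toep r) f i = l * f i].
Proof.
move=> n0 rdec lded hn0 h0 he minl.
have nR : 0 < n%:R :> R by rewrite ltr0n.
pose F i := \sum_(0 <= k < i) `|h k.+1 - h k|.
pose m := (\sum_(i < n) F i) / n%:R.
pose f i := F i - m.
have fS i : f i.+1 - f i = `|h i.+1 - h i|.
  rewrite /f /F big_nat_recr //=; ring.
have f0 : \sum_(i < n) f i = 0.
  by rewrite /f sumrB sumr_const card_ord -mulr_natl mulrC divfK ?subrr // gt_eqF.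
have mf i : f i <= f i.+1 by rewrite -subr_ge0 fS normr_ge0.
pose g i := l * f i - lap n (toep r) f i.
(* The increment equation of [h] and the triangle inequality, with nonnegative matrix entries, bound
   [deg - l] times the increment of [f] by the matrix applied to the increments of [f]; this says
   that [g] increases. *)
have mg i : (i.+1 < n)%N -> g i <= g i.+1.
  move=> lin; rewrite -subr_ge0.
  have -> : g i.+1 - g i = l * (f i.+1 - f i) - (lap n (toep r) f i.+1 - lap n (toep r) f i).
    by rewrite /g; ring.
  rewrite toep_lapS // fS subr_ge0.
  have := toep_lapS n r h i lin; rewrite !he //; last exact: ltnW.
  set D := deg _ _ _; have lD : l <= D by apply: lded.
  set S := \sum_(k < n.-1) _ * (h _ - h _) => E.
  have ES : S = (D - l) * (h i.+1 - h i) by move: E; clearbody S D; lra.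
  have : `|S| <= \sum_(k < n.-1) toep_diff n r i k * (f k.+1 - f k).
    apply: le_trans (ler_norm_sum _ _ _) _; apply: ler_sum => k _.
    by rewrite normrM fS ger0_norm // toep_diff_ge0.
  rewrite ES normrM ger0_norm ?subr_ge0 //.
  move: (\sum_(k < n.-1) _) => B; lra.
have fle : dotn n f (lap n (toep r) f) <= l * dotn n f f.
  have := monotone_dotn_ge0 n f g n0 f0 (fun i _ => mf i) mg.
  rewrite /g dotnBr dotnZr; lra.
exists f; split => //; last exact: (minimizer_eigen n _ l f (toep_sym r)).
(* A flat [f] means that all increments of [h] vanish, so [h] would be constant with zero sum. *)
rewrite ltNge; apply/negP => ffle.
have hc i : (i < n)%N -> h i = h 0%N.
  elim: i => [//|i IH] lin; rewrite -IH; last exact: ltnW.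
  have h1 : f 0%N <= f i by apply: (monotone_le n) => //; exact: ltnW.
  have h2 : f i.+1 <= f n.-1 by apply: (monotone_le n) => //; lia.
  have h3 : f i.+1 - f i <= 0 by lra.
  by apply/eqP; rewrite -subr_eq0 -normr_le0 -fS.
have : \sum_(i < n) h i = n%:R * h 0%N.
  rewrite (eq_bigr (fun=> h 0%N)); last by move=> i _; rewrite hc.
  by rewrite sumr_const card_ord mulr_natl.
rewrite h0 => /esym/eqP; rewrite mulf_eq0 gt_eqF //= => /eqP h00.
by case: hn0 => i lin; rewrite hc // h00 eqxx.
Qed.

Lemma toep_diff_le1 {R : realType} n (r : nat -> R) i k : (i.+1 < n)%N -> (k < n.-1)%N ->
  (forall k, (k < n)%N -> 0 < r k <= 1) -> toep_diff n r i k <= 1.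
Proof.
move=> lin lkn r01; rewrite /toep_diff; case: leqP => ik.
  have h1 : (k - i < n)%N by lia.
  have h2 : (n.-1 - i < n)%N by lia.
  have := r01 _ h1; have := r01 _ h2; lra.
have h1 : (i - k < n)%N by lia.
have := r01 _ h1; have := r01 _ lin; lra.
Qed.

Lemma toep_diff_ge {R : realType} n (r : nat -> R) (kappa : R) z i k :
  (forall k l, (l < n)%N -> (k + z <= l)%N -> kappa <= r k - r l) ->
  (i.+1 < n)%N -> (z <= k.+1)%N -> (k < n - z)%N -> (k < n.-1)%N ->
  kappa <= toep_diff n r i k.
Proof.
move=> md lin zk kz kn; rewrite /toep_diff; case: leqP => ik; apply: md; lia.
Qed.

Lemma lap_eigen_diff {R : realType} n (r f : nat -> R) (l : R) i : (i.+1 < n)%N ->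
  (forall i, (i < n)%N -> lap n (toep r) f i = l * f i) ->
  (deg n (toep r) i.+1 - l) * (f i.+1 - f i) =
  \sum_(k < n.-1) toep_diff n r i k * (f k.+1 - f k).
Proof.
move=> lin fe; have := toep_lapS n r f i lin; rewrite !fe //; last exact: ltnW.
move: (deg _ _ _) (\sum_(k < n.-1) _) => D S; lra.
Qed.

(** The matrix entries are at most 1 and the increments add up to 1, so the increment equation
    divided by [deg - l] bounds every single increment. *)
Lemma toep_slope_le {R : realType} n (r f : nat -> R) (l c1 : R) :
  (1 < n)%N -> 0 < c1 ->
  (forall k, (k < n)%N -> 0 < r k <= 1) ->
  (forall i, (i < n)%N -> c1 * n%:R <= deg n (toep r) i - l) ->
  (forall i, (i.+1 < n)%N -> f i <= f i.+1) -> f n.-1 - f 0%N = 1 ->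
  (forall i, (i < n)%N -> lap n (toep r) f i = l * f i) ->
  forall i j, (i <= j)%N -> (j < n)%N -> f j - f i <= (j - i)%:R / (c1 * n%:R).
Proof.
move=> n1 c1p r01 dl mf fn fe.
have cn : 0 < c1 * n%:R by rewrite mulr_gt0 // ltr0n; lia.
have step i : (i.+1 < n)%N -> f i.+1 - f i <= 1 / (c1 * n%:R).
  move=> lin; rewrite ler_pdivlMr //.
  have gi : 0 <= f i.+1 - f i by rewrite subr_ge0 mf.
  have h1 := dl _ lin.
  apply: le_trans (_ : (deg n (toep r) i.+1 - l) * (f i.+1 - f i) <= 1); last first.
    rewrite lap_eigen_diff //.
    apply: le_trans (_ : \sum_(k < n.-1) (f k.+1 - f k) <= 1); last first.
      by rewrite -(big_mkord xpredT (fun k => f k.+1 - f k)) telescope_sumr // fn.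
    apply: ler_sum => k _; have kn := ltn_ord k.
    rewrite -[leRHS]mul1r ler_wpM2r ?toep_diff_le1 // subr_ge0 mf; lia.
  by rewrite mulrC ler_wpM2r.
move=> i; elim=> [|j IH]; first by rewrite leqn0 => /eqP -> _; rewrite subrr subnn mul0r.
rewrite leq_eqVlt => /orP[/eqP -> _|ij jn]; first by rewrite subrr subnn mul0r.
have := IH ij (ltnW jn); have := step j jn.
rewrite subSn // -natr1 mulrDl; lra.
Qed.

(** By the upper slope bound the outer [z] indices on each side carry at most 1/8 of the total
    increase. At least half of it therefore lies in columns where the matrix entries are at least
    [kappa], whatever the row, while [deg - l] is at most n. *)
Lemma toep_slope_ge {R : realType} n (r f : nat -> R) (l c1 kappa : R) z :
  (1 < n)%N -> 0 < c1 -> 0 <= l ->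
  (forall k, (k < n)%N -> 0 < r k <= 1) ->
  (forall k l, (k <= l)%N -> (l < n)%N -> r l <= r k) ->
  (forall i, (i < n)%N -> c1 * n%:R <= deg n (toep r) i - l) ->
  (forall i, (i.+1 < n)%N -> f i <= f i.+1) -> f n.-1 - f 0%N = 1 ->
  (forall i, (i < n)%N -> lap n (toep r) f i = l * f i) ->
  0 <= kappa -> (forall k l, (l < n)%N -> (k + z <= l)%N -> kappa <= r k - r l) ->
  8 * z%:R <= c1 * n%:R -> (0 < z)%N -> (z + z <= n)%N ->
  forall i j, (i <= j)%N -> (j < n)%N -> kappa / 2 * (j - i)%:R / n%:R <= f j - f i.
Proof.
move=> n1 c1p l0 r01 rdec dl mf fn fe kp md zs z0 zn.
have nR : 0 < n%:R :> R by rewrite ltr0n; lia.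
have cn : 0 < c1 * n%:R by rewrite mulr_gt0.
have up := toep_slope_le n r f l c1 n1 c1p r01 dl mf fn fe.
have mid : 1 / 2 <= f (n - z)%N - f z.
  have h1 : f z - f 0%N <= z%:R / (c1 * n%:R) by rewrite -[in leRHS](subn0 z); apply: up; lia.
  have h2 : f n.-1 - f (n - z)%N <= z%:R / (c1 * n%:R).
    apply: le_trans (up _ _ _ _) _; [lia|lia|].
    by rewrite ler_pM2r ?invr_gt0 // ler_nat; lia.
  have h3 : z%:R / (c1 * n%:R) <= 1 / 8 by rewrite ler_pdivrMr //; lra.
  lra.
have step i : (i.+1 < n)%N -> kappa / 2 * 1 / n%:R <= f i.+1 - f i.
  move=> lin; rewrite ler_pdivrMr // mulr1.
  have gi : 0 <= f i.+1 - f i by rewrite subr_ge0 mf.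
  have dn : deg n (toep r) i.+1 - l <= n%:R.
    rewrite lerBlDr; apply: le_trans (_ : n%:R <= _); last by rewrite lerDl.
    apply: le_trans (_ : \sum_(j < n) 1 <= _); last by rewrite sumr_const card_ord.
    apply: ler_sum => j _; have jn := ltn_ord j.
    rewrite /toep /adist; have h : (i.+1 - j + (j - i.+1) < n)%N by clear -jn lin; lia.
    by have /andP[] := r01 _ h.
  apply: le_trans (_ : (deg n (toep r) i.+1 - l) * (f i.+1 - f i) <= _); last first.
    by rewrite mulrC ler_wpM2l.
  rewrite lap_eigen_diff //.
  apply: le_trans (_ : \sum_(k < n.-1) ((z <= k < n - z)%N)%:R * (kappa * (f k.+1 - f k)) <= _).
    rewrite (@sum_ord_ltn _ _ _ _ (fun k => kappa * (f k.+1 - f k))); try by clear -zn z0; lia.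
    by rewrite -mulr_sumr telescope_sumr; [clear -mid kp; nra|clear -zn; lia].
  apply: ler_sum => k _; have kn := ltn_ord k.
  have gk : 0 <= f k.+1 - f k by rewrite subr_ge0 mf //; clear -kn; lia.
  case: (boolP (z <= k < n - z)%N) => [/andP[zk kz]|_] /=.
    by rewrite mul1r ler_wpM2r // (toep_diff_ge n r kappa z) // leqW.
  by rewrite mul0r mulr_ge0 // toep_diff_ge0.
move=> i; elim=> [|j IH].
  by rewrite leqn0 => /eqP -> _; rewrite subrr subnn mulr0 mul0r.
rewrite leq_eqVlt => /orP[/eqP -> _|ij jn]; first by rewrite subrr subnn mulr0 mul0r.
have := IH ij (ltnW jn); have := step j jn.
rewrite subSn // -[(j - i).+1%:R]natr1 mulrDr mulrDl; lra.
Qed.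

(** Each index in the first quarter is paired with its mirror image; the slope forces the two values
    apart by at least [c / 4], so their squares cannot both be small. *)
Lemma sq_norm_ge_slope {R : realType} n (f : nat -> R) (c : R) :
  (4 <= n)%N -> 0 <= c ->
  (forall i j, (i <= j)%N -> (j < n)%N -> c * (j - i)%:R / n%:R <= f j - f i) ->
  c ^+ 2 / 512 * n%:R <= dotn n f f.
Proof.
move=> n4 c0 sl.
have nR : 0 < n%:R :> R by rewrite ltr0n; lia.
pose m := (n %/ 4)%N.
have mn : n%:R / 8 <= m%:R :> R.
  rewrite ler_pdivrMr // -natrM ler_nat /m; lia.
have E : dotn n f f = \sum_(i < n) f (n.-1 - i)%N ^+ 2.
  rewrite /dotn (reindex_inj rev_ord_inj) /=; apply: eq_bigr => i _.
  by rewrite expr2 (_ : (n - i.+1 = n.-1 - i)%N) //; lia.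
have H : \sum_(i < n) (f (n.-1 - i)%N - f i) ^+ 2 <= 4 * dotn n f f.
  have -> : 4 * dotn n f f = \sum_(i < n) (2 * f (n.-1 - i)%N ^+ 2 + 2 * (f i * f i)).
    rewrite big_split -!mulr_sumr /= -E -/(dotn n f f); ring.
  by apply: ler_sum => i _; have := sqr_ge0 (f (n.-1 - i)%N + f i); lra.
suff : m%:R * (c ^+ 2 / 16) <= \sum_(i < n) (f (n.-1 - i)%N - f i) ^+ 2.
  move: H mn; move: (\sum_(i < n) _) (dotn _ _ _) => S D; have := sqr_ge0 c; nra.
apply: le_trans (_ : \sum_(i < n) ((0 <= i < m)%N)%:R * (c ^+ 2 / 16) <= _).
  rewrite (@sum_ord_ltn _ n 0 m (fun=> c ^+ 2 / 16)) //; last by rewrite /m; lia.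
  by rewrite sumr_const_nat subn0 mulr_natl.
apply: ler_sum => i _; case: (boolP (0 <= i < m)%N) => im /=; last by rewrite mul0r sqr_ge0.
rewrite mul1r; have lin := ltn_ord i.
have h1 : c / 4 <= f (n.-1 - i)%N - f i.
  apply: le_trans (sl i (n.-1 - i)%N _ _); rewrite /m in im; try lia.
  rewrite ler_pdivlMr // -mulrA ler_wpM2l // mulrC ler_pdivrMr // -natrM ler_nat; lia.
rewrite (_ : c ^+ 2 / 16 = (c / 4) ^+ 2); last by field.
by rewrite ler_pXn2r // nnegrE; lra.
Qed.

Lemma sum_natr_le {R : realType} (m : nat) : \sum_(i < m) (i%:R : R) <= m%:R ^+ 2 / 2.
Proof.
elim: m => [|m IH]; first by rewrite big_ord0 expr0n /= mul0r.
rewrite big_ord_recr /= -[m.+1%:R]natr1; have := ler0n R m; nra.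
Qed.

(* The test vector is 1 on the first [m] indices and -1 on the last [m]. *)
Lemma toep_test {R : realType} n (r : nat -> R) m :
  (0 < m)%N -> (2 * m <= n)%N ->
  (forall k l, (k <= l)%N -> (l < n)%N -> r l <= r k) ->
  exists x : nat -> R, [/\ \sum_(i < n) x i = 0, dotn n x x = 2 * m%:R &
    dotn n x (lap n (toep r) x) <=
      2 * m%:R * (deg n (toep r) 0 + m%:R / 2 * (r 0%N - r n.-1 - 2 * r m + 2 * r (n - 2 * m)%N))].
Proof.
move=> m0 mn rdec.
pose a (j : nat) : R := ((0 <= j < m)%N)%:R.
pose b (j : nat) : R := ((n - m <= j < n)%N)%:R.
have sa (u : nat -> R) : \sum_(i < n) a i * u i = \sum_(i < m) u i.
  by rewrite /a sum_ord_ltn ?big_mkord //; lia.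
have sb (u : nat -> R) : \sum_(i < n) b i * u i = \sum_(i < m) u (n.-1 - i)%N.
  rewrite -(sa (fun i => u (n.-1 - i)%N)) [RHS](reindex_inj rev_ord_inj) /=; apply: eq_bigr => i _.
  have lin := ltn_ord i; congr (_%:R * u _); last lia.
  by rewrite /=; lia.
have a01 i : a i * a i = a i by rewrite /a; case: (_ <= _ < _)%N; rewrite ?mulr1 ?mulr0.
have b01 i : b i * b i = b i by rewrite /b; case: (_ <= _ < _)%N; rewrite ?mulr1 ?mulr0.
have ab0 i : a i * b i = 0.
  rewrite /a /b; case: (boolP (0 <= i < m)%N) => h; last by rewrite mul0r.
  by rewrite (_ : (_ <= _ < _)%N = false) ?mulr0 //; lia.
exists (fun i => a i - b i).
have s1 : \sum_(i < n) a i = m%:R.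
  under eq_bigr do rewrite -[a _]mulr1; by rewrite (sa (fun=> 1)) sumr_const card_ord.
have s2 : \sum_(i < n) b i = m%:R.
  under eq_bigr do rewrite -[b _]mulr1; by rewrite (sb (fun=> 1)) sumr_const card_ord.
split.
- by rewrite sumrB s1 s2 subrr.
- transitivity (\sum_(i < n) (a i + b i)); last by rewrite big_split /= s1 s2; ring.
  apply: eq_bigr => i _; rewrite -{3}(a01 i) -{3}(b01 i); have := ab0 i; lra.
set x := (fun i => _); set D := deg _ _ _.
(* The test vector is odd under reversal and the kernel is invariant, so the last [m] rows repeat
   the first [m] up to sign. *)
have lx i : (i < n)%N -> lap n (toep r) x (n.-1 - i)%N = - lap n (toep r) x i.
  move=> lin; rewrite /lap -sumrN (reindex_inj rev_ord_inj) /=; apply: eq_bigr => j _.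
  have ljn := ltn_ord j.
  rewrite (_ : toep r (n.-1 - i) (n - j.+1) = toep r i j); last first.
    by rewrite /toep /adist; congr r; lia.
  have xr k : (k < n)%N -> x (n.-1 - k)%N = - x k.
    move=> kn; rewrite /x /a /b opprB; congr (_%:R - _%:R); lia.
  rewrite (_ : (n - j.+1 = n.-1 - j)%N); last lia.
  rewrite !xr //; ring.
have -> : dotn n x (lap n (toep r) x) = 2 * \sum_(i < m) lap n (toep r) x i.
  rewrite /dotn; under eq_bigr do rewrite {1}/x mulrBl.
  rewrite sumrB sa sb (_ : \sum_(i < m) lap _ _ _ (n.-1 - i)%N = - \sum_(i < m) lap n (toep r) x i).
    ring.
  by rewrite -sumrN; apply: eq_bigr => i _; rewrite lx //; have := ltn_ord i; lia.
rewrite -mulrA ler_pM2l //.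
(* In row [i] the own block removes at least [m * r m] from the degree, and the opposite block adds
   at most [m * r (n - 2 * m)]. *)
have H (i : 'I_m) : lap n (toep r) x i <= D + i%:R * (r 0%N - r n.-1) - m%:R * r m + m%:R * r (n - 2 * m)%N.
  have lim := ltn_ord i.
  have xi : x i = 1.
    rewrite /x /a /b (_ : (0 <= i < m)%N = true) // (_ : (_ <= _ < _)%N = false) ?subr0 //; lia.
  have -> : lap n (toep r) x i = deg n (toep r) i - \sum_(j < n) a j * toep r i j
     + \sum_(j < n) b j * toep r i j.
    rewrite /lap /deg -sumrB -big_split; apply: eq_bigr => j _ /=; rewrite xi /x; ring.
  rewrite sa sb.
  have lin : (i < n)%N by lia.
  have h1 := deg_toep_le n r i lin rdec.
  have h2 : m%:R * r m <= \sum_(j < m) toep r i j.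
    rewrite -[X in X%:R * _]card_ord mulr_natl -sumr_const; apply: ler_sum => j _.
    by have := ltn_ord j; rewrite /toep /adist => ?; apply: rdec; lia.
  have h3 : \sum_(j < m) toep r i (n.-1 - j) <= m%:R * r (n - 2 * m)%N.
    rewrite -[X in _ <= X%:R * _]card_ord mulr_natl -sumr_const; apply: ler_sum => j _.
    by have := ltn_ord j; rewrite /toep /adist => ?; apply: rdec; lia.
  rewrite -/D in h1; move: h1 h2 h3.
  by move: (\sum_(j < m) _) (\sum_(j < m) _) => A B; lra.
have dl0 : r n.-1 <= r 0%N by apply: rdec; lia.
move: H dl0; move: (r 0%N - r n.-1) (subr_ge0 (r n.-1) (r 0%N)) (r m) (r (n - 2 * m)%N).
move=> Dl E rm rn H; rewrite -E => {E} Dl0.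
have [A EA] : exists A, A = D - m%:R * rm + m%:R * rn by exists (D - m%:R * rm + m%:R * rn).
have {}H (i : 'I_m) : true -> lap n (toep r) x i <= A + i%:R * Dl.
  by move=> _; rewrite EA; have := H i; lra.
apply: le_trans (ler_sum _ H) _.
rewrite big_split /= sumr_const card_ord -mulr_suml -mulr_natl EA.
have := sum_natr_le (R := R) m.
move: (\sum_(i < m) _) => S h1.
have h3 : 0 <= (m%:R ^+ 2 / 2 - S) * Dl by rewrite mulr_ge0 ?subr_ge0.
lra.
Qed.

(* Let [h] be an eigenvector orthogonal to [f] with eigenvalue close to [l], and [U] the
   largest ratio of the absolute increments of [h] to those of [f].  At an index attaining it, the
   increment equations of [f] and [h] bound a weighted sum of the nonnegative deficits
   [y = U (f i.+1 - f i) - (k i.+1 - k i)], with [k = h] or [k = - h].  Hence [k] is close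
   to [U f] up to a constant, against orthogonality. *)
Lemma toep_gap {R : realType} n (r f h : nat -> R) (l l' c1 c2 kappa theta : R) z :
  (1 < n)%N -> 0 < c1 -> 0 < c2 -> 0 < kappa -> 0 <= theta ->
  (forall k, (k < n)%N -> 0 < r k <= 1) ->
  (forall k l, (k <= l)%N -> (l < n)%N -> r l <= r k) ->
  (forall i, (i < n)%N -> c1 * n%:R <= deg n (toep r) i - l) ->
  f n.-1 - f 0%N = 1 -> \sum_(i < n) f i = 0 ->
  (forall i, (i < n)%N -> lap n (toep r) f i = l * f i) ->
  (forall i j, (i <= j)%N -> (j < n)%N -> f j - f i <= (j - i)%:R / (c1 * n%:R)) ->
  (forall i j, (i <= j)%N -> (j < n)%N -> c2 * (j - i)%:R / n%:R <= f j - f i) ->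
  (forall k l, (l < n)%N -> (k + z <= l)%N -> kappa <= r k - r l) -> (z + z <= n)%N -> (0 < z)%N ->
  (theta / (c1 * kappa) + 4 * z%:R / (c1 * n%:R)) * n%:R < 2 * dotn n f f ->
  (exists2 i, (i < n)%N & h i != 0) -> \sum_(i < n) h i = 0 -> dotn n f h = 0 ->
  (forall i, (i < n)%N -> lap n (toep r) h i = l' * h i) ->
  l' < l + theta * n%:R -> l <= l' -> False.
Proof.
move=> n1 c1p c2p kp th0 r01 rdec dl fn f0 fe up sl md zn z0 nu hn0 h0 hf he l'lt ll'.
have nR : 0 < n%:R :> R by rewrite ltr0n (ltn_trans _ n1).
have cn : 0 < c1 * n%:R by rewrite mulr_gt0.
have gp i : (i.+1 < n)%N -> 0 < f i.+1 - f i.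
  move=> lin; apply: lt_le_trans (sl i i.+1 _ lin); last by [].
  by rewrite subSnn divr_gt0 // mulr_gt0.
have n10 : (0 < n.-1)%N by clear -n1; lia.
pose q (i : 'I_n.-1) : R := `|h i.+1 - h i| / (f i.+1 - f i).
pose i1 := [arg max_(i > Ordinal n10 | true) q i]%O.
pose U0 := q i1.
have i1n : (i1.+1 < n)%N by have := ltn_ord i1; clear -n1; lia.
have Uub i : (i.+1 < n)%N -> `|h i.+1 - h i| <= U0 * (f i.+1 - f i).
  move=> lin; rewrite -ler_pdivrMr ?gp //.
  have lin' : (i < n.-1)%N by clear -lin; lia.
  have : q (Ordinal lin') <= U0 by rewrite /U0 /i1; case: arg_maxP => //= j _; exact.
  by [].
have U0p : 0 < U0.
  have U00 : 0 <= U0 by rewrite /U0 /q divr_ge0 // ltW // gp.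
  rewrite lt_neqAle U00 andbT; apply/negP => /eqP U0e.
  have hc i : (i < n)%N -> h i = h 0%N.
    elim: i => [//|i IH] lin; rewrite -IH; last exact: ltnW.
    apply/eqP; rewrite -subr_eq0 -normr_le0; have := Uub i lin; by rewrite -U0e mul0r.
  have : \sum_(i < n) h i = n%:R * h 0%N.
    rewrite (eq_bigr (fun=> h 0%N)); last by move=> i _; rewrite hc.
    by rewrite sumr_const card_ord mulr_natl.
  rewrite h0 => /esym/eqP; rewrite mulf_eq0 gt_eqF //= => /eqP h00.
  by case: hn0 => i lin; rewrite hc // h00 eqxx.
(* Passing to [k = s * h] makes the extremal increment positive, so that the deficit [y] vanishes at
   [i1]. *)
pose s : R := Num.sg (h i1.+1 - h i1).
have ss : `|s| <= 1 by rewrite /s normr_sg; case: (_ == _).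
pose k i : R := s * h i.
have k1 : k i1.+1 - k i1 = U0 * (f i1.+1 - f i1).
  rewrite /k -mulrBr -normrEsg /U0 /q divfK // gt_eqF // gp //.
have ke i : (i < n)%N -> lap n (toep r) k i = l' * k i.
  by move=> lin; rewrite lapZ he // /k; ring.
have k0 : \sum_(i < n) k i = 0 by rewrite -mulr_sumr h0 mulr0.
have kf : dotn n f k = 0 by rewrite dotnZr hf mulr0.
have Kub i : (i.+1 < n)%N -> `|k i.+1 - k i| <= U0 * (f i.+1 - f i).
  move=> lin; rewrite /k -mulrBr normrM; apply: le_trans (Uub i lin).
  by rewrite -[leRHS]mul1r ler_wpM2r.
pose y i : R := U0 * (f i.+1 - f i) - (k i.+1 - k i).
have y0 i : (i.+1 < n)%N -> 0 <= y i.
  by move=> lin; rewrite /y subr_ge0 (le_trans (ler_norm _)) // Kub.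
have y2 i : (i.+1 < n)%N -> y i <= 2 * U0 * (f i.+1 - f i).
  move=> lin; have := Kub i lin; have := ler_norm (- (k i.+1 - k i)).
  rewrite normrN /y; move: `|_| => A; lra.
(* Subtracting the two increment equations at [i1] cancels the degree and leaves [l' - l] times an
   increment; the first is at most [theta * n], the second of order 1/n. *)
have My : \sum_(i < n.-1) toep_diff n r i1 i * y i <= theta * U0 / c1.
  have -> : \sum_(i < n.-1) toep_diff n r i1 i * y i = (l' - l) * (U0 * (f i1.+1 - f i1)).
    transitivity (U0 * \sum_(i < n.-1) toep_diff n r i1 i * (f i.+1 - f i)
       - \sum_(i < n.-1) toep_diff n r i1 i * (k i.+1 - k i)).
      by rewrite mulr_sumr -sumrB; apply: eq_bigr => i _; rewrite /y; ring.
    rewrite -(lap_eigen_diff n r f l i1) // -(lap_eigen_diff n r k l' i1) // k1; ring.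
  have h1 := up i1 i1.+1 (leqnSn _) i1n; rewrite subSnn in h1.
  apply: le_trans (_ : theta * n%:R * (U0 * (1 / (c1 * n%:R))) <= _).
    apply: ler_pM; [lra| |lra|by rewrite ler_pM2l].
    by rewrite mulr_ge0 // ltW // gp.
  by rewrite le_eqVlt; apply/orP; left; apply/eqP; field; rewrite !gt_eqF.
pose Y : R := \sum_(i < n.-1) y i.
(* In the middle the matrix entries are at least [kappa]; near the two ends only the bound of [y] by
   twice [U0] times the increment of [f] is at hand, and there the upper slope limits the loss. *)
have Yle : Y <= U0 * (theta / (c1 * kappa) + 4 * z%:R / (c1 * n%:R)).
  have Ysplit : Y = \sum_(0 <= i < z.-1) y i + \sum_(z.-1 <= i < n - z) y i + \sum_(n - z <= i < n.-1) y i.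
    rewrite /Y -(big_mkord xpredT y) (@big_cat_nat _ _ _ (n - z) 0) //=; last by clear -z0 zn; lia.
    by rewrite (@big_cat_nat _ _ _ z.-1 0 (n - z)) //=; clear -z0 zn; lia.
  have tele a b : (a <= b)%N -> (b < n)%N -> \sum_(a <= i < b) y i <= 2 * U0 * ((b - a)%:R / (c1 * n%:R)).
    move=> ab bn; apply: le_trans (_ : 2 * U0 * (f b - f a) <= _); last first.
      by rewrite ler_pM2l ?up // mulr_gt0.
    rewrite -telescope_sumr // mulr_sumr; apply: ler_sum_nat => i /andP[_ ib].
    by apply: y2; clear -ib bn; lia.
  have h1 := tele 0%N z.-1 isT; rewrite subn0 in h1.
  have h2 := tele (n - z)%N n.-1.
  have zl a : (a <= z)%N -> 2 * U0 * (a%:R / (c1 * n%:R)) <= 2 * U0 * (z%:R / (c1 * n%:R)).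
    move=> az; apply: ler_wpM2l; first by rewrite mulr_ge0 // ltW.
    by apply: ler_wpM2r; rewrite ?invr_ge0 ?ler_nat // ltW.
  have {}h1 : \sum_(0 <= i < z.-1) y i <= 2 * U0 * (z%:R / (c1 * n%:R)).
    by apply: le_trans (h1 _) (zl _ _); clear -z0 zn; lia.
  have {}h2 : \sum_(n - z <= i < n.-1) y i <= 2 * U0 * (z%:R / (c1 * n%:R)).
    by apply: le_trans (h2 _ _) (zl _ _); clear -z0 zn; lia.
  have h3 : kappa * \sum_(z.-1 <= i < n - z) y i <= theta * U0 / c1.
    apply: le_trans My; rewrite mulr_sumr.
    rewrite -(@sum_ord_ltn _ n.-1 _ _ (fun i => kappa * y i)); last 2 first.
    - by clear -z0 zn; lia.
    - by clear -z0 zn; lia.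
    apply: ler_sum => i _; have lin := ltn_ord i.
    have yi : 0 <= y i by apply: y0; clear -lin; lia.
    case: (boolP (z.-1 <= i < n - z)%N) => [/andP[zi iz]|_] /=.
      rewrite mul1r ler_wpM2r // (toep_diff_ge n r kappa z) //.
      by clear -zi; lia.
    by rewrite mul0r mulr_ge0 // toep_diff_ge0.
  have {}h3 : \sum_(z.-1 <= i < n - z) y i <= U0 * (theta / (c1 * kappa)).
    rewrite -(ler_pM2l kp); apply: le_trans h3 _.
    by rewrite le_eqVlt; apply/orP; left; apply/eqP; field; rewrite !gt_eqF.
  rewrite Ysplit mulrDr; move: h1 h2 h3.
  rewrite -[4 * z%:R / _]mulrA.
  move: (\sum_(0 <= i < _) _) (\sum_(_ <= i < n - z) _) (\sum_(n - z <= i < _) _) => B1 B2 B3.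
  lra.
have Y0 : 0 <= Y by apply: sumr_ge0 => i _; apply: y0; have := ltn_ord i; clear; lia.
have ypart i j : (i <= j)%N -> (j < n)%N -> U0 * (f j - f i) - (k j - k i) <= Y.
  move=> ij jn.
  have -> : U0 * (f j - f i) - (k j - k i) = \sum_(i <= q < j) y q.
    by rewrite -!telescope_sumr // mulr_sumr -sumrB.
  rewrite -(@sum_ord_ltn _ n.-1) //; last by clear -jn; lia.
  apply: ler_sum => p _; have yp : 0 <= y p by apply: y0; have := ltn_ord p; clear; lia.
  by case: (_ <= _ < _)%N; rewrite ?mul1r ?mul0r.
have f1 i j : (i <= j)%N -> (j < n)%N -> 0 <= f j - f i <= 1.
  move=> ij jn.
  have h1 a b : (a <= b)%N -> (b < n)%N -> f a <= f b.
    move=> ab bn; rewrite -subr_ge0; apply: le_trans (sl a b ab bn).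
    by rewrite divr_ge0 // mulr_ge0 // ltW.
  have := h1 i j ij jn; have := h1 0%N i isT (leq_ltn_trans ij jn).
  have : f j <= f n.-1 by apply: h1; clear -jn; lia.
  by move: fn; clear; lra.
(* The deficits add up to at most [Y], so [k] follows [U0 * f] up to [Y], and the values of [f] span
   an interval of length 1. Summed over all pairs, the right side is a multiple of the inner product
   of [f] and [k], which is 0. *)
have pos i j : (i < n)%N -> (j < n)%N ->
    U0 * ((f i - f j) * (f i - f j)) - Y <= (k i - k j) * (f i - f j).
  wlog ij : i j / (j <= i)%N.
    move=> H lin ljn; have [ji|ij] := leqP j i; first exact: H.
    by have := H j i (ltnW ij) ljn lin; clear; lra.
  move=> lin ljn; have := ypart j i ij lin; have := f1 j i ij lin.
  move: (f i - f j) (k i - k j) => a b; clear -Y0; nra.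
have : \sum_(i < n) \sum_(j < n) (U0 * ((f i - f j) * (f i - f j)) - Y) <=
    \sum_(i < n) \sum_(j < n) (k i - k j) * (f i - f j).
  by apply: ler_sum => i _; apply: ler_sum => j _; apply: pos.
rewrite -dotn_cov k0 mul0r subr0 dotnC kf mulr0 mulr0.
under eq_bigr do rewrite sumrB -mulr_sumr sumr_const card_ord.
rewrite sumrB -mulr_sumr -dotn_cov f0 mul0r subr0 sumr_const card_ord
  -[Y *+ n]mulr_natl -[(n%:R * Y) *+ n]mulr_natl.
move: nu Yle; move: (theta / _ + _) (dotn n f f) => nu D h1 h2 h3.
have h4 : n%:R * Y <= n%:R * (U0 * nu) by rewrite ler_pM2l.
have h5 : U0 * (nu * n%:R) < U0 * (2 * D) by rewrite ltr_pM2l.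
have h6 : n%:R * (U0 * (2 * D) - n%:R * Y) <= 0 by lra.
have : 0 < U0 * (2 * D) - n%:R * Y by lra.
by rewrite -(pmulr_rgt0 _ nR) ltNge h6.
Qed.

(** The derivative of the profile may tend to 0 at both ends of the interval; hence a Lipschitz
    bound everywhere, but a slope bound only at distance [eta] from the ends. *)
Definition decay_profile {R : realType} (rho : R -> R) (Lam : R) : Prop :=
  [/\ 0 < Lam, forall x, 0 <= x <= 1 -> 0 < rho x <= 1,
      forall x y, 0 <= x -> x <= y -> y <= 1 -> 0 <= rho x - rho y <= Lam * (y - x)
    & forall eta, 0 < eta -> exists2 kappa, 0 < kappa &
        forall x y, eta <= x -> x <= y -> y <= 1 - eta -> kappa * (y - x) <= rho x - rho y].

(** Cutting [eta / 3] off both ends of the unit interval leaves at least a third of any subinterval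
    of length [eta], and monotonicity covers the rest; so the drop is uniform although the slope is
    not. *)
Lemma decay_profile_drop {R : realType} (rho : R -> R) (Lam eta : R) :
  decay_profile rho Lam -> 0 < eta <= 1 ->
  exists2 kappa, 0 < kappa &
    forall x y, 0 <= x -> x + eta <= y -> y <= 1 -> kappa <= rho x - rho y.
Proof.
move=> [_ _ mono slope] /andP[e0 e1].
have e3 : 0 < eta / 3 by rewrite divr_gt0.
have [kappa kp H] := slope _ e3.
exists (kappa * (eta / 3)); first exact: mulr_gt0.
move=> x y x0 xy y1.
pose x' := Num.max x (eta / 3); pose y' := Num.min y (1 - eta / 3).
have hx : x <= x' /\ eta / 3 <= x' by rewrite /x' !le_max !lexx orbT.
have hy : y' <= y /\ y' <= 1 - eta / 3 by rewrite /y' !ge_min !lexx orbT.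
have hxy : x' + eta / 3 <= y'.
  rewrite /x' /y' addr_maxl ge_max !le_min; apply/andP; split; apply/andP; split; lra.
have := H x' y' hx.2 _ hy.2; have := mono x x' x0 hx.1; have := mono y' y _ hy.1 y1.
have : kappa * (eta / 3) <= kappa * (y' - x') by rewrite ler_pM2l //; lra.
case: hx hy => hx1 hx2 [hy1 hy2].
have a1 : 0 <= y' by lra. have a2 : x' <= 1 by lra. have a3 : x' <= y' by lra.
move=> b1 /(_ a1) /andP[b2 _] /(_ a2) /andP[b3 _] /(_ a3); lra.
Qed.

Lemma nat_floor {R : realType} (eta : R) (n : nat) : 0 < eta -> 2 / eta <= n%:R ->
  exists z : nat, [/\ (0 < z)%N, z%:R <= eta * n%:R & eta * n%:R / 2 <= z%:R].
Proof.
move=> e0; rewrite ler_pdivrMr // mulrC => hn.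
exists (Num.truncn (eta * n%:R)).
have h0 : 0 <= eta * n%:R by lra.
have /andP[h1 h2] := truncn_itv h0.
have h3 : 1 < (Num.truncn (eta * n%:R))%:R :> R by rewrite -natr1 in h2; lra.
split => //; last by rewrite -natr1 in h2; lra.
by rewrite ltr1n in h3; exact: ltnW.
Qed.

Definition grid {R : realType} (rho : R -> R) (n k : nat) : R := rho (k%:R / n%:R).

Lemma grid_ratio {R : realType} n k l : (l < n)%N -> (k <= l)%N ->
  [/\ 0 <= k%:R / n%:R :> R, k%:R / n%:R <= l%:R / n%:R :> R & l%:R / n%:R <= 1 :> R].
Proof.
move=> ln kl; have nR : 0 < n%:R :> R by rewrite ltr0n (leq_ltn_trans _ ln).
split; first by rewrite divr_ge0.
  by rewrite ler_pM2r ?invr_gt0 // ler_nat.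
by rewrite ler_pdivrMr // mul1r ler_nat ltnW.
Qed.

(** The constants depend on [rho] alone and are fixed in the order block size [delta], margin [c1],
    slope [c2], norm [c4], gap [theta]. The size n only has to be large enough for lengths
    proportional to n to be rounded. *)
Lemma toep_reference {R : realType} (rho : R -> R) (Lam : R) : decay_profile rho Lam ->
  exists c1 c2 c4 theta : R, [/\ 0 < c1, 0 < c2, 0 < c4 & 0 < theta] /\
  exists n0 : nat, forall n : nat, (n0 <= n)%N -> exists (l : R) (f : nat -> R),
    [/\ 0 <= l, \sum_(i < n) f i = 0 & forall i, (i < n)%N -> `|f i| <= 1] /\
    [/\ forall i j, (i <= j)%N -> (j < n)%N -> c2 * (j - i)%:R / n%:R <= f j - f i,
       forall i, (i < n)%N -> lap n (toep (grid rho n)) f i = l * f i,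
       forall i, (i < n)%N -> c1 * n%:R <= deg n (toep (grid rho n)) i - l,
       c4 * n%:R <= dotn n f f &
       forall x : nat -> R, \sum_(i < n) x i = 0 -> dotn n f x = 0 ->
         (l + theta * n%:R) * dotn n x x <= dotn n x (lap n (toep (grid rho n)) x)].
Proof.
move=> P; have [L0 r01 mono slope] := P.
pose D := rho 0 - rho 1.
have D0 : 0 < D.
  have h01 : 0 < (1 : R) <= 1 by lra.
  have [kappa kp H] := decay_profile_drop rho Lam 1 P h01.
  have h : 0 + 1 <= (1 : R) by lra.
  have := H 0 1 (lexx _) h (lexx _); rewrite /D; lra.
have D1 : D <= 1.
  have := r01 0; have := r01 1; rewrite !lexx ler01 => /(_ isT) ? /(_ isT) ?; rewrite /D; lra.
(* With blocks of length about [delta * n] the Lipschitz bound costs [6 * Lam * delta], at most half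
   of the total drop [D]. *)
have [delta Edelta] : exists x, x = D / (12 * (Lam + 1)) by exists (D / (12 * (Lam + 1))).
have d0 : 0 < delta by rewrite Edelta divr_gt0 // mulr_gt0 //; lra.
have dL : 6 * Lam * delta <= D / 2.
  rewrite Edelta mulrA ler_pdivrMr; last by rewrite mulr_gt0 //; lra.
  nra.
have d8 : delta <= 1 / 12.
  rewrite Edelta ler_pdivrMr; last by rewrite mulr_gt0 //; lra.
  nra.
(* The test vector gains [m / 2 * (D / 2)] over the end degree, and [m] is at least
   [delta * n / 2]. *)
have [c1 Ec1] : exists x, x = delta * D / 8 by exists (delta * D / 8).
have c1p : 0 < c1 by rewrite Ec1 divr_gt0 // mulr_gt0.
have c1s : c1 <= 1 / 96 by rewrite Ec1; nra.
have e1 : 0 < c1 / 16 <= 1 by lra.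
have [k1 k1p K1] := decay_profile_drop rho Lam (c1 / 16) P e1.
have [c2 Ec2] : exists x, x = k1 / 2 by exists (k1 / 2).
have c2p : 0 < c2 by rewrite Ec2 divr_gt0.
have [c4 Ec4] : exists x, x = c2 ^+ 2 / 512 by exists (c2 ^+ 2 / 512).
have c4p : 0 < c4 by rewrite Ec4; have := exprn_gt0 2 c2p; lra.
have k11 : k1 <= 1.
  have h : 0 + c1 / 16 <= 1 by lra.
  have := K1 0 1 (lexx _) h (lexx _); rewrite -/D; lra.
have c4s : c4 <= 1 by rewrite Ec4 Ec2; nra.
(* [e2] makes the end term [4 * z / (c1 * n)] of the gap estimate at most [c4], and [theta] makes
   its other term [c4 / 2]; together they stay below [2 * c4]. *)
have [e2 Ee2] : exists x, x = c1 * c4 / 4 by exists (c1 * c4 / 4).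
have e2p : 0 < e2 by rewrite Ee2 divr_gt0 // mulr_gt0.
have e2s : e2 <= 1 / 4 by rewrite Ee2; nra.
have e2h : 0 < e2 / 2 <= 1 by clear -e2p e2s; lra.
have [k2 k2p K2] := decay_profile_drop rho Lam (e2 / 2) P e2h.
have [theta Etheta] : exists x, x = c1 * k2 * c4 / 2 by exists (c1 * k2 * c4 / 2).
have thp : 0 < theta by rewrite Etheta; apply: divr_gt0; [apply: mulr_gt0 => //; exact: mulr_gt0|exact: ltr0n].
exists c1, c2, c4, theta; split; first by split.
pose B := 4 + 2 / delta + 2 / (c1 / 8) + 2 / e2.
exists (Num.truncn B).+1; move=> n hn.
have b1 : 0 < 2 / delta by rewrite divr_gt0.
have b2 : 0 < 2 / (c1 / 8) by rewrite !divr_gt0.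
have b3 : 0 < 2 / e2 by rewrite divr_gt0.
have Bn : B <= n%:R.
  have h0 : 0 <= B by rewrite /B; clear -b1 b2 b3; lra.
  have /andP[_ h] := truncn_itv h0.
  by apply: le_trans (ltW h) _; rewrite ler_nat.
have n4 : (4 <= n)%N by rewrite -(ler_nat R); rewrite /B in Bn; clear -Bn b1 b2 b3; lra.
have B1 : 2 / delta <= n%:R by rewrite /B in Bn; clear -Bn b1 b2 b3; lra.
have B2 : 2 / (c1 / 8) <= n%:R by rewrite /B in Bn; clear -Bn b1 b2 b3; lra.
have B3 : 2 / e2 <= n%:R by rewrite /B in Bn; clear -Bn b1 b2 b3; lra.
have c18 : 0 < c1 / 8 by rewrite divr_gt0.
have [m [m0 mle mge]] := nat_floor delta n d0 B1.
have [z1 [z10 z1le z1ge]] := nat_floor (c1 / 8) n c18 B2.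
have [z2 [z20 z2le z2ge]] := nat_floor e2 n e2p B3.
have n1 : (1 < n)%N by clear -n4; lia.
have n0 : (0 < n)%N by clear -n4; lia.
have nR : 0 < n%:R :> R by rewrite ltr0n.
pose r := grid rho n; rewrite -/r.
have rr01 k : (k < n)%N -> 0 < r k <= 1.
  by move=> kn; have [h1 h2 h3] := @grid_ratio R n k k kn (leqnn k); apply: r01; rewrite h1.
have rdec k q : (k <= q)%N -> (q < n)%N -> r q <= r k.
  move=> kq qn; have [h1 h2 h3] := @grid_ratio R n k q qn kq.
  by have /andP[] := mono _ _ h1 h2 h3; rewrite subr_ge0.
have md (z : nat) (e k0 : R) :
    (forall x y, 0 <= x -> x + e <= y -> y <= 1 -> k0 <= rho x - rho y) -> e * n%:R <= z%:R ->
    forall k q, (q < n)%N -> (k + z <= q)%N -> k0 <= r k - r q.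
  move=> K ez k q qn kq; have [h1 h2 h3] := @grid_ratio R n k q qn (leq_trans (leq_addr _ _) kq).
  apply: K => //; rewrite -lerBrDl -mulrBl ler_pdivlMr //; apply: le_trans ez _.
  by rewrite -natrB ?ler_nat; clear -kq; lia.
have m2n : (2 * m <= n)%N by rewrite -(ler_nat R) natrM; clear -mle d8 nR; nra.
have z2n : (z2 + z2 <= n)%N by rewrite -(ler_nat R) natrD; clear -z2le e2s nR; nra.
have z1n : (z1 + z1 <= n)%N by rewrite -(ler_nat R) natrD; clear -z1le c1s nR; nra.
have [x [x0 xx xL]] := toep_test n r m m0 m2n rdec.
set rho' := deg n (toep r) 0 + _ in xL.
have rho'le : rho' <= deg n (toep r) 0 - c1 * n%:R.
  rewrite /rho' lerD2l.
  have h1 : r 0%N - r n.-1 <= D.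
    have n1n : (n.-1 < n)%N by clear -n0; lia.
    have [h1 h2 h3] := @grid_ratio R n 0 n.-1 n1n isT.
    have /andP[h4 _] := mono _ _ (le_trans h1 h2) h3 (lexx _).
    rewrite /r /grid mul0r /D; clear -h4; lra.
  have mn : (m < n)%N by clear -m2n m0; lia.
  have h2 : D - 3 * Lam * delta <= r m - r (n - 2 * m)%N.
    have [g1 g2 g3] := @grid_ratio R n 0 m mn isT; rewrite mul0r in g1 g2.
    have q1 : m%:R / n%:R <= delta by rewrite ler_pdivrMr.
    have q2 : (n - 2 * m)%:R / n%:R = 1 - 2 * (m%:R / n%:R) :> R.
      by rewrite natrB // natrM mulrBl divff ?gt_eqF // mulrA.
    have q3 : 0 <= 1 - 2 * (m%:R / n%:R) :> R by rewrite -q2.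
    have q4 : 1 - 2 * (m%:R / n%:R) <= 1 :> R by rewrite lerBlDr lerDl mulr_ge0.
    have /andP[_ u1] := mono _ _ (lexx _) g2 g3.
    have /andP[_ u2] := mono _ _ q3 q4 (lexx _).
    rewrite /r /grid q2 /D.
    have : Lam * (m%:R / n%:R) <= Lam * delta by rewrite ler_pM2l.
    move: u1 u2; rewrite subr0; clear; move: (m%:R / n%:R) => t; lra.
  have h3 : r 0%N - r n.-1 - 2 * r m + 2 * r (n - 2 * m)%N <= - (D / 2) by clear -h1 h2 dL; lra.
  have h4 : delta * n%:R / 4 <= m%:R / 2 by clear -mge; lra.
  have h5 : 0 <= m%:R / 2 :> R by rewrite divr_ge0.
  apply: le_trans (ler_wpM2l h5 h3) _.
  rewrite mulrN lerN2 Ec1; clear -h4 D0.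
  have -> : delta * D / 8 * n%:R = delta * n%:R / 4 * (D / 2) by field.
  by rewrite ler_wpM2r // divr_ge0 // ltW.
have z00 : \sum_(i < n) (fun=> 0 : R) i = 0 by rewrite big1.
have zl i : (i < n)%N -> lap n (toep r) (fun=> 0) i = 0 * (fun=> 0 : R) i.
  by move=> _; rewrite /lap big1 ?mul0r // => j _; rewrite subr0 mulr0.
have dz (y : nat -> R) : dotn n (fun=> 0) y = 0 by rewrite /dotn big1 // => i _; rewrite mul0r.
have m2R : 0 < 2 * m%:R :> R by rewrite mulr_gt0 // ltr0n.
(* The zero vector in place of [f] leaves only the zero-sum constraint. The threshold [rho' + 1]
   lies above the quotient of the test vector, which excludes the first alternative. *)
have [bad|[l [h [lt hn0 [h0 _] he hmin]]]] :=
    lap_constrained_min n (toep r) (fun=> 0) 0 (rho' + 1) n0 (toep_sym r) z00 zl.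
  by have := le_trans (bad x x0 (dz x)) xL; rewrite xx mulrC ler_pM2l //; clear; lra.
have {}hmin (y : nat -> R) : \sum_(i < n) y i = 0 -> l * dotn n y y <= dotn n y (lap n (toep r) y).
  by move=> y0; apply: hmin.
have lrho : l <= rho'.
  by have := le_trans (hmin x x0) xL; rewrite xx mulrC ler_pM2l.
have dl i : (i < n)%N -> c1 * n%:R <= deg n (toep r) i - l.
  by move=> lin; have := deg_toep_ge n r i lin rdec; clear -lrho rho'le; lra.
have cnp : 0 < c1 * n%:R by rewrite mulr_gt0.
have dl' i : (i < n)%N -> l <= deg n (toep r) i.
  by move=> lin; have := dl i lin; clear -cnp; lra.
have l0 : 0 <= l.
  case: hn0 => i lin hi; have hp := dotn_gt0 n h i lin hi.
  have : dotn n h (lap n (toep r) h) = l * dotn n h h.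
    by rewrite -dotnZr; apply: eq_dotn => // k kn; rewrite he.
  have : 0 <= 2 * dotn n h (lap n (toep r) h).
    rewrite dotn_lap; last exact: toep_sym.
    apply: sumr_ge0 => a _; apply: sumr_ge0 => b _; rewrite mulr_ge0 ?sqr_ge0 //.
    have hab : (adist a b < n)%N by have := ltn_ord a; have := ltn_ord b; rewrite /adist; clear; lia.
    by have /andP[/ltW] := rr01 _ hab.
  by move=> h1 h2; rewrite -(pmulr_lge0 _ hp) -h2; clear -h1; lra.
have [F [mF F01 F0 Fe]] := toep_monotone_eigen n r l h n0 rdec dl' hn0 h0 he hmin.
pose G := F n.-1 - F 0%N.
have G0 : 0 < G by rewrite subr_gt0.
(* Normalized to total increase 1; together with the zero sum this also gives the sup bound by 1. *)
pose f i := G^-1 * F i.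
have mf i : (i.+1 < n)%N -> f i <= f i.+1.
  by move=> lin; rewrite /f ler_pM2l ?invr_gt0 // mF.
have f0 : \sum_(i < n) f i = 0 by rewrite -mulr_sumr F0 mulr0.
have fn : f n.-1 - f 0%N = 1 by rewrite /f -mulrBr mulVf // gt_eqF.
have fe i : (i < n)%N -> lap n (toep r) f i = l * f i.
  by move=> lin; rewrite lapZ Fe // mulrCA.
have md1 := md z1 _ _ K1 (_ : c1 / 16 * n%:R <= z1%:R).
have {}md1 : forall k q, (q < n)%N -> (k + z1 <= q)%N -> k1 <= r k - r q.
  by apply: md1; clear -z1ge; lra.
have md2 : forall k q, (q < n)%N -> (k + z2 <= q)%N -> k2 <= r k - r q.
  by apply: (md z2 _ _ K2); clear -z2ge; lra.
have z1s : 8 * z1%:R <= c1 * n%:R by clear -z1le; lra.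
have up := toep_slope_le n r f l c1 n1 c1p rr01 dl mf fn fe.
have sl := toep_slope_ge n r f l c1 k1 z1 n1 c1p l0 rr01 rdec dl mf fn fe (ltW k1p) md1 z1s z10 z1n.
rewrite -Ec2 in sl.
have ff := sq_norm_ge_slope n f c2 n4 (ltW c2p) sl; rewrite -Ec4 in ff.
exists l, f; split; split => //.
  move=> i lin.
  have mono_f := monotone_le n f mf.
  have f_neg : f 0%N <= 0.
    rewrite leNgt; apply/negP => f0p.
    have : 0 < \sum_(i < n) f i.
      apply: lt_le_trans (_ : \sum_(i < n) f 0%N <= _).
        by rewrite sumr_const card_ord pmulrn_lgt0.
      by apply: ler_sum => j _; apply: mono_f.
    by rewrite f0 ltxx.
  have f_pos : 0 <= f n.-1.
    rewrite leNgt; apply/negP => f0p.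
    have : \sum_(i < n) f i < 0.
      apply: le_lt_trans (_ : _ <= \sum_(i < n) f n.-1) _.
        by apply: ler_sum => j _; apply: mono_f; have := ltn_ord j; clear -n0; lia.
      by rewrite sumr_const card_ord pmulrn_llt0.
    by rewrite f0 ltxx.
  have g1 : f 0%N <= f i by apply: mono_f.
  have g2 : f i <= f n.-1 by apply: mono_f; clear -lin; lia.
  by rewrite ler_norml; clear -g1 g2 f_pos f_neg fn; apply/andP; split; lra.
have [//|[l' [h' [lt' hn0' [h0' hf'] he' hmin']]]] :=
    lap_constrained_min n (toep r) f l (l + theta * n%:R) n0 (toep_sym r) f0 fe.
exfalso.
have hp : 0 < dotn n h' h' by case: hn0' => i lin hi; exact: (dotn_gt0 n h' i).
have ll' : l <= l'.
  have := hmin h' h0'; rewrite (@eq_dotn _ _ _ (lap n (toep r) h') h' (fun i => l' * h' i)) //.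
  by rewrite dotnZr ler_pM2r.
apply: (toep_gap n r f h' l l' c1 c2 k2 theta z2) => //; first exact: ltW.
apply: lt_le_trans (_ : 2 * (c4 * n%:R) <= _); last by rewrite ler_pM2l.
have -> : theta / (c1 * k2) = c4 / 2.
  by rewrite Etheta; field; rewrite !gt_eqF.
have : 4 * z2%:R / (c1 * n%:R) <= c4.
  by rewrite ler_pdivrMr //; move: z2le; rewrite Ee2; clear; lra.
move: (4 * _ / _) => t tc; rewrite mulrA ltr_pM2r //; clear -tc c4p; lra.
Qed.

(* [Lam] bounds the derivative, and compactness bounds it away from 0 on [eta, 1 - eta]. *)
Lemma C1_decay_profile {R : realType} (rho : R -> R) :
  (forall x : R, 0 <= x <= 1 -> 0 < rho x <= 1) ->
  C1_on01 rho ->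
  (forall x : R, 0 < x < 1 -> derive1 rho x < 0) ->
  exists Lam, decay_profile rho Lam.
Proof.
move=> r01 [cr dr [g [cg gE]]] dneg.
have sub (a b : R) : 0 <= a -> b <= 1 ->
    (`[a, b]%classic `<=` [set x : R | (0 <= x <= 1)%R])%classic.
  by move=> a0 b1 x /=; rewrite in_itv /= => /andP[h1 h2]; apply/andP; split; lra.
have mvt x y : 0 <= x -> x < y -> y <= 1 ->
    exists2 c, x < c < y & rho y - rho x = g c * (y - x).
  move=> x0 xy y1.
  have [|c] := @MVT R rho (fun c => g c) x y xy _ (continuous_subspaceW (sub x y x0 y1) cr).
    move=> c; rewrite in_itv /= => /andP[c0 c1].
    have c01 : 0 < c < 1 by apply/andP; split; lra.
    have := derivableP (dr c c01); rewrite -derive1E gE //.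
  by rewrite in_itv /= => cxy E; exists c.
have gneg c : 0 < c < 1 -> g c < 0 by move=> c01; rewrite -gE // dneg.
have l01 : (0 : R) <= 1 by [].
have cg01 := continuous_subspaceW (sub 0 1 (lexx _) (lexx _)) cg.
have [c _ cmin] := EVT_min l01 cg01.
exists (`|g c| + 1); split.
- by rewrite ltr_wpDl.
- exact: r01.
- move=> x y x0 xy y1; move: xy; rewrite le_eqVlt => /orP[/eqP ->|xy].
    by rewrite !subrr mulr0 lexx.
  have [d /andP[d0 d1] E] := mvt x y x0 xy y1.
  have d01 : 0 < d < 1 by apply/andP; split; lra.
  have h1 := gneg d d01.
  have h2 : g c <= g d by apply: cmin; rewrite in_itv /=; apply/andP; split; lra.
  have h3 : - g c <= `|g c| by rewrite -normrN ler_norm.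
  apply/andP; split; first by nra.
  have -> : rho x - rho y = - (g d) * (y - x) by lra.
  by apply: ler_wpM2r; lra.
move=> eta e0; have [e1|e1] := leP eta (1 - eta); last first.
  by exists 1 => // x y h1 h2 h3; exfalso; lra.
have cge : {within `[eta, 1 - eta]%classic, continuous g}%classic.
  by apply: continuous_subspaceW cg; apply: sub; lra.
have [d dI dmax] := EVT_max e1 cge.
have d01 : 0 < d < 1.
  by move: dI; rewrite in_itv /= => /andP[h1 h2]; apply/andP; split; lra.
exists (- g d); first by rewrite oppr_gt0 gneg.
move=> x y x0 xy y1; move: xy; rewrite le_eqVlt => /orP[/eqP ->|xy].
  by rewrite !subrr mulr0.
have x00 : 0 <= x by lra. have y11 : y <= 1 by lra.
have [z /andP[z0 z1] E] := mvt x y x00 xy y11.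
have -> : rho x - rho y = - (g z) * (y - x) by lra.
apply: ler_wpM2r; first by lra.
by rewrite lerN2; apply: dmax; rewrite in_itv /=; apply/andP; split; lra.
Qed.

(** * Perturbation of the Fiedler vector *)

Definition sgb {R : realType} (b : bool) : R := if b then 1 else -1.

Lemma norm_sgb {R : realType} (a : R) : `|a| = sgb (0 <= a) * a.
Proof.
rewrite /sgb; case: (leP 0 a) => h; first by rewrite ger0_norm // mul1r.
by rewrite ltr0_norm // mulN1r.
Qed.

(** A bilinear form is maximal over the cube at sign vectors: each entry of [v], and after that each
    entry of [u], can be replaced by the sign of its coefficient. *)
Lemma cut_bound_cube {R : realType} n (B : nat -> nat -> R) (K : R) :
  (forall s t : nat -> bool, \sum_(i < n) \sum_(j < n) sgb (s i) * B i j * sgb (t j) <= K) ->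
  forall u v : nat -> R, (forall i, (i < n)%N -> `|u i| <= 1) -> (forall i, (i < n)%N -> `|v i| <= 1) ->
  \sum_(i < n) \sum_(j < n) u i * B i j * v j <= K.
Proof.
move=> cut u v u1 v1.
pose t j := 0 <= \sum_(i < n) u i * B i j.
pose s i := 0 <= \sum_(j < n) B i j * sgb (t j) :> R.
apply: le_trans (cut s t).
apply: le_trans (_ : \sum_(i < n) \sum_(j < n) u i * B i j * sgb (t j) <= _).
  rewrite exchange_big [leRHS]exchange_big /=; apply: ler_sum => j _.
  rewrite -!mulr_suml mulrC [leRHS]mulrC -norm_sgb.
  apply: le_trans (ler_norm _) _; rewrite normrM -[leRHS]mul1r.
  by apply: ler_wpM2r => //; exact: v1.
apply: ler_sum => i _.
under eq_bigr do rewrite -mulrA; under [leRHS]eq_bigr do rewrite -mulrA.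
rewrite -!mulr_sumr -norm_sgb.
apply: le_trans (ler_norm _) _; rewrite normrM -[leRHS]mul1r.
by apply: ler_wpM2r => //; exact: u1.
Qed.

(* Two Cauchy-Schwarz steps reduce to the sum of the squared entries of [B ^ 2], which is a
   sum of [n ^ 2] bilinear forms of [B] evaluated at vectors with entries in [-1, 1]. *)
Lemma cut_form {R : realType} n (B : nat -> nat -> R) (K : R) (x : nat -> R) :
  (forall i j, B i j = B j i) -> (forall i j, (i < n)%N -> (j < n)%N -> `|B i j| <= 1) ->
  (forall s t : nat -> bool, \sum_(i < n) \sum_(j < n) sgb (s i) * B i j * sgb (t j) <= K) ->
  dotn n x (fun i => \sum_(j < n) B i j * x j) ^+ 4 <= n%:R ^+ 2 * K * dotn n x x ^+ 4.
Proof.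
move=> symB B1 cut.
pose y i := \sum_(j < n) B i j * x j.
pose w i := \sum_(j < n) B i j * y j.
have h1 := dotn_CS n x y.
have E2 : dotn n y y = dotn n x w.
  transitivity (\sum_(i < n) \sum_(j < n) y i * (B i j * x j)).
    by apply: eq_bigr => i _; rewrite mulr_sumr.
  rewrite exchange_big; apply: eq_bigr => i _ /=.
  by rewrite mulr_sumr; apply: eq_bigr => j _; rewrite (symB i j); ring.
have h2 := dotn_CS n x w; rewrite -E2 in h2.
pose C i k := \sum_(j < n) B i j * B j k.
have h3 : dotn n w w <= (\sum_(i < n) \sum_(k < n) C i k ^+ 2) * dotn n x x.
  rewrite mulr_suml; apply: ler_sum => i _.
  have -> : w i = dotn n (C i) x.
    rewrite /w /y /dotn /C.
    under eq_bigr do rewrite mulr_sumr.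
    rewrite exchange_big; apply: eq_bigr => k _ /=.
    by rewrite mulr_suml; apply: eq_bigr => j _; ring.
  rewrite -expr2; apply: le_trans (dotn_CS _ _ _) _.
  by rewrite le_eqVlt; apply/orP; left; apply/eqP; congr (_ * _); apply: eq_bigr => k _; rewrite expr2.
have h4 : \sum_(i < n) \sum_(k < n) C i k ^+ 2 <= n%:R ^+ 2 * K.
  have -> : \sum_(i < n) \sum_(k < n) C i k ^+ 2 =
    \sum_(k < n) \sum_(l < n) \sum_(i < n) \sum_(j < n) (B i l * B l k) * B i j * B j k.
    transitivity (\sum_(k < n) \sum_(i < n) \sum_(l < n) \sum_(j < n) (B i l * B l k) * B i j * B j k).
      rewrite exchange_big; apply: eq_bigr => k _; apply: eq_bigr => i _.
      rewrite expr2 {1}/C mulr_suml; apply: eq_bigr => l _.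
      by rewrite /C mulr_sumr; apply: eq_bigr => j _; ring.
    by apply: eq_bigr => k _; rewrite exchange_big.
  apply: le_trans (_ : \sum_(k < n) \sum_(l < n) K <= _).
    apply: ler_sum => k _; apply: ler_sum => l _.
    apply: (cut_bound_cube n B K cut (fun i => B i l * B l k) (fun j => B j k)).
      by move=> i lin; rewrite normrM mulr_ile1 // B1.
    by move=> i lin; rewrite B1.
  rewrite !sumr_const !card_ord -[K *+ n]mulr_natl -[(n%:R * K) *+ n]mulr_natl; lra.
have x0 := dotn_ge0 n x; have y0 := dotn_ge0 n y.
have h5 : dotn n x y ^+ 4 <= (dotn n x x * dotn n y y) ^+ 2.
  rewrite (_ : dotn n x y ^+ 4 = (dotn n x y ^+ 2) ^+ 2); last by rewrite -exprM.
  by rewrite ler_pXn2r // nnegrE ?sqr_ge0 // mulr_ge0.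
apply: le_trans h5 _; rewrite exprMn.
have h6 : dotn n y y ^+ 2 <= dotn n x x * (n%:R ^+ 2 * K * dotn n x x).
  by apply: le_trans h2 _; apply: ler_wpM2l => //; apply: le_trans h3 _; apply: ler_wpM2r.
apply: le_trans (ler_wpM2l (sqr_ge0 _) h6) _.
by rewrite le_eqVlt; apply/orP; left; apply/eqP; ring.
Qed.

Lemma cut_form_le {R : realType} n (B : nat -> nat -> R) (eps : R) (x : nat -> R) :
  0 < eps ->
  (forall i j, B i j = B j i) -> (forall i j, (i < n)%N -> (j < n)%N -> `|B i j| <= 1) ->
  (forall s t : nat -> bool, \sum_(i < n) \sum_(j < n) sgb (s i) * B i j * sgb (t j)
     <= eps ^+ 4 * n%:R ^+ 2) ->
  `|dotn n x (fun i => \sum_(j < n) B i j * x j)| <= eps * n%:R * dotn n x x.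
Proof.
move=> e0 symB B1 cut; have := cut_form n B _ x symB B1 cut.
move: (dotn n x (fun i => _)) => q.
have x0 := dotn_ge0 n x.
rewrite (_ : _ * _ = (eps * n%:R * dotn n x x) ^+ 4); last by ring.
rewrite -[leLHS]ger0_norm ?exprn_even_ge0 // normrX.
by rewrite ler_pXn2r // ?nnegrE // mulr_ge0 // mulr_ge0 // ltW.
Qed.

Lemma lap_diff {R : realType} n (A W : nat -> nat -> R) (x : nat -> R) i :
  lap n A x i - lap n W x i =
  (deg n A i - deg n W i) * x i - \sum_(j < n) (A i j - W i j) * x j.
Proof.
rewrite /lap /deg mulrBl !mulr_suml -!sumrB; apply: eq_bigr => j _; ring.
Qed.

Lemma dotn_lap_close {R : realType} n (A W : nat -> nat -> R) (tau eps : R) (x : nat -> R) :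
  (forall i, (i < n)%N -> `|deg n A i - deg n W i| <= n%:R * tau) ->
  `|dotn n x (fun i => \sum_(j < n) (A i j - W i j) * x j)| <= eps * n%:R * dotn n x x ->
  `|dotn n x (lap n A x) - dotn n x (lap n W x)| <= (tau + eps) * n%:R * dotn n x x.
Proof.
move=> dA cut; rewrite -dotnBr.
rewrite (@eq_dotn _ _ _ _ x (fun i => (deg n A i - deg n W i) * x i - \sum_(j < n) (A i j - W i j) * x j)) //; last first.
  by move=> i _; rewrite lap_diff.
rewrite dotnBr.
have h1 : `|dotn n x (fun i => (deg n A i - deg n W i) * x i)| <= n%:R * tau * dotn n x x.
  apply: le_trans (ler_norm_sum _ _ _) _; rewrite mulr_sumr; apply: ler_sum => i _.
  rewrite mulrCA normrM; apply: ler_pM => //; first exact: dA.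
  by rewrite ger0_norm // -expr2 sqr_ge0.
apply: le_trans (ler_normB _ _) _; lra.
Qed.

Lemma sq_le_norm {R : realType} (a b : R) : 0 <= b -> a ^+ 2 <= b ^+ 2 -> `|a| <= b.
Proof. by move=> b0; rewrite -(@ler_pXn2r _ 2 _ `|a| b) ?nnegrE // real_normK // num_real. Qed.

(* The quadratic forms give the l2 distance of [phi] to a multiple of [f]; dividing the
   coordinatewise eigenvalue equation by [deg n A i - lam] upgrades it to sup norm. *)
Lemma fiedler_perturbation {R : realType} n (A W : nat -> nat -> R) (f phi : nat -> R)
    (l lam c1 c4 theta tau eps : R) :
  (0 < n)%N -> 0 < c1 -> 0 < c4 -> 0 < theta -> 0 <= tau -> 0 <= eps ->
  (forall i j, A i j = A j i) -> (forall i j, W i j = W j i) ->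
  (forall i j, (i < n)%N -> (j < n)%N -> `|A i j| <= 1) ->
  \sum_(i < n) f i = 0 -> (forall i, (i < n)%N -> `|f i| <= 1) ->
  (forall i, (i < n)%N -> lap n W f i = l * f i) ->
  (forall i, (i < n)%N -> c1 * n%:R <= deg n W i - l) ->
  c4 * n%:R <= dotn n f f ->
  (forall x : nat -> R, \sum_(i < n) x i = 0 -> dotn n f x = 0 ->
         (l + theta * n%:R) * dotn n x x <= dotn n x (lap n W x)) ->
  (forall i, (i < n)%N -> `|deg n A i - deg n W i| <= n%:R * tau) ->
  (forall i, (i < n)%N -> `|\sum_(j < n) (A i j - W i j) * f j| <= n%:R * tau) ->
  (forall x : nat -> R,
     `|dotn n x (fun i => \sum_(j < n) (A i j - W i j) * x j)| <= eps * n%:R * dotn n x x) ->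
  tau + eps <= theta / 4 -> tau * (1 + 3 / c4) <= c1 / 2 ->
  (exists2 i, (i < n)%N & phi i != 0) -> \sum_(i < n) phi i = 0 ->
  (forall i, (i < n)%N -> lap n A phi i = lam * phi i) ->
  lam * dotn n f f <= dotn n f (lap n A f) ->
  exists2 a, a != 0 & forall i, (i < n)%N ->
    `|phi i - a * f i| <= `|a| * (2 * (2 + 3 / c4 + 4 / theta) / c1 * tau).
Proof.
move=> n0 c1p c4p thp t0 e0 symA symW A1 f0 f1 fe dl c4n gap E1 E2 E3 te tc phin0 phi0 phie lamf.
have nR : 0 < n%:R :> R by rewrite ltr0n.
have ff0 : 0 < dotn n f f by apply: lt_le_trans c4n; rewrite mulr_gt0.
have ffn : dotn n f f <= n%:R.
  rewrite -[X in _ <= X%:R]card_ord -sumr_const; apply: ler_sum => i _.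
  have := f1 i (ltn_ord i); rewrite -expr2 -real_normK ?num_real // => h.
  by rewrite exprn_ile1.
pose rho i := lap n A f i - l * f i.
have rhoE i : (i < n)%N -> rho i = (deg n A i - deg n W i) * f i - \sum_(j < n) (A i j - W i j) * f j.
  by move=> lin; rewrite -lap_diff fe.
have rho1 i : (i < n)%N -> `|rho i| <= 2 * n%:R * tau.
  move=> lin; rewrite rhoE //; apply: le_trans (ler_normB _ _) _.
  have h := ler_pM (normr_ge0 _) (normr_ge0 _) (E1 i lin) (f1 i lin).
  rewrite normrM; have := E2 i lin; lra.
have rr : dotn n rho rho <= 4 * n%:R ^+ 3 * tau ^+ 2.
  apply: le_trans (_ : \sum_(i < n) (2 * n%:R * tau) ^+ 2 <= _).
    apply: ler_sum => i _; rewrite -expr2 -real_normK ?num_real //.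
    by rewrite ler_pXn2r ?nnegrE ?rho1 // !mulr_ge0.
  by rewrite sumr_const card_ord -[_ *+ n]mulr_natl; lra.
(* [f] is a zero-sum test vector for the Laplacian of [A], with quotient close to [l]. *)
have lam_le : lam <= l + theta / 4 * n%:R.
  have := dotn_lap_close n A W tau eps f E1 (E3 f); rewrite ler_norml => /andP[_].
  rewrite (@eq_dotn _ _ _ (lap n W f) f (fun i => l * f i)) // dotnZr => h.
  rewrite -(ler_pM2r ff0).
  have : (tau + eps) * n%:R * dotn n f f <= theta / 4 * n%:R * dotn n f f.
    by rewrite ler_pM2r // ler_pM2r.
  lra.
(* [a * f] is the orthogonal projection of [phi] on [f], so the gap applies to the remainder
   [psi]. *)
have [a Ea] : exists a, a = dotn n f phi / dotn n f f by exists (dotn n f phi / dotn n f f).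
pose psi i := phi i - a * f i.
have psi0 : \sum_(i < n) psi i = 0 by rewrite sumrB -mulr_sumr phi0 f0 mulr0 subr0.
have psif : dotn n f psi = 0 by rewrite dotnBr dotnZr Ea divfK ?subrr // gt_eqF.
pose p := dotn n psi psi.
have p0 : 0 <= p by exact: dotn_ge0.
have eqpsi : lam * p = a * dotn n psi rho + dotn n psi (lap n A psi).
  have e1 : dotn n psi (lap n A phi) = lam * p.
    rewrite (@eq_dotn _ _ _ (lap n A phi) psi (fun i => lam * (psi i + a * f i))) //; last first.
      by move=> i lin; rewrite phie // /psi; ring.
    by rewrite dotnZr dotnDr dotnZr (dotnC n psi f) psif mulr0 addr0.
  have e2 : dotn n psi (lap n A phi) = dotn n psi (lap n A psi) + a * dotn n psi (lap n A f).
    rewrite -dotnZr -dotnDr; apply: eq_dotn => // i lin.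
    by rewrite lapB lapZ; ring.
  have e3 : dotn n psi rho = dotn n psi (lap n A f).
    by rewrite dotnBr dotnZr (dotnC n psi f) psif mulr0 subr0.
  by rewrite -e1 e2 e3; ring.
(* Of the gap [theta], a quarter is lost to [lam_le] and a quarter to the change of the form; half
   remains. *)
have main : theta / 2 * n%:R * p <= `|a| * `|dotn n psi rho|.
  have h1 := gap psi psi0 psif.
  have := dotn_lap_close n A W tau eps psi E1 (E3 psi); rewrite ler_norml => /andP[h2 _].
  have h3 : (tau + eps) * n%:R * p <= theta / 4 * n%:R * p.
    by rewrite ler_wpM2r // ler_pM2r.
  have h4 : lam * p <= (l + theta / 4 * n%:R) * p by rewrite ler_wpM2r.
  rewrite -normrM; have := ler_norm (- (a * dotn n psi rho)); rewrite normrN.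
  rewrite -/p in h1 h2; move: eqpsi; clear -h1 h2 h3 h4; lra.
have tn : 0 < theta / 2 * n%:R by rewrite mulr_gt0 // divr_gt0.
have main2 : (theta / 2 * n%:R) ^+ 2 * p <= a ^+ 2 * dotn n rho rho.
  move: p0; rewrite le_eqVlt => /orP[/eqP <-|pp].
    by rewrite mulr0 mulr_ge0 ?sqr_ge0 // dotn_ge0.
  rewrite -(ler_pM2r pp).
  have h : (theta / 2 * n%:R * p) ^+ 2 <= (`|a| * `|dotn n psi rho|) ^+ 2.
    by rewrite ler_pXn2r ?nnegrE // mulr_ge0 // ltW.
  have h' := dotn_CS n psi rho; rewrite -/p in h'.
  rewrite [X in _ <= X]exprMn !real_normK ?num_real // in h.
  have := ler_wpM2l (sqr_ge0 a) h'; clear -h; lra.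
have main3 : p <= a ^+ 2 * (4 * tau / theta) ^+ 2 * n%:R.
  have tn2 : 0 < (theta / 2 * n%:R) ^+ 2 by rewrite exprn_gt0.
  rewrite -(ler_pM2l tn2); apply: le_trans main2 _.
  apply: le_trans (ler_wpM2l (sqr_ge0 a) rr) _.
  by rewrite le_eqVlt; apply/orP; left; apply/eqP; field; rewrite gt_eqF.
have an0 : a != 0.
  apply/negP => /eqP a0; move: main3; rewrite a0 expr0n /= !mul0r => pl.
  case: phin0 => i lin pi.
  have : 0 < dotn n psi psi by apply: (dotn_gt0 n psi i) => //; rewrite /psi a0 mul0r subr0.
  by rewrite ltNge -/p pl.
exists a => //.
have a2 : 0 < `|a| by rewrite normr_gt0.
have a20 : 0 < a ^+ 2 by rewrite exprn_even_gt0.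
have tth : 4 * tau / theta <= 1 by rewrite ler_pdivrMr //; clear -te e0; lra.
have tth0 : 0 <= 4 * tau / theta by rewrite divr_ge0 ?mulr_ge0 // ltW.
have fphi : dotn n f phi = a * dotn n f f by rewrite Ea divfK // gt_eqF.
have phiphi : dotn n phi phi <= a ^+ 2 * (2 * n%:R).
  have -> : dotn n phi phi = a ^+ 2 * dotn n f f + p.
    have e1 : dotn n phi psi = dotn n phi phi - a * dotn n phi f by rewrite dotnBr dotnZr.
    have e2 : p = dotn n psi phi - a * dotn n psi f by rewrite /p {2}/psi dotnBr dotnZr.
    move: e2; rewrite (dotnC n psi f) psif (dotnC n psi phi) e1 (dotnC n phi f) fphi; clear; lra.
  have : a ^+ 2 * dotn n f f <= a ^+ 2 * n%:R by rewrite ler_pM2l.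
  have h : a ^+ 2 * (4 * tau / theta) ^+ 2 * n%:R <= a ^+ 2 * 1 * n%:R.
    by rewrite ler_pM2r // ler_pM2l // exprn_ile1.
  clear -main3 h; lra.
(* Pairing the two eigenvalue equations expresses [lam - l] through [dotn n phi rho]; the residual
   [rho] is of order [n * tau] in each entry, so the error is of first order in [tau]. *)
have lam_l : `|lam - l| <= 3 / c4 * n%:R * tau.
  have e1 : lam * dotn n f phi = dotn n phi (lap n A f).
    rewrite dotn_lapC // (@eq_dotn _ _ _ (lap n A phi) f (fun i => lam * phi i)) //.
    by rewrite dotnZr.
  have e2 : (lam - l) * (a * dotn n f f) = dotn n phi rho.
    by rewrite dotnBr dotnZr -e1 (dotnC n phi f) -fphi; ring.
  have h1 : dotn n phi rho ^+ 2 <= (`|a| * (3 * n%:R ^+ 2 * tau)) ^+ 2.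
    apply: le_trans (dotn_CS _ _ _) _.
    have h := ler_pM (dotn_ge0 n phi) (dotn_ge0 n rho) phiphi rr.
    apply: le_trans h _.
    rewrite [in leRHS]exprMn real_normK ?num_real //.
    have : 0 <= a ^+ 2 * (n%:R ^+ 2 * tau) ^+ 2 by rewrite mulr_ge0 ?sqr_ge0.
    clear; lra.
  have h2 : `|dotn n phi rho| <= `|a| * (3 * n%:R ^+ 2 * tau).
    apply: sq_le_norm h1; by rewrite !mulr_ge0 // exprn_ge0.
  rewrite -e2 !normrM (ger0_norm (ltW ff0)) in h2.
  have h3 : `|lam - l| * dotn n f f <= 3 * n%:R ^+ 2 * tau.
    rewrite -(ler_pM2l a2) mulrCA. exact: h2.
  have h4 : `|lam - l| * (c4 * n%:R) <= 3 * n%:R ^+ 2 * tau.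
    by apply: le_trans h3; rewrite ler_wpM2l.
  have cn : 0 < c4 * n%:R by rewrite mulr_gt0.
  rewrite -(ler_pM2r cn); apply: le_trans h4 _.
  by rewrite le_eqVlt; apply/orP; left; apply/eqP; field; rewrite gt_eqF.
move=> i lin; rewrite -/(psi i).
pose S := \sum_(j < n) A i j * psi j.
have S1 : `|S| <= `|a| * (4 * tau / theta * n%:R).
  apply: sq_le_norm; first by rewrite mulr_ge0 // mulr_ge0.
  apply: le_trans (dotn_CS n (A i) psi) _.
  have h1 : dotn n (A i) (A i) <= n%:R.
    rewrite -[X in _ <= X%:R]card_ord -sumr_const; apply: ler_sum => j _.
    by rewrite -expr2 -real_normK ?num_real // exprn_ile1 // A1.
  apply: le_trans (ler_pM (dotn_ge0 n (A i)) p0 h1 main3) _.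
  rewrite [leRHS]exprMn real_normK ?num_real // [in leRHS]exprMn.
  by rewrite le_eqVlt; apply/orP; left; apply/eqP; ring.
(* The equation of [phi] at [i] minus [a] times that of [f]. All terms but [S] are small entrywise,
   and [S] is small by Cauchy-Schwarz and the l2 bound on [psi]. *)
have key : (deg n A i - lam) * psi i =
    a * ((lam - l - (deg n A i - deg n W i)) * f i + \sum_(j < n) (A i j - W i j) * f j) + S.
  have lapE (B : nat -> nat -> R) (x : nat -> R) : lap n B x i = deg n B i * x i - \sum_(j < n) B i j * x j.
    by rewrite /lap /deg mulr_suml -sumrB; apply: eq_bigr => j _; ring.
  have e1 := phie i lin; rewrite lapE in e1.
  have e2 := fe i lin; rewrite lapE in e2.
  have e3 : \sum_(j < n) A i j * phi j = S + a * (\sum_(j < n) (A i j - W i j) * f j + \sum_(j < n) W i j * f j).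
    rewrite -big_split /S mulr_sumr -big_split; apply: eq_bigr => j _; rewrite /psi /=; ring.
  move: e1 e2; rewrite e3 /psi.
  move: (deg n A i) (deg n W i) (\sum_(j < n) W i j * f j) (\sum_(j < n) (A i j - W i j) * f j) => dA dW sW sD.
  clearbody S; clear=> e1 e2; have e2' : sW = (dW - l) * f i by lra.
  by rewrite e2' in e1; lra.
have dlow : c1 / 2 * n%:R <= deg n A i - lam.
  have := dl i lin; have := E1 i lin; rewrite ler_norml => /andP[h1 _].
  move: lam_l; rewrite ler_norml => /andP[_ h2] h3.
  have h4 : tau * (1 + 3 / c4) * n%:R <= c1 / 2 * n%:R by rewrite ler_pM2r.
  clear -h1 h2 h3 h4; lra.
have cn2 : 0 < c1 / 2 * n%:R by rewrite mulr_gt0 // divr_gt0.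
have up : `|(deg n A i - lam) * psi i| <= `|a| * ((2 + 3 / c4 + 4 / theta) * n%:R * tau).
  rewrite key; apply: le_trans (ler_normD _ _) _; rewrite normrM.
  have h : `|(lam - l - (deg n A i - deg n W i)) * f i + \sum_(j < n) (A i j - W i j) * f j| <=
      (2 + 3 / c4) * n%:R * tau.
    apply: le_trans (ler_normD _ _) _; rewrite normrM.
    have h1 : `|lam - l - (deg n A i - deg n W i)| * `|f i| <= (3 / c4 * n%:R * tau + n%:R * tau) * 1.
      apply: ler_pM => //; last exact: f1.
      by apply: le_trans (ler_normB _ _) _; apply: lerD => //; exact: E1.
    have := E2 i lin; clear -h1; lra.
  have := ler_wpM2l (ltW a2) h; clear -S1; lra.
rewrite -(ler_pM2l cn2); apply: le_trans (_ : `|(deg n A i - lam) * psi i| <= _).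
  rewrite normrM; apply: ler_wpM2r => //.
  by apply: le_trans dlow _; exact: ler_norm.
apply: le_trans up _.
by rewrite le_eqVlt; apply/orP; left; apply/eqP; field; rewrite !gt_eqF.
Qed.

(** * Ordering guarantees for the algorithms *)

(** Indices are ranks in [enum T], which lists the vertices in increasing order; this turns the mean
    kernel of an evenly spread [T] into an almost Toeplitz one. *)
Definition adj_kernel (R : realType) {N : nat} (e : graph N) (T : {set 'I_N}) (x0 : 'I_N)
    (i j : nat) : R := (adj e (nth x0 (enum T) i) (nth x0 (enum T) j))%:R.

Definition nat_of_row {R : realType} {n : nat} (x : 'rV[R]_n) (k : nat) : R :=
  if insub k is Some i then x 0 i else 0.

Lemma nat_of_rowE {R : realType} {n : nat} (x : 'rV[R]_n) (i : 'I_n) : nat_of_row x i = x 0 i.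
Proof. by rewrite /nat_of_row valK. Qed.

Lemma adjC {N : nat} (e : graph N) u v : adj e u v = adj e v u.
Proof. by rewrite /adj; case: ltngtP. Qed.

Lemma adj_kernelC {R : realType} {N : nat} (e : graph N) (T : {set 'I_N}) x0 i j :
  adj_kernel R e T x0 i j = adj_kernel R e T x0 j i.
Proof. by rewrite /adj_kernel adjC. Qed.

Lemma sum_set_nth {R : realType} {N : nat} (T : {set 'I_N}) (x0 : 'I_N) (F : 'I_N -> R) :
  \sum_(v in T) F v = \sum_(i < #|T|) F (nth x0 (enum T) i).
Proof. by rewrite big_enum_val; apply: eq_bigr => i _; rewrite (enum_val_nth x0). Qed.

Lemma lapT_mul {R : realType} {N : nat} (e : graph N) (T : {set 'I_N}) (x0 : 'I_N) (x : 'rV[R]_#|T|) i :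
  (x *m lapT R e T) 0 i = lap #|T| (adj_kernel R e T x0) (nat_of_row x) i.
Proof.
have degE (k : 'I_#|T|) : (#|[set v in T | adj e (enum_val k) v]|)%:R = \sum_(j < #|T|) adj_kernel R e T x0 k j.
  rewrite -sum1_card natr_sum (eq_bigl (fun v => (v \in T) && adj e (enum_val k) v)); last first.
    by move=> v; rewrite inE.
  rewrite big_mkcondr /= (sum_set_nth T x0); apply: eq_bigr => j _.
  rewrite /adj_kernel (enum_val_nth x0). by case: (adj _ _ _).
rewrite mxE; under eq_bigr do rewrite mxE mulrBr degE mulrCA.
rewrite sumrB.
have -> : \sum_(j < #|T|) (j == i)%:R * (x 0 j * \sum_(k < #|T|) adj_kernel R e T x0 j k) =
    x 0 i * \sum_(k < #|T|) adj_kernel R e T x0 i k.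
  rewrite (bigD1 i) //= eqxx mul1r [X in _ + X]big1 ?addr0 //.
  by move=> j /negbTE ->; rewrite mul0r.
rewrite /lap mulr_sumr -sumrB; apply: eq_bigr => j _.
rewrite !nat_of_rowE !(enum_val_nth x0) adjC -/(adj_kernel R e T x0 i j); ring.
Qed.

Lemma lapT_sym {R : realType} {N : nat} (e : graph N) (T : {set 'I_N}) :
  (lapT R e T)^T = lapT R e T.
Proof.
apply/matrixP => i j; rewrite !mxE eq_sym adjC; congr (_ - _).
by case: eqP => [->|_] //; rewrite !mul0r.
Qed.

(** Coercivity leaves only constants in the kernel, so [lam] is positive and its eigenvectors have
    zero sum. A minimizer among zero-sum vectors is an eigenvector with positive eigenvalue, and 0
    is another eigenvalue, so [lam] cannot exceed the minimum. *)
Lemma lapT_second_eig {R : realType} {N : nat} (e : graph N) (T : {set 'I_N}) (x0 : 'I_N)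
    (lam mu : R) (phi : 'rV[R]_#|T|) :
  (1 < #|T|)%N -> 0 < mu ->
  (forall x : nat -> R, \sum_(i < #|T|) x i = 0 ->
     mu * dotn #|T| x x <= dotn #|T| x (lap #|T| (adj_kernel R e T x0) x)) ->
  second_smallest_eig (lapT R e T) lam -> phi != 0 -> phi *m lapT R e T = lam *: phi ->
  [/\ exists2 i, (i < #|T|)%N & nat_of_row phi i != 0,
      \sum_(i < #|T|) nat_of_row phi i = 0,
      forall i, (i < #|T|)%N -> lap #|T| (adj_kernel R e T x0) (nat_of_row phi) i = lam * nat_of_row phi i &
      forall x : nat -> R, \sum_(i < #|T|) x i = 0 ->
        lam * dotn #|T| x x <= dotn #|T| x (lap #|T| (adj_kernel R e T x0) x)].
Proof.
set n := #|T|; set A := adj_kernel R e T x0.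
move=> n1 mu0 coer slam phi0 phie.
have symA i j : A i j = A j i by exact: adj_kernelC.
have n0 : (0 < n)%N by exact: ltnW.
have nR : 0 < n%:R :> R by rewrite ltr0n.
have formE (x : 'rV[R]_n) : (x *m lapT R e T *m x^T) 0 0 = dotn n (nat_of_row x) (lap n A (nat_of_row x)).
  by rewrite mxE; apply: eq_bigr => i _; rewrite (lapT_mul e T x0) mxE mulrC nat_of_rowE.
have psd (y : nat -> R) : 0 <= dotn n y (lap n A y).
  have : 0 <= 2 * dotn n y (lap n A y).
    rewrite dotn_lap //; apply: sumr_ge0 => i _; apply: sumr_ge0 => j _.
    by rewrite mulr_ge0 ?ler0n // -expr2 sqr_ge0.
  by rewrite pmulr_rge0.
have lap0 (c : R) i : lap n A (fun=> c) i = 0.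
  by rewrite /lap big1 // => j _; rewrite subrr mulr0.
have lam0 : 0 < lam.
  apply: (second_smallest_eig_gt0 (lapT R e T)) slam; first exact: lapT_sym.
    by move=> x; rewrite formE.
  move=> x xL.
  have xl i : (i < n)%N -> lap n A (nat_of_row x) i = 0.
    move=> lin; have := lapT_mul e T x0 x (Ordinal lin); by rewrite xL mxE => <-.
  pose m := (\sum_(i < n) nat_of_row x i) / n%:R.
  pose y i := nat_of_row x i - m.
  have y0 : \sum_(i < n) y i = 0.
    by rewrite sumrB sumr_const card_ord -[m *+ n]mulr_natl mulrC divfK ?subrr // gt_eqF.
  have := coer y y0.
  have -> : dotn n y (lap n A y) = 0.
    rewrite /dotn big1 // => i _; rewrite lapB lap0 xl // subrr mulr0 //.
  move=> h; exists m; apply/rowP => i; rewrite mxE -nat_of_rowE.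
  apply/eqP; rewrite -subr_eq0; apply/negPn/negP => yi.
  have := dotn_gt0 n y i (ltn_ord i) yi; rewrite ltNge; move/negP; apply.
  by rewrite -(ler_pM2l mu0) mulr0.
have phin i : (i < n)%N -> lap n A (nat_of_row phi) i = lam * nat_of_row phi i.
  move=> lin; have := lapT_mul e T x0 phi (Ordinal lin).
  by rewrite phie mxE => <-; rewrite (nat_of_rowE phi (Ordinal lin)).
split => //.
- by have /rV0Pn [i vi] := phi0; exists i => //; rewrite nat_of_rowE.
- have : \sum_(i < n) lap n A (nat_of_row phi) i = lam * \sum_(i < n) nat_of_row phi i.
    by rewrite mulr_sumr; apply: eq_bigr => i _; rewrite phin.
  by rewrite sum_lap // => /esym/eqP; rewrite mulf_eq0 gt_eqF //= => /eqP.
have z00 : \sum_(i < n) (fun=> 0 : R) i = 0 by rewrite big1.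
have zl i : (i < n)%N -> lap n A (fun=> 0) i = 0 * (fun=> 0 : R) i.
  by move=> _; rewrite mul0r lap0.
have dz (y : nat -> R) : dotn n (fun=> 0) y = 0 by rewrite /dotn big1 // => i _; rewrite mul0r.
have eig0 : eigenvalue (lapT R e T) 0.
  apply/eigenvalueP; exists (const_mx 1).
    apply/rowP => i; rewrite (lapT_mul e T x0) scale0r mxE.
    rewrite /lap big1 // => j _; rewrite !nat_of_rowE !mxE subrr mulr0 //.
  apply/rV0Pn; exists (Ordinal n0); by rewrite mxE oner_eq0.
move=> x xs.
have [big|[l [h [_ hn0 [h0 _] he hmin]]]] :=
    lap_constrained_min n A (fun=> 0) 0 lam n0 symA z00 zl.
  exact: big.
apply: le_trans (hmin x xs (dz x)); apply: ler_wpM2r; first exact: dotn_ge0.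
have l0 : 0 < l.
  case: hn0 => i lin hi; have hp := dotn_gt0 n h i lin hi.
  have := coer h h0; rewrite (@eq_dotn _ _ _ (lap n A h) h (fun i => l * h i)) //.
  by rewrite dotnZr ler_pM2r // => h1; exact: lt_le_trans h1.
apply: (second_smallest_eig_le (lapT R e T) lam 0 l) => //.
apply/eigenvalueP; exists (\row_i h i).
  apply/rowP => i; rewrite (lapT_mul e T x0) !mxE -he //.
  apply: eq_bigr => j _; rewrite !nat_of_rowE !mxE //.
by case: hn0 => i lin hi; apply/rV0Pn; exists (Ordinal lin); rewrite mxE.
Qed.

Definition mean_adj {R : realType} (rho : R -> R) {N : nat} (u v : 'I_N) : R :=
  if u == v then 0 else wfun rho (vpos R u) (vpos R v).

Definition adj_dev {R : realType} (rho : R -> R) {N : nat} (e : graph N) (u v : 'I_N) : R :=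
  (adj e u v)%:R - mean_adj rho u v.

Definition well_spread {R : realType} {N : nat} (T : {set 'I_N}) (tau : R) : Prop :=
  forall (x0 : 'I_N) (i : nat), (i < #|T|)%N ->
    `|vpos R (nth x0 (enum T) i) - i.+1%:R / #|T|%:R| <= tau.

(** The weights [F] depend on the size of [T] and the rank in it, not on the graph, and the signs
    are finite functions; so failure is a finite union of Chernoff events. *)
Definition graph_regular {R : realType} (rho : R -> R) (F : nat -> nat -> R) {N : nat}
    (e : graph N) (T : {set 'I_N}) (tau eps : R) : Prop :=
  [/\ forall v, `|\sum_(u in T) adj_dev rho e u v| <= N%:R * tau,
      forall v, `|\sum_(u in T) F #|T| (index u (enum T)) * adj_dev rho e u v| <= N%:R * tau &
      forall s t : {ffun 'I_N -> bool},
        \sum_(u in T) \sum_(v in T) sgb (s u) * adj_dev rho e u v * sgb (t v) <= eps * N%:R ^+ 2].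

Definition orders_up_to {R : realType} {N : nat} (q : 'I_N -> R) (T : {set 'I_N})
    (omega : R) (sig : 'I_N -> nat) : Prop :=
  {in T &, forall u v, q u + omega <= q v -> (sig u < sig v)%N}.

Lemma decay_profile_lip {R : realType} (rho : R -> R) (Lam x y : R) :
  decay_profile rho Lam -> 0 <= x <= 1 -> 0 <= y <= 1 -> `|rho x - rho y| <= Lam * `|x - y|.
Proof.
move=> [_ _ mono _]; wlog xy : x y / x <= y.
  move=> H hx hy; have [xy|/ltW yx] := leP x y; first exact: H.
  by rewrite distrC (distrC x); apply: H.
move=> /andP[x0 _] /andP[_ y1]; have /andP[h1 h2] := mono x y x0 xy y1.
by rewrite ger0_norm // (distrC x) [`|y - x|]ger0_norm // subr_ge0.
Qed.

Lemma vpos_gt0_le1 {R : realType} {N : nat} (u : 'I_N) : 0 < vpos R u <= 1.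
Proof.
have N0 : 0 < N%:R :> R by rewrite ltr0n (leq_ltn_trans _ (ltn_ord u)).
by rewrite /vpos divr_gt0 //= ler_pdivrMr // mul1r ler_nat ltn_ord.
Qed.

Lemma mean_adjC {R : realType} (rho : R -> R) {N : nat} (u v : 'I_N) :
  mean_adj rho u v = mean_adj rho v u.
Proof. by rewrite /mean_adj eq_sym /wfun distrC. Qed.

Lemma adj_devC {R : realType} (rho : R -> R) {N : nat} (e : graph N) (u v : 'I_N) :
  adj_dev rho e u v = adj_dev rho e v u.
Proof. by rewrite /adj_dev adjC mean_adjC. Qed.

Lemma mean_adj_ge0_le1 {R : realType} (rho : R -> R) Lam {N : nat} (u v : 'I_N) :
  decay_profile rho Lam -> 0 <= mean_adj rho u v <= 1.
Proof.
move=> [_ r01 _ _]; rewrite /mean_adj; case: eqP => _; first by rewrite lexx ler01.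
have /andP[h1 h2] := @vpos_gt0_le1 R N u; have /andP[h3 h4] := @vpos_gt0_le1 R N v.
have h : 0 <= `|vpos R u - vpos R v| <= 1.
  by rewrite normr_ge0 /= ler_norml; apply/andP; split; lra.
by have /andP[/ltW -> ->] := r01 _ h.
Qed.

Lemma adj_dev_le1 {R : realType} (rho : R -> R) Lam {N : nat} (e : graph N) (u v : 'I_N) :
  decay_profile rho Lam -> `|adj_dev rho e u v| <= 1.
Proof.
move=> P; have /andP[h1 h2] := mean_adj_ge0_le1 rho Lam u v P; rewrite /adj_dev.
by rewrite ler_norml; case: adj => /=; apply/andP; split; lra.
Qed.

Lemma mean_adj_grid {R : realType} (rho : R -> R) Lam {N : nat} (T : {set 'I_N}) (x0 : 'I_N)
    (tau : R) i j :
  decay_profile rho Lam -> well_spread T tau -> (i < #|T|)%N -> (j < #|T|)%N ->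
  `|mean_adj rho (nth x0 (enum T) i) (nth x0 (enum T) j) - toep (grid rho #|T|) i j|
    <= 2 * Lam * tau + (i == j)%:R.
Proof.
move=> P ws lin ljn; have [L0 r01 mono slope] := P.
have nR : 0 < #|T|%:R :> R by rewrite ltr0n (leq_ltn_trans _ lin).
have t0 : 0 <= tau by apply: le_trans (ws x0 i lin).
rewrite /mean_adj nth_uniq ?enum_uniq -?cardE //.
have dn : 0 <= ((adist i j)%:R / #|T|%:R : R) <= 1.
  apply/andP; split; first exact: divr_ge0. rewrite ler_pdivrMr // mul1r ler_nat /adist; clear -lin ljn; lia.
case: eqP => [ij|ij] /=.
  rewrite sub0r normrN /toep /grid.
  have /andP[h1 h2] := r01 _ dn.
  have h3 : 0 <= 2 * Lam * tau by rewrite !mulr_ge0 // ltW.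
  rewrite ger0_norm; last exact: ltW.
  by apply: le_trans h2 _; rewrite lerDr.
set xi := nth x0 _ i; set xj := nth x0 _ j.
rewrite addr0 /wfun /toep /grid.
have /andP[h1 h2] := @vpos_gt0_le1 R N xi; have /andP[h3 h4] := @vpos_gt0_le1 R N xj.
have h : 0 <= `|vpos R xi - vpos R xj| <= 1.
  by rewrite normr_ge0 /= ler_norml; apply/andP; split; lra.
apply: le_trans (decay_profile_lip rho Lam _ _ P h dn) _.
rewrite (mulrC 2) -mulrA ler_pM2l //.
have -> : (adist i j)%:R / #|T|%:R = `|i.+1%:R / #|T|%:R - j.+1%:R / #|T|%:R| :> R.
  rewrite -mulrBl normrM [`|_^-1|]ger0_norm ?invr_ge0 ?ltW //; congr (_ / _).
  rewrite -[i.+1%:R]natr1 -[j.+1%:R]natr1 (_ : _ - _ = i%:R - j%:R); last by ring.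
  rewrite /adist; case: (leqP i j) => h5.
    by rewrite distrC -natrB // ger0_norm //; congr _%:R; clear -h5; lia.
  by rewrite -natrB ?(ltnW h5) // ger0_norm //; congr _%:R; clear -h5; lia.
apply: le_trans (ler_dist_dist _ _) _.
rewrite (_ : _ - _ = (vpos R xi - i.+1%:R / #|T|%:R) - (vpos R xj - j.+1%:R / #|T|%:R)); last by ring.
apply: le_trans (ler_normB _ _) _.
have := ws x0 i lin; have := ws x0 j ljn; rewrite -/xi -/xj; lra.
Qed.

(** One vector per size is selected before any graph appears. Sizes below [n0] and indices beyond n
    get the value 0, which makes the sup bound unconditional, as the tail bounds require. *)
Lemma toep_reference_fun {R : realType} (rho : R -> R) (Lam : R) : decay_profile rho Lam ->
  exists (c1 c2 c4 theta : R) (n0 : nat) (F : nat -> nat -> R) (L : nat -> R),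
  [/\ 0 < c1, 0 < c2, 0 < c4 & 0 < theta] /\ (forall n i, `|F n i| <= 1) /\
  forall n : nat, (n0 <= n)%N ->
    [/\ 0 <= L n, \sum_(i < n) F n i = 0 & forall i, (i < n)%N -> `|F n i| <= 1] /\
    [/\ forall i j, (i <= j)%N -> (j < n)%N -> c2 * (j - i)%:R / n%:R <= F n j - F n i,
       forall i, (i < n)%N -> lap n (toep (grid rho n)) (F n) i = L n * F n i,
       forall i, (i < n)%N -> c1 * n%:R <= deg n (toep (grid rho n)) i - L n,
       c4 * n%:R <= dotn n (F n) (F n) &
       forall x : nat -> R, \sum_(i < n) x i = 0 -> dotn n (F n) x = 0 ->
         (L n + theta * n%:R) * dotn n x x <= dotn n x (lap n (toep (grid rho n)) x)].
Proof.
move=> P; have [c1 [c2 [c4 [theta [pos [n0 H]]]]]] := toep_reference rho Lam P.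
have H' (n : nat) : exists lf : R * (nat -> R), (forall i, `|lf.2 i| <= 1) /\ ((n0 <= n)%N ->
    [/\ 0 <= lf.1, \sum_(i < n) lf.2 i = 0 & forall i, (i < n)%N -> `|lf.2 i| <= 1] /\
    [/\ forall i j, (i <= j)%N -> (j < n)%N -> c2 * (j - i)%:R / n%:R <= lf.2 j - lf.2 i,
       forall i, (i < n)%N -> lap n (toep (grid rho n)) lf.2 i = lf.1 * lf.2 i,
       forall i, (i < n)%N -> c1 * n%:R <= deg n (toep (grid rho n)) i - lf.1,
       c4 * n%:R <= dotn n lf.2 lf.2 &
       forall x : nat -> R, \sum_(i < n) x i = 0 -> dotn n lf.2 x = 0 ->
         (lf.1 + theta * n%:R) * dotn n x x <= dotn n x (lap n (toep (grid rho n)) x)]).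
  have [hn|hn] := leqP n0 n; last first.
    by exists (0, fun=> 0); split => // i; rewrite /= normr0.
  have [l [f [[h1 h2 h3] [h4 h5 h6 h7 h8]]]] := H n hn.
  pose f' i := if (i < n)%N then f i else 0.
  have ff' i : (i < n)%N -> f' i = f i by move=> lin; rewrite /f' lin.
  have lf i : (i < n)%N -> lap n (toep (grid rho n)) f' i = lap n (toep (grid rho n)) f i.
    by move=> lin; apply: eq_bigr => j _; rewrite !ff'.
  exists (l, f') => /=; split.
    by move=> i; rewrite /f'; case: ifP => [/h3 //|_]; rewrite normr0.
  move=> _; split; split => //.
  - by rewrite -[RHS]h2; apply: eq_bigr => i _; rewrite ff'.
  - by move=> i lin; rewrite ff' // h3.
  - by move=> i j ij jn; rewrite !ff' ?h4 // (leq_ltn_trans ij).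
  - by move=> i lin; rewrite lf // ff' // h5.
  - by rewrite (@eq_dotn _ _ f' f' f f).
  - by move=> x x0 xf; apply: h8 => //; rewrite -xf; apply: eq_dotn => // i lin; rewrite ff'.
have [G HG] := choice H'.
exists c1, c2, c4, theta, n0, (fun n => (G n).2), (fun n => (G n).1); split => //; split.
  by move=> n i; have [h _] := HG n; apply: h.
by move=> n hn; have [_ h] := HG n; apply: h.
Qed.

(* The indicator absorbs the diagonal, where adjacency vanishes but the profile does not. *)
Lemma near_diagonal_form {R : realType} n (D : nat -> nat -> R) (b : R) (x : nat -> R) :
  (forall i j, (i < n)%N -> (j < n)%N -> `|D i j| <= b + (i == j)%:R) ->
  `|\sum_(i < n) \sum_(j < n) x i * (D i j * x j)| <= (b * n%:R + 1) * dotn n x x.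
Proof.
move=> Db.
apply: le_trans (_ : \sum_(i < n) \sum_(j < n)
    (b + (i == j :> nat)%:R) * ((x i * x i + x j * x j) / 2) <= _).
  apply: le_trans (ler_norm_sum _ _ _) _; apply: ler_sum => i _.
  apply: le_trans (ler_norm_sum _ _ _) _; apply: ler_sum => j _.
  rewrite mulrCA normrM; apply: ler_pM => //; first exact: Db.
  have := sqr_ge0 (x i - x j); have := sqr_ge0 (x i + x j) => h2 h3.
  by rewrite ler_norml; apply/andP; split; lra.
have S1 : \sum_(i < n) \sum_(j < n) (x i * x i + x j * x j) / 2 = n%:R * dotn n x x.
  have S2 : \sum_(i < n) \sum_(j < n) x i * x i / 2 = n%:R * (dotn n x x / 2).
    rewrite /dotn mulr_suml mulr_sumr; apply: eq_bigr => i _.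
    by rewrite sumr_const card_ord mulr_natl.
  have S3 : \sum_(i < n) \sum_(j < n) x j * x j / 2 = n%:R * (dotn n x x / 2).
    by rewrite exchange_big.
  rewrite (_ : n%:R * dotn n x x = n%:R * (dotn n x x / 2) + n%:R * (dotn n x x / 2)); last by field.
  rewrite -{1}S2 -S3 -big_split; apply: eq_bigr => i _ /=.
  by rewrite -big_split; apply: eq_bigr => j _ /=; rewrite mulrDl.
have S4 : \sum_(i < n) \sum_(j < n) (i == j :> nat)%:R * ((x i * x i + x j * x j) / 2) = dotn n x x.
  apply: eq_bigr => i _; rewrite (bigD1 i) //= eqxx mul1r big1 ?addr0; first by field.
  by move=> j /negbTE; rewrite -(inj_eq val_inj) /= eq_sym => ->; rewrite mul0r.
rewrite (_ : \sum_(i < n) _ = b * (n%:R * dotn n x x) + dotn n x x); first by lra.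
rewrite -S1 -[in RHS]S4 mulr_sumr -big_split; apply: eq_bigr => i _ /=.
by rewrite mulr_sumr -big_split; apply: eq_bigr => j _ /=; rewrite mulrDl.
Qed.

Lemma spectral_seriation_order {R : realType} (rho : R -> R) (Lam : R) : decay_profile rho Lam ->
  exists (K tau0 eps : R) (n0 : nat) (F : nat -> nat -> R),
  [/\ 0 < K, 0 < tau0 & 0 < eps] /\ (forall n i, `|F n i| <= 1) /\
  forall (N : nat) (e : graph N) (T : {set 'I_N}) (tau : R) (sig : 'I_N -> nat),
    (n0 <= #|T|)%N -> (N <= 4 * #|T|)%N -> 1 <= #|T|%:R * tau -> tau <= tau0 ->
    well_spread T tau -> graph_regular rho F e T tau eps -> spec_ser R e T sig ->
    orders_up_to (@vpos R N) T (K * tau) sig \/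
    orders_up_to (fun u => 1 - @vpos R N u) T (K * tau) sig.
Proof.
move=> P; have [L0 r01 mono slope] := P.
have [c1 [c2 [c4 [theta [n0 [F [L [[c1p c2p c4p thp] [F1 H]]]]]]]]] := toep_reference_fun rho Lam P.
have h11 : 0 <= (1 : R) <= 1 by rewrite ler01 lexx.
have r1 : 0 < rho 1 by have /andP[] := r01 1 h11.
(* [theta / 4] is the error that the perturbation estimate tolerates; [rho 1 / 2] keeps the random
   Laplacian coercive, since all entries of the Toeplitz kernel are at least [rho 1]. *)
have [g [gp gth gr]] : exists g, [/\ 0 < g, g <= theta / 4 & g <= rho 1 / 2].
  exists (Num.min (theta / 4) (rho 1 / 2)); rewrite lt_min !ge_min !lexx orbT.
  by rewrite !divr_gt0.
(* 4 comes from [N <= 4 * #|T|], [2 * Lam] from the displacement of two vertices, and 1 from the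
   diagonal, which [1 <= #|T| * tau] absorbs. *)
have [M [M0 EM]] : exists M, 0 < M /\ M = 2 * Lam + 5 by exists (2 * Lam + 5); split => //; lra.
have [e0 [e0p Ee0]] : exists e0, 0 < e0 /\ e0 = g / 2 by exists (g / 2); split => //; rewrite divr_gt0.
have [C [C0 EC]] : exists C, 0 < C /\ C = 2 * (2 + 3 / c4 + 4 / theta) / c1.
  exists (2 * (2 + 3 / c4 + 4 / theta) / c1); split => //.
  rewrite divr_gt0 // mulr_gt0 // addr_gt0 ?divr_gt0 // addr_gt0 // divr_gt0 //.
have [tau0 [tp t1 t2]] : exists tau0, [/\ 0 < tau0, tau0 * (2 * M) <= g / 2 &
     M * tau0 * (1 + 3 / c4) <= c1 / 2].
  have h1 : 0 < 1 + 3 / c4 by rewrite addr_gt0 // divr_gt0.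
  exists (Num.min (g / 2 / (2 * M)) (c1 / 2 / (M * (1 + 3 / c4)))); split.
  - rewrite lt_min; apply/andP; split; apply: divr_gt0; rewrite ?divr_gt0 ?mulr_gt0 //.
  - by rewrite -ler_pdivlMr ?mulr_gt0 // ge_min lexx.
  - by rewrite mulrAC mulrC -ler_pdivlMr ?mulr_gt0 // ge_min lexx orbT.
(* 2 pays for the displacement of two vertices, the quotient for twice the sup-norm error measured
   against the slope [c2], and the remaining 1 makes the inequality strict. *)
pose K := 3 + 2 * C * M / c2.
have K2 : 2 * C * M / c2 < K - 2 by rewrite /K; lra.
have Kp : 0 < 2 * C * M / c2 by rewrite divr_gt0 // !mulr_gt0.
(* [cut_form_le] takes a fourth root, and 16 comes from [N <= 4 * #|T|] squared. *)
exists K, tau0, (e0 ^+ 4 / 16), (n0 + 2)%N, F; split; first split => //.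
- by rewrite /K; lra.
- by rewrite divr_gt0 // exprn_gt0.
split => // N e T tau sig hn hN nt tt ws [G1 G2 G3] [lam [phi [slam phi0 phie ordsig ssig]]].
have n1 : (1 < #|T|)%N by clear -hn; lia.
have n00 : (0 < #|T|)%N by clear -hn; lia.
have [x0 x0T] : exists x0, x0 \in T by apply/card_gt0P.
have [[l0 f0 f1] [fsl fe dl ffn gap]] := H #|T| (leq_trans (leq_addr _ _) hn).
clear H hn.
set n := #|T| in n1 n00 hN nt f0 f1 fsl fe dl ffn gap *.
have nR : 0 < n%:R :> R by rewrite ltr0n.
have t0 : 0 < tau by rewrite -(pmulr_rgt0 _ nR); apply: lt_le_trans nt.
set f := F n in f0 f1 fsl fe ffn gap *.
set W := toep (grid rho n) in fe dl gap *.
pose A := adj_kernel R e T x0.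
pose Pm i j := mean_adj rho (nth x0 (enum T) i) (nth x0 (enum T) j).
have NR : N%:R <= 4 * n%:R :> R by rewrite -natrM ler_nat.
have AP i j : A i j - Pm i j = adj_dev rho e (nth x0 (enum T) i) (nth x0 (enum T) j) by [].
have PW i j : (i < n)%N -> (j < n)%N -> `|Pm i j - W i j| <= 2 * Lam * tau + (i == j)%:R.
  by move=> lin ljn; apply: (mean_adj_grid rho Lam T x0 tau i j P ws).
have PWsum (c : nat -> R) i : (i < n)%N -> (forall j, (j < n)%N -> `|c j| <= 1) ->
    `|\sum_(j < n) (Pm i j - W i j) * c j| <= 2 * Lam * tau * n%:R + 1.
  move=> lin hc; apply: le_trans (ler_norm_sum _ _ _) _.
  apply: le_trans (_ : \sum_(j < n) (2 * Lam * tau + (i == j :> nat)%:R) <= _).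
    apply: ler_sum => j _; rewrite normrM -[leRHS]mulr1.
    by apply: ler_pM => //; [exact: PW|exact: hc].
  rewrite big_split /= sumr_const card_ord -[_ *+ n]mulr_natr lerD2l.
  rewrite (bigD1 (Ordinal lin)) //= eqxx big1 ?addr0 // => j /negbTE.
  by rewrite -(inj_eq val_inj) /= eq_sym => ->.
have E1 i : (i < n)%N -> `|deg n A i - deg n W i| <= n%:R * (M * tau).
  move=> lin.
  have -> : deg n A i - deg n W i = \sum_(u in T) adj_dev rho e u (nth x0 (enum T) i)
       + \sum_(j < n) (Pm i j - W i j) * (fun=> 1) j.
    rewrite (sum_set_nth T x0) /deg -sumrB -big_split; apply: eq_bigr => j _ /=.
    by rewrite adj_devC -AP; ring.
  apply: le_trans (ler_normD _ _) _.
  have := G1 (nth x0 (enum T) i).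
  have h1 (j : nat) : (j < n)%N -> `|(fun=> 1 : R) j| <= 1 by rewrite normr1.
  have := PWsum (fun=> 1) i lin h1.
  have : N%:R * tau <= 4 * n%:R * tau by rewrite ler_pM2r.
  rewrite EM; clear -nt; lra.
have E2 i : (i < n)%N -> `|\sum_(j < n) (A i j - W i j) * f j| <= n%:R * (M * tau).
  move=> lin.
  have -> : \sum_(j < n) (A i j - W i j) * f j =
      \sum_(u in T) F n (index u (enum T)) * adj_dev rho e u (nth x0 (enum T) i)
       + \sum_(j < n) (Pm i j - W i j) * f j.
    rewrite (sum_set_nth T x0) -big_split; apply: eq_bigr => j _ /=.
    rewrite index_uniq ?enum_uniq -?cardE // adj_devC -AP -/f; ring.
  apply: le_trans (ler_normD _ _) _.
  have := G2 (nth x0 (enum T) i).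
  have := PWsum f i lin f1.
  have : N%:R * tau <= 4 * n%:R * tau by rewrite ler_pM2r.
  rewrite EM; clear -nt; lra.
pose B i j := if (i < n)%N && (j < n)%N then adj_dev rho e (nth x0 (enum T) i) (nth x0 (enum T) j) else 0.
have BE i j : (i < n)%N -> (j < n)%N -> B i j = A i j - Pm i j by move=> hi hj; rewrite /B hi hj.
have Bform (x : nat -> R) : `|dotn n x (fun i => \sum_(j < n) B i j * x j)| <= e0 * n%:R * dotn n x x.
  apply: cut_form_le => //.
  - by move=> i j; rewrite /B andbC adj_devC.
  - by move=> i j hi hj; rewrite /B hi hj; exact: (adj_dev_le1 rho Lam).
  move=> s t; have := G3 [ffun u => s (index u (enum T))] [ffun u => t (index u (enum T))].
  rewrite (sum_set_nth T x0) => h.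
  apply: le_trans (_ : e0 ^+ 4 / 16 * N%:R ^+ 2 <= _).
    apply: le_trans h; rewrite le_eqVlt; apply/orP; left; apply/eqP.
    apply: eq_bigr => i _; rewrite (sum_set_nth T x0); apply: eq_bigr => j _.
    by rewrite !ffunE !index_uniq ?enum_uniq -?cardE // BE.
  have : N%:R ^+ 2 <= 16 * n%:R ^+ 2 :> R.
    rewrite (_ : 16 * n%:R ^+ 2 = (4 * n%:R) ^+ 2); last by ring.
    by rewrite ler_pXn2r // nnegrE // mulr_ge0.
  move/(ler_wpM2l (ltW (exprn_gt0 4 e0p))); clear; lra.
have E3 (x : nat -> R) :
    `|dotn n x (fun i => \sum_(j < n) (A i j - W i j) * x j)| <= (e0 + (2 * Lam + 1) * tau) * n%:R * dotn n x x.
  have -> : dotn n x (fun i => \sum_(j < n) (A i j - W i j) * x j) =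
    dotn n x (fun i => \sum_(j < n) B i j * x j) + \sum_(i < n) \sum_(j < n) x i * ((Pm i j - W i j) * x j).
    rewrite /dotn -big_split; apply: eq_bigr => i _ /=; rewrite !mulr_sumr -big_split.
    by apply: eq_bigr => j _ /=; rewrite BE //; ring.
  have xx0 := dotn_ge0 n x.
  have h1 := near_diagonal_form n (fun i j => Pm i j - W i j) (2 * Lam * tau) x PW.
  apply: le_trans (ler_normD _ _) _.
  have h2 := Bform x.
  have h3 : 1 * dotn n x x <= n%:R * tau * dotn n x x by rewrite ler_wpM2r.
  clear -h1 h2 h3; lra.
have Mt : M * tau <= M * tau0 by rewrite ler_pM2l.
have te : M * tau + (e0 + (2 * Lam + 1) * tau) <= g.
  have h1 : tau * (2 * M) <= tau0 * (2 * M) by rewrite ler_pM2r // mulr_gt0.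
  have h2 : (2 * Lam + 1) * tau <= M * tau.
    by rewrite ler_pM2r // EM; lra.
  move: t1; rewrite Ee0; clear -h1 h2; lra.
have h1c4 : 0 < 1 + 3 / c4 by rewrite addr_gt0 // divr_gt0.
have tc : M * tau * (1 + 3 / c4) <= c1 / 2 by apply: le_trans t2; rewrite ler_pM2r.
have lapA_close (x : nat -> R) := dotn_lap_close n A W (M * tau) (e0 + (2 * Lam + 1) * tau) x E1 (E3 x).
have coer (x : nat -> R) : \sum_(i < n) x i = 0 ->
    rho 1 / 2 * n%:R * dotn n x x <= dotn n x (lap n A x).
  move=> xs; have xx0 := dotn_ge0 n x.
  have hW : rho 1 * n%:R * dotn n x x <= dotn n x (lap n W x).
    rewrite -(ler_pM2l (_ : 0 < 2)) // dotn_lap; last exact: toep_sym.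
    have -> : 2 * (rho 1 * n%:R * dotn n x x) = rho 1 * (2 * (n%:R * dotn n x x - (\sum_(i < n) x i) * (\sum_(i < n) x i))).
      by rewrite xs; ring.
    rewrite dotn_cov mulr_sumr; apply: ler_sum => i _.
    rewrite mulr_sumr; apply: ler_sum => j _.
    apply: ler_wpM2r; first by rewrite -expr2 sqr_ge0.
    have hij : (adist i j < n)%N by rewrite /adist; have := ltn_ord i; have := ltn_ord j; clear; lia.
    have [q1 q2 q3] := @grid_ratio R n (adist i j) (adist i j) hij (leqnn _).
    by have /andP[] := mono _ 1 q1 q3 (lexx _); rewrite subr_ge0.
  have := lapA_close x; rewrite ler_norml => /andP[h1 _].
  have h2 : (M * tau + (e0 + (2 * Lam + 1) * tau)) * n%:R * dotn n x x <= rho 1 / 2 * n%:R * dotn n x x.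
    by apply: ler_wpM2r => //; rewrite ler_pM2r //; apply: le_trans te _.
  clear -h1 h2 hW; lra.
have mu0 : 0 < rho 1 / 2 * n%:R by rewrite mulr_gt0 // divr_gt0.
have [phin0 phis phil lam_min] := lapT_second_eig e T x0 lam _ phi n1 mu0 coer slam phi0 phie.
rewrite -/n -/A in phin0 phis phil lam_min.
have A1 i j : (i < n)%N -> (j < n)%N -> `|A i j| <= 1.
  by move=> _ _; rewrite /A /adj_kernel; case: adj; rewrite ?normr1 ?normr0.
have Mt0 : 0 <= M * tau by rewrite mulr_ge0 // ltW.
have ee0 : 0 <= e0 + (2 * Lam + 1) * tau by rewrite addr_ge0 ?mulr_ge0 // ?ltW // addr_gt0 // mulr_gt0.
have [a an0 Ha] := fiedler_perturbation n A W f (nat_of_row phi) (L n) lam c1 c4 theta (M * tau) _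
  n00 c1p c4p thp Mt0 ee0 (adj_kernelC e T x0) (toep_sym _) A1 f0 f1 fe dl ffn gap E1 E2 E3
  (le_trans te gth) tc phin0 phis phil (lam_min f f0).
rewrite -EC in Ha.
have sep i j : (i < n)%N -> (j < n)%N ->
    vpos R (nth x0 (enum T) i) + K * tau <= vpos R (nth x0 (enum T) j) ->
    [/\ (i < j)%N & 2 * (C * (M * tau)) < f j - f i].
  move=> lin ljn hij.
  have := ws x0 i lin; have := ws x0 j ljn; rewrite -/n !ler_norml => /andP[_ w1] /andP[w2 _].
  have Kt : 2 * C * M / c2 * tau < (K - 2) * tau by rewrite ltr_pM2r.
  have Kt0 : 0 < 2 * C * M / c2 * tau by rewrite mulr_gt0.
  have dij : 2 * C * M / c2 * tau < j.+1%:R / n%:R - i.+1%:R / n%:R by clear -w1 w2 hij Kt; lra.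
  have ij : (i < j)%N.
    rewrite ltnNge; apply/negP => ji.
    have : j.+1%:R / n%:R <= i.+1%:R / n%:R :> R by rewrite ler_pM2r ?invr_gt0 // ler_nat.
    clear -dij Kt0; lra.
  split => //; apply: lt_le_trans (fsl i j (ltnW ij) ljn).
  have -> : c2 * (j - i)%:R / n%:R = c2 * (j.+1%:R / n%:R - i.+1%:R / n%:R).
    by rewrite -mulrBl -natrB ?ltnS 1?ltnW // subSS mulrA.
  have := dij; rewrite -(ltr_pM2l c2p); apply: le_lt_trans.
  by rewrite le_eqVlt; apply/orP; left; apply/eqP; field; rewrite gt_eqF.
have vtx u : u \in T -> exists i, [/\ (i < n)%N, u = nth x0 (enum T) i &
    forall v j, (j < n)%N -> v = nth x0 (enum T) j ->
      nat_of_row phi i < nat_of_row phi j -> (sig u < sig v)%N].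
  move=> uT; have iu : (index u (enum T) < n)%N by rewrite /n cardE index_mem mem_enum.
  exists (index u (enum T)); split => //; first by rewrite nth_index // mem_enum.
  move=> v j ljn Ev; rewrite (nat_of_rowE phi (Ordinal iu)) (nat_of_rowE phi (Ordinal ljn)) => h.
  have := ssig _ _ h; rewrite !(enum_val_nth x0) /= -Ev nth_index // mem_enum //.
(* An eigenvector is determined only up to sign; the sign of [a] decides between the order and its
   reverse. *)
have [ap|an|a0] := ltgtP a 0; last by rewrite a0 eqxx in an0.
- right=> u v uT vT huv.
  have [i [lin Eu Hu]] := vtx u uT; have [j [ljn Ev Hv]] := vtx v vT.
  apply: (Hu v j ljn Ev).
  have hji : vpos R (nth x0 (enum T) j) + K * tau <= vpos R (nth x0 (enum T) i).
    by rewrite -Eu -Ev; clear -huv; lra.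
  have [_ hf] := sep j i ljn lin hji.
  have := Ha i lin; have := Ha j ljn; rewrite !ler_norml (ltr0_norm ap) => /andP[b1 b2] /andP[b3 b4].
  have := hf; rewrite -(ltr_nM2l ap); clear -b1 b2 b3 b4; lra.
- left=> u v uT vT huv.
  have [i [lin Eu Hu]] := vtx u uT; have [j [ljn Ev Hv]] := vtx v vT.
  apply: (Hu v j ljn Ev).
  have hji : vpos R (nth x0 (enum T) i) + K * tau <= vpos R (nth x0 (enum T) j).
    by rewrite -Eu -Ev; clear -huv; lra.
  have [_ hf] := sep i j lin ljn hji.
  have := Ha i lin; have := Ha j ljn; rewrite !ler_norml (gtr0_norm an) => /andP[b1 b2] /andP[b3 b4].
  have := hf; rewrite -(ltr_pM2l an); clear -b1 b2 b3 b4; lra.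
Qed.

(** * Scores, thresholds and the pairwise comparison *)

Definition spread {R : realType} {N : nat} (q : 'I_N -> R) (T : {set 'I_N}) (tau : R) : Prop :=
  forall x, 0 <= x <= 1 ->
    (#|[set u in T | q u < x]|)%:R <= #|T|%:R * (x + tau) /\
    #|T|%:R * (x - tau) <= (#|[set u in T | q u <= x]|)%:R.

Lemma card_split {N : nat} (T : {set 'I_N}) (P : pred 'I_N) :
  (#|[set u in T | P u]| + #|[set u in T | ~~ P u]| = #|T|)%N.
Proof.
rewrite -(cardsID [set u | P u] T); congr (_ + _)%N; apply: eq_card => u; rewrite !inE //.
by rewrite andbC.
Qed.

(** In [spread] the upper bound is on a strict count and the lower bound on a weak one;
    complementation exchanges them, which makes the notion symmetric under reversal. *)
Lemma spread_rev {R : realType} {N : nat} (q : 'I_N -> R) (T : {set 'I_N}) (tau : R) :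
  spread q T tau -> spread (fun u => 1 - q u) T tau.
Proof.
move=> sp x /andP[x0 x1].
have h : 0 <= 1 - x <= 1 by apply/andP; split; lra.
have [h1 h2] := sp _ h; split.
  have := card_split T (fun u => q u <= 1 - x) => /(congr1 (fun k => k%:R : R)); rewrite natrD => E.
  rewrite (_ : [set u in T | 1 - q u < x] = [set u in T | ~~ (q u <= 1 - x)]); first by lra.
  by apply/setP => u; rewrite !inE -ltNge ltrBlDl ltrBlDr addrC.
have := card_split T (fun u => q u < 1 - x) => /(congr1 (fun k => k%:R : R)); rewrite natrD => E.
rewrite (_ : [set u in T | 1 - q u <= x] = [set u in T | ~~ (q u < 1 - x)]); first by lra.
by apply/setP => u; rewrite !inE -leNgt lerBlDl lerBlDr addrC.
Qed.

Lemma spread_lt {R : realType} {N : nat} (q : 'I_N -> R) (T : {set 'I_N}) (tau x : R) :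
  spread q T tau -> 0 <= tau -> 0 <= x ->
  (#|[set u in T | q u < x]|)%:R <= #|T|%:R * (x + tau).
Proof.
move=> sp t0 x0; have [x1|x1] := leP x 1; first by have [] := sp x; rewrite ?x0.
apply: le_trans (_ : #|T|%:R <= _).
  by rewrite ler_nat; apply: subset_leq_card; apply/fintype.subsetP => u; rewrite inE => /andP[].
by rewrite ler_peMr //; lra.
Qed.

Lemma spread_le {R : realType} {N : nat} (q : 'I_N -> R) (T : {set 'I_N}) (tau x : R) :
  spread q T tau -> 0 <= tau -> x <= 1 ->
  #|T|%:R * (x - tau) <= (#|[set u in T | q u <= x]|)%:R.
Proof.
move=> sp t0 x1; have [x0|x0] := leP 0 x; first by have [] := sp x; rewrite ?x0.
by apply: le_trans (_ : 0 <= _) => //; rewrite nmulr_lle0 ?ler0n //; lra.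
Qed.

Lemma card_ordering_lt {N : nat} (T : {set 'I_N}) (sig : 'I_N -> nat) (k : nat) :
  {in T &, injective sig} -> (#|[set u in T | (sig u < k)%N]| <= k)%N.
Proof.
move=> inj; rewrite -[X in (_ <= X)%N](size_iota 0 k) cardE -(size_map sig).
apply: uniq_leq_size.
  rewrite map_inj_in_uniq ?enum_uniq // => u v; rewrite !mem_enum !inE.
  by move=> /andP[uT _] /andP[vT _]; exact: inj.
by move=> x /mapP [u]; rewrite mem_enum inE => /andP[_ us] ->; rewrite mem_iota.
Qed.

Lemma card_ordering_ge {N : nat} (T : {set 'I_N}) (sig : 'I_N -> nat) (k : nat) :
  is_ordering T sig -> (k <= #|T|)%N -> (k <= #|[set u in T | (sig u < k)%N]|)%N.
Proof.
move=> [inj lt] kn.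
have := card_split T (fun u => (sig u < k)%N).
have : (#|[set u in T | ~~ (sig u < k)%N]| <= #|T| - k)%N.
  apply: leq_trans (card_ordering_lt [set u in T | ~~ (sig u < k)%N] (fun u => sig u - k)%N (#|T| - k) _).
    apply: subset_leq_card; apply/fintype.subsetP => u; rewrite !inE -leqNgt => /andP[uT us].
    by rewrite uT us /= ltn_sub2r ?lt // (leq_ltn_trans us) ?lt.
  move=> u v; rewrite !inE -!leqNgt => /andP[uT us] /andP[vT vs] E.
  apply: inj => //; by rewrite -(subnK us) -(subnK vs) E.
by move=> h E; rewrite -(leq_add2r (#|T| - k)) subnKC // -[X in (X <= _)%N]E leq_add2l.
Qed.

(** The vertices ranked no later than [u] all lie to the left of [q u + omega], and the rank tells
    how many they are. *)
Lemma rank_le {R : realType} {N : nat} (q : 'I_N -> R) (T : {set 'I_N}) (tau omega : R)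
    (sig : 'I_N -> nat) u :
  spread q T tau -> 0 <= tau -> 0 <= q u -> 0 <= omega -> is_ordering T sig ->
  orders_up_to q T omega sig -> u \in T -> ((sig u).+1)%:R <= #|T|%:R * (q u + omega + tau).
Proof.
move=> sp t0 q0 w0 ord ou uT; apply: le_trans (spread_lt q T tau (q u + omega) sp t0 (addr_ge0 q0 w0)).
rewrite ler_nat; apply: leq_trans (card_ordering_ge T sig (sig u).+1 ord (ord.2 u uT)) _.
apply: subset_leq_card; apply/fintype.subsetP => v; rewrite !inE => /andP[vT vs]; rewrite vT /=.
by rewrite ltNge; apply/negP => /(ou u v uT vT); rewrite ltnNge -ltnS vs.
Qed.

Lemma rank_ge {R : realType} {N : nat} (q : 'I_N -> R) (T : {set 'I_N}) (tau omega : R)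
    (sig : 'I_N -> nat) u :
  spread q T tau -> 0 <= tau -> q u <= 1 -> 0 <= omega -> is_ordering T sig ->
  orders_up_to q T omega sig -> u \in T -> #|T|%:R * (q u - omega - tau) <= (sig u)%:R.
Proof.
move=> sp t0 q1 w0 [inj _] ou uT.
have q1' : q u - omega <= 1 by lra.
apply: le_trans (spread_le q T tau (q u - omega) sp t0 q1') _.
rewrite ler_nat; apply: leq_trans (card_ordering_lt T sig (sig u) inj).
apply: subset_leq_card; apply/fintype.subsetP => v; rewrite !inE => /andP[vT vs]; rewrite vT /=.
by apply: ou => //; rewrite -lerBrDr.
Qed.

(** Seen from [x] in the top five percent, a point [m <= 75/100] is at distance at least 20/100, so
    the slope bound applies between [x - m] and [x - a] as soon as [x <= 98/100]. A point [b] beyond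
    [x] is at distance at most 5/100, closer than [m]. *)
Lemma mean_adj_step {R : realType} (rho : R -> R) (Lam kappa : R) :
  decay_profile rho Lam ->
  (forall x y, 2 / 100 <= x -> x <= y -> y <= 1 - 2 / 100 -> kappa * (y - x) <= rho x - rho y) ->
  forall x a b m, 95 / 100 <= x <= 1 -> 0 <= a -> a <= m -> m <= b -> b <= 1 -> m <= 75 / 100 ->
  ((x <= 98 / 100)%R)%:R * (kappa * (m - a)) <= rho `|x - b| - rho `|x - a|.
Proof.
move=> [_ _ mono _] slope x a b m /andP[x0 x1] a0 am mb b1 m1.
have h1 : `|x - b| <= x - m by rewrite ler_norml; apply/andP; split; lra.
have h2 : `|x - a| = x - a by rewrite ger0_norm //; lra.
have h3 : x - m <= 1 by lra.
have h4 : x - a <= 1 by lra.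
have h5 : 0 <= x - m by lra.
have h6 : x - m <= x - a by lra.
have /andP[g1 _] := mono _ _ (normr_ge0 _) h1 h3.
have /andP[g2 _] := mono _ _ h5 h6 h4.
rewrite h2; case: (leP x (98 / 100)) => hx /=; last by rewrite mul0r; lra.
have k1 : 2 / 100 <= x - m by lra.
have k2 : x - a <= 1 - 2 / 100 by lra.
have := slope _ _ k1 h6 k2; rewrite mul1r; lra.
Qed.

(* Only the vertices of [X] inside the top five percent contribute to the drop; [m] is an
   intermediate position that keeps the drop estimate away from the end of the interval. *)
Lemma psi_step {R : realType} (rho : R -> R) (Lam kappa : R) {N : nat} (e : graph N)
    (T S X : {set 'I_N}) (q : 'I_N -> R) (tau omega : R) :
  decay_profile rho Lam -> 0 < kappa ->
  (forall x y, 2 / 100 <= x -> x <= y -> y <= 1 - 2 / 100 -> kappa * (y - x) <= rho x - rho y) ->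
  (forall u, 0 <= q u <= 1) -> (forall u v, `|q u - q v| = `|vpos R u - vpos R v|) ->
  [disjoint T & S] -> (0 < #|T|)%N -> (N <= 4 * #|T|)%N ->
  spread q T tau -> 0 <= tau <= 5 / 1000 -> 0 < omega <= 1 / 100 ->
  X \subset T -> {in X, forall u, 95 / 100 - omega <= q u} ->
  {in T, forall u, 95 / 100 + omega <= q u -> u \in X} ->
  (forall v, `|\sum_(u in [set u in T | 95 / 100 <= q u]) adj_dev rho e u v| <= N%:R * tau) ->
  {in S &, forall v w m, q v <= m -> m <= q w -> m <= 75 / 100 ->
     2 / 100 * kappa * (m - q v) - 2 * (6 * tau + 3 * omega) <= psi R e T X w - psi R e T X v}.
Proof.
move=> P kp slope q01 qv dTS T0 NT spT /andP[t0 t1] /andP[w0 w1] XT X1 X2 dev v w vS wS m vm mw m75.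
have nR : 0 < #|T|%:R :> R by rewrite ltr0n.
pose R0 := [set u in T | 95 / 100 <= q u].
pose H x := \sum_(u in R0) rho `|q u - q x|.
have R0T u : u \in R0 -> u \in T by rewrite inE => /andP[].
have NR : N%:R <= 4 * #|T|%:R :> R by rewrite -natrM ler_nat.
have psiE (Y : {set 'I_N}) x : (#|[set u in Y | adj e u x]|)%:R = \sum_(u in Y) (adj e u x)%:R :> R.
  rewrite -sum1_card natr_sum (eq_bigl (fun u => (u \in Y) && adj e u x)); last by move=> u; rewrite inE.
  by rewrite big_mkcondr /=; apply: eq_bigr => u _; case: adj.
(* [4 * tau] is the noise, and [2 * tau + 3 * omega] counts the vertices within [omega] of the cut
   at 95/100, the only ones where [X] and the ideal end set [R0] may differ. *)
have close x : x \in S -> `|#|T|%:R * psi R e T X x - H x| <= #|T|%:R * (6 * tau + 3 * omega).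
  move=> xS.
  have h1 : `|\sum_(u in R0) (adj e u x)%:R - H x| <= N%:R * tau.
    apply: le_trans (dev x); rewrite le_eqVlt; apply/orP; left; apply/eqP; congr `|_|.
    rewrite /H -sumrB; apply: eq_bigr => u uR; rewrite /adj_dev /mean_adj /wfun qv.
    case: eqP => // ux; have := R0T u uR; rewrite ux => xT.
    by have := disjointFr dTS xT; rewrite xS.
  have h2 : `|\sum_(u in X) (adj e u x)%:R - \sum_(u in R0) (adj e u x)%:R : R| <=
      (#|[set u in T | (95 / 100 - omega <= q u) && (q u < 95 / 100 + omega)]|)%:R.
    rewrite -sum1_card natr_sum big_mkcond [X in _ - X]big_mkcond [leRHS]big_mkcond -sumrB.
    apply: le_trans (ler_norm_sum _ _ _) _; apply: ler_sum => u _.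
    have [uX|uX] := boolP (u \in X).
      have uT := fintype.subsetP XT u uX; have qu := X1 u uX.
      rewrite /R0 !inE uT qu /=; case: (leP (95 / 100) (q u)) => q95; first by rewrite subrr normr0; case: ifP.
      have -> : q u < 95 / 100 + omega by clear -q95 w0; lra.
      by rewrite subr0; case: adj; rewrite ?normr1 ?normr0.
    rewrite /R0 !inE; have [uT|uT] := boolP (u \in T) => /=; last by rewrite subrr normr0.
    case: (leP (95 / 100) (q u)) => q95; last by rewrite subrr normr0; case: ifP.
    have -> : 95 / 100 - omega <= q u by clear -q95 w0; lra.
    have -> : q u < 95 / 100 + omega by rewrite ltNge; apply: contra uX; exact: X2.
    by rewrite sub0r normrN /=; case: adj; rewrite ?normr1 ?normr0.
  have h3 : (#|[set u in T | (95 / 100 - omega <= q u) && (q u < 95 / 100 + omega)]|)%:R <=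
      #|T|%:R * (3 * omega + 2 * tau).
    have h4 : 0 <= 95 / 100 + omega by clear -w0; lra.
    have h5 : 95 / 100 - 2 * omega <= 1 by clear -w0; lra.
    have b1 := spread_lt q T tau _ spT t0 h4.
    have b2 := spread_le q T tau _ spT t0 h5.
    pose Sa := [set u in T | (95 / 100 - omega <= q u) && (q u < 95 / 100 + omega)].
    pose Sb := [set u in T | q u <= 95 / 100 - 2 * omega].
    pose Sc := [set u in T | q u < 95 / 100 + omega].
    rewrite -/Sa -/Sb -/Sc in b1 b2 *.
    have b3 : (#|Sa| + #|Sb| <= #|Sc|)%N.
      rewrite -cardsUI [X in (_ + X)%N](_ : _ = 0%N) ?addn0; last first.
        apply: eq_card0 => u; rewrite !inE; apply/negP => /andP[/and3P[_ c1 _] /andP[_ c2]]; clear -c1 c2 w0; lra.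
      apply: subset_leq_card; apply/fintype.subsetP => u; rewrite !inE => /orP[/and3P[-> _ ->] //|].
      by move=> /andP[-> c2] /=; clear -c2 w0; lra.
    rewrite -(ler_nat R) natrD in b3; clear -b1 b2 b3; lra.
  have E : #|T|%:R * psi R e T X x = \sum_(u in X) (adj e u x)%:R.
    by rewrite /psi psiE mulrC divfK // gt_eqF.
  have h4 : N%:R * tau <= 4 * #|T|%:R * tau by rewrite ler_wpM2r.
  rewrite E (_ : _ - _ = (\sum_(u in X) (adj e u x)%:R - \sum_(u in R0) (adj e u x)%:R) +
      (\sum_(u in R0) (adj e u x)%:R - H x)); last by ring.
  apply: le_trans (ler_normD _ _) _; clear -h1 h2 h3 h4; lra.
have [/andP[qv0 qv1] /andP[qw0 qw1]] := (q01 v, q01 w).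
(* The stretch from 95/100 to 98/100 holds a share of at least [3/100 - 2 * tau] of [T], hence the
   factor 2/100. *)
have HH : #|T|%:R * (2 / 100 * kappa * (m - q v)) <= H w - H v.
  rewrite /H -sumrB; apply: le_trans (_ : \sum_(u in R0) ((q u <= 98 / 100)%R)%:R * (kappa * (m - q v)) <= _).
    have hm : 0 <= kappa * (m - q v) by rewrite mulr_ge0 ?subr_ge0 // ltW.
    rewrite (_ : _ * (_ * _ * _) = #|T|%:R * (2 / 100) * (kappa * (m - q v))); last by ring.
    rewrite -mulr_suml; apply: ler_wpM2r => //.
    have h4 : 0 <= 95 / 100 :> R by clear; lra.
    have h5 : 98 / 100 <= 1 :> R by clear; lra.
    have b1 := spread_lt q T tau _ spT t0 h4.
    have b2 := spread_le q T tau _ spT t0 h5.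
    pose Sa := [set u in T | q u <= 98 / 100].
    pose Sb := [set u in T | q u < 95 / 100].
    pose Sc := [set u in R0 | q u <= 98 / 100].
    rewrite -/Sa -/Sb in b1 b2.
    have b3 : (#|Sa| <= #|Sb| + #|Sc|)%N.
      apply: leq_trans (leq_card_setU Sb Sc); apply: subset_leq_card.
      apply/fintype.subsetP => u; rewrite !inE => /andP[-> ->] /=; rewrite andbT.
      by case: ltP.
    have -> : \sum_(u in R0) ((q u <= 98 / 100)%R)%:R = #|Sc|%:R :> R.
      rewrite -sum1_card natr_sum (eq_bigl (fun u => (u \in R0) && (q u <= 98 / 100))); last by move=> u; rewrite inE.
      by rewrite big_mkcondr /=; apply: eq_bigr => u _; case: (_ <= _)%R.
    rewrite -(ler_nat R) natrD in b3.
    have : #|T|%:R * tau <= #|T|%:R * (5 / 1000) by rewrite ler_wpM2l.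
    clear -b1 b2 b3; lra.
  apply: ler_sum => u; rewrite inE => /andP[uT q95]; have /andP[_ qu1] := q01 u.
  by apply: (mean_adj_step rho Lam kappa P slope) => //; rewrite q95.
have := close v vS; have := close w wS; rewrite !ler_norml => /andP[a1 _] /andP[_ a2].
rewrite -(ler_pM2l nR); clear -HH a1 a2; lra.
Qed.

Definition score_step {R : realType} {N : nat} (q p : 'I_N -> R) (S : {set 'I_N}) (kappa eta : R) : Prop :=
  {in S &, forall v w m, q v <= m -> m <= q w -> m <= 75 / 100 ->
     kappa * (m - q v) - eta <= p w - p v}.

(** The value 31/100 puts the threshold at the 69 percent quantile of the scores. A vertex beyond
    75/100 scores at least as high as all vertices up to 70/100, so its score is admissible in the
    infimum. Below the threshold a vertex is thus in the range where [score_step] sees its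
    position. *)
Lemma thresh_gt {R : realType} {N : nat} (q p : 'I_N -> R) (S : {set 'I_N}) (kappa eta tau : R) :
  0 < kappa -> eta <= kappa / 100 -> score_step q p S kappa eta ->
  (forall u, 0 <= p u) -> spread q S tau -> 0 <= tau <= 5 / 1000 ->
  {in S, forall v, p v < thresh S (31 / 100) p -> q v <= 75 / 100}.
Proof.
move=> kp he step p0 spS /andP[t0 t1] v vS; apply: contraTT; rewrite -ltNge -leNgt => qv.
apply: ge_inf; first by exists 0 => c /= [].
split=> //.
have h7 : 70 / 100 <= 1 :> R by lra.
have sR : 0 <= #|S|%:R :> R by rewrite ler0n.
apply: le_trans (le_trans (_ : _ <= #|S|%:R * (70 / 100 - tau)) (spread_le q S tau (70 / 100) spS t0 h7)) _.
  by rewrite mulrC; apply: ler_wpM2l => //; lra.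
rewrite ler_nat; apply: subset_leq_card; apply/fintype.subsetP => w; rewrite !inE => /andP[wS qw].
rewrite wS /= -subr_ge0; apply: le_trans (step w v wS vS (75 / 100) _ (ltW qv) (lexx _)); last by lra.
have : kappa * (5 / 100) <= kappa * (75 / 100 - q w) by rewrite ler_pM2l //; lra.
lra.
Qed.

(** Fewer than 69 percent of the vertices lie left of 68/100, so an admissible level reaches the
    score of some vertex at or beyond it, which exceeds every score up to 65/100 by a fixed
    margin. *)
Lemma thresh_lt {R : realType} {N : nat} (q p : 'I_N -> R) (S : {set 'I_N}) (kappa eta tau : R) :
  0 < kappa -> eta <= kappa / 100 -> score_step q p S kappa eta -> (0 < #|S|)%N ->
  (forall u, 0 <= p u) -> spread q S tau -> 0 <= tau <= 5 / 1000 ->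
  {in S, forall v, q v <= 65 / 100 -> p v < thresh S (31 / 100) p}.
Proof.
move=> kp he step S0 p0 spS /andP[t0 t1] v vS qv.
have sR : 0 < #|S|%:R :> R by rewrite ltr0n.
have d0 : p v < p v + (kappa * (3 / 100) - eta) by rewrite ltrDl; lra.
apply: lt_le_trans d0 _; apply: lb_le_inf.
  exists (\sum_(u in S) p u); split; first by apply: sumr_ge0.
  rewrite (_ : [set u in S | _] = S); last first.
    apply/setP => u; rewrite inE; have [uS|//] := boolP (u \in S).
    by rewrite (bigD1 u) //= lerDl sumr_ge0.
  by rewrite ler_piMl ?ltW //; lra.
move=> c /= [c0 hc].
have [w /andP[wS wc] qw] : exists2 w, (w \in S) && (p w <= c) & 68 / 100 <= q w.
  apply: contrapT => hno.
  have h6 : 0 <= 68 / 100 :> R by lra.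
  have : (#|[set u in S | p u <= c]|)%:R <= (#|[set u in S | q u < 68 / 100]|)%:R :> R.
    rewrite ler_nat; apply: subset_leq_card; apply/fintype.subsetP => w.
    rewrite !inE => /andP[wS wc]; rewrite wS /= ltNge; apply/negP => qw.
    by apply: hno; exists w; rewrite ?wS.
  have := spread_lt q S tau (68 / 100) spS t0 h6.
  move: hc; move: (#|[set u in S | p u <= c]|)%:R (#|[set u in S | q u < 68 / 100]|)%:R => a b.
  clear -t1 sR => h1 h2 h3.
  have : #|S|%:R * (68 / 100 + tau) < #|S|%:R * (69 / 100) by rewrite ltr_pM2l //; lra.
  lra.
apply: le_trans wc; rewrite -lerBrDl.
apply: le_trans (step v w vS wS (68 / 100) _ qw _); [|lra|lra].
have : kappa * (3 / 100) <= kappa * (68 / 100 - q v) by rewrite ler_pM2l //; lra.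
lra.
Qed.

Lemma Fhat_antisym {R : realType} {N : nat} (pR pL : 'I_N -> R) (cR cL : R) u v :
  Fhat pR pL cR cL u v = - Fhat pR pL cR cL v u.
Proof. by rewrite /Fhat; case: ltngtP; rewrite ?opprK ?oppr0. Qed.

Lemma Fhat_le1 {R : realType} {N : nat} (pR pL : 'I_N -> R) (cR cL : R) u v :
  Fhat pR pL cR cL u v <= 1.
Proof.
have h a b : -1 <= Fup pR pL cR cL a b <= 1.
  by rewrite /Fup; do ![case: ifP => _]; lra.
by rewrite /Fhat; have := h u v; have := h v u; do ![case: ifP => _]; lra.
Qed.

(** A pair that reaches the last clause has [u] below [cR]: otherwise [u], and with it [v], lies
    beyond 65/100, and both would be below [cL] and compared by [pL]. The gap [D] makes the score
    differences strict, so the index-dependent treatment of ties never matters. *)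
Lemma Fhat_eq1 {R : realType} {N : nat} (q pR pL : 'I_N -> R) (cR cL : R) (S : {set 'I_N})
    (tau kappa eta D : R) :
  0 < kappa -> eta <= kappa / 100 -> eta < kappa * D -> 0 < D -> (0 < #|S|)%N ->
  score_step q pR S kappa eta -> score_step (fun u => 1 - q u) pL S kappa eta ->
  (forall u, 0 <= pR u) -> (forall u, 0 <= pL u) ->
  spread q S tau -> 0 <= tau <= 5 / 1000 ->
  cR = thresh S (31 / 100) pR -> cL = thresh S (31 / 100) pL ->
  {in S &, forall u v, q u + D <= q v -> Fhat pR pL cR cL u v = 1}.
Proof.
move=> kp he hD D0 S0 stR stL pR0 pL0 spS ht EcR EcL u v uS vS huv.
have spS' := spread_rev q S tau spS.
have R2 := thresh_gt q pR S kappa eta tau kp he stR pR0 spS ht.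
have R3 := thresh_lt q pR S kappa eta tau kp he stR S0 pR0 spS ht.
have L2 := thresh_gt _ pL S kappa eta tau kp he stL pL0 spS' ht.
have L3 := thresh_lt _ pL S kappa eta tau kp he stL S0 pL0 spS' ht.
rewrite -EcR in R2 R3; rewrite -EcL in L2 L3.
have cmpR : pR v < cR -> pR u < pR v.
  move=> hv; have qv := R2 v vS hv.
  have := stR u v uS vS (q v) (le_trans (ltW (ltr_pwDr D0 (lexx _))) huv) (lexx _) qv.
  have h : kappa * D <= kappa * (q v - q u) by rewrite ler_pM2l //; clear -huv; lra.
  clear -h hD; lra.
have cmpL : pL u < cL -> pL v < pL u.
  move=> hu; have qu := L2 u uS hu.
  have h1 : 1 - q v <= 1 - q u by clear -huv D0; lra.
  have := stL v u vS uS (1 - q u) h1 (lexx _) qu.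
  have h : kappa * D <= kappa * (1 - q u - (1 - q v)).
    by rewrite ler_pM2l //; clear -huv; lra.
  clear -h hD; lra.
have third : ~~ ((pR u < cR) && (pR v < cR)) -> ~~ ((pL u < cL) && (pL v < cL)) ->
    (pR u < cR) && ~~ (pR v < cR).
  move=> nR nL; have [hu|hu] := boolP (pR u < cR); first by rewrite hu in nR.
  exfalso; move/negP: nL; apply.
  have qu : 65 / 100 < q u by rewrite ltNge; apply: contra hu; exact: R3.
  by apply/andP; split; apply: L3 => //; clear -qu huv D0; lra.
rewrite /Fhat; case: ltngtP => uv.
- rewrite /Fup; case: ifP => [/andP[_ hv]|/negbT nR]; first by rewrite ltNge ltW // cmpR.
  case: ifP => [/andP[hu _]|/negbT nL]; first by rewrite ltNge ltW // cmpL.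
  by have /andP[-> _] := third nR nL.
- rewrite /Fup andbC; case: ifP => [/andP[_ hv]|/negbT nR].
    by rewrite cmpR ?opprK // .
  rewrite andbC; case: ifP => [/andP[hu _]|/negbT nL].
    by rewrite cmpL ?opprK.
  by have /andP[_ /negbTE ->] := third nR nL; rewrite opprK.
exfalso; have Euv : u = v by apply: val_inj.
by move: huv; rewrite Euv; clear -D0; lra.
Qed.

(** When [v] and [w] are [2 * D] apart, every [u] is [D] to the left of [w] or [D] to the right of
    [v], and in both cases its vote for [w] is at least its vote for [v]. The vote of [v] itself
    makes the sums differ. *)
Lemma Fhat_sum_order {R : realType} {N : nat} (q : 'I_N -> R) (F : 'I_N -> 'I_N -> R)
    (S : {set 'I_N}) (D : R) (sig : 'I_N -> nat) :
  0 < D -> (forall u v, F u v = - F v u) -> (forall u v, F u v <= 1) ->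
  {in S &, forall u v, q u + D <= q v -> F u v = 1} ->
  ordered_by (fun v => \sum_(u in S) F u v) S sig ->
  orders_up_to q S (2 * D) sig.
Proof.
move=> D0 anti le1 F1 [_ ord] v w vS wS hvw; apply: ord => //.
have Fvv : F v v = 0 by have := anti v v; lra.
have Fvw : F v w = 1 by apply: F1 => //; lra.
rewrite (bigD1 v) //= [ltRHS](bigD1 v) //= Fvv Fvw.
apply: ltr_leD; first by rewrite ltr01.
apply: ler_sum => u /andP[uS _].
have [h|h] := leP (q u + D) (q w); first by rewrite (F1 u w).
rewrite (anti u v) (F1 v u) //; last by lra.
by have := le1 w u; rewrite (anti u w); lra.
Qed.

(** The end sets are cut by position and do not depend on the graph; the computed sets [R] and [L]
    differ from them only near the cut. *)
Definition ends_regular {R : realType} (rho : R -> R) {N : nat} (e : graph N) (T : {set 'I_N})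
    (q : 'I_N -> R) (tau : R) : Prop :=
  (forall v, `|\sum_(u in [set u in T | 95 / 100 <= q u]) adj_dev rho e u v| <= N%:R * tau) /\
  (forall v, `|\sum_(u in [set u in T | 95 / 100 <= 1 - q u]) adj_dev rho e u v| <= N%:R * tau).

Lemma ends_regular_rev {R : realType} (rho : R -> R) {N : nat} (e : graph N) (T : {set 'I_N})
    (q : 'I_N -> R) (tau : R) :
  ends_regular rho e T q tau -> ends_regular rho e T (fun u => 1 - q u) tau.
Proof.
move=> [h1 h2]; split => // v.
rewrite (_ : [set u in T | 95 / 100 <= 1 - (1 - q u)] = [set u in T | 95 / 100 <= q u]) //.
by apply/setP => u; rewrite !inE subKr.
Qed.

Lemma subroutine_order_oriented {R : realType} (rho : R -> R) (Lam kappa : R) {N : nat} (e : graph N)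
    (T S : {set 'I_N}) (q : 'I_N -> R) (tau K : R) (sigT sigma : 'I_N -> nat) :
  decay_profile rho Lam -> 0 < kappa ->
  (forall x y, 2 / 100 <= x -> x <= y -> y <= 1 - 2 / 100 -> kappa * (y - x) <= rho x - rho y) ->
  (forall u, 0 <= q u <= 1) -> (forall u v, `|q u - q v| = `|vpos R u - vpos R v|) ->
  [disjoint T & S] -> (0 < #|T|)%N -> (0 < #|S|)%N -> (N <= 4 * #|T|)%N ->
  spread q T tau -> spread q S tau -> 0 < tau -> 0 < K ->
  tau <= 5 / 1000 -> (K + 1) * tau <= 1 / 100 -> (36 + 12 * K) * tau <= kappa / 5000 ->
  ends_regular rho e T q tau -> is_ordering T sigT -> orders_up_to q T (K * tau) sigT ->
  let Rs := [set u in T | (1 - 5 / 100) * (#|T|)%:R <= ((sigT u).+1)%:R :> R] in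
  let Ls := [set u in T | ((sigT u).+1)%:R <= 5 / 100 * (#|T|)%:R :> R] in
  let pR := psi R e T Rs in
  let pL := psi R e T Ls in
  let cR := thresh S (31 / 100) pR in
  let cL := thresh S (31 / 100) pL in
  ordered_by (fun v => \sum_(u in S) Fhat pR pL cR cL u v) S sigma ->
  orders_up_to q S (200 * (18 + 6 * K) / kappa * tau) sigma.
Proof.
move=> P kp slope q01 qv dTS T0 S0 NT spT spS t0 K0 t1 Kt kt [dev1 dev2] ordT ouT Rs Ls pR pL cR cL ord.
have nR : 0 < #|T|%:R :> R by rewrite ltr0n.
have Kt0 : 0 <= K * tau by rewrite mulr_ge0 // ltW.
have w0 : 0 < (K + 1) * tau <= 1 / 100 by rewrite Kt mulr_gt0 // addr_gt0.
have t01 : 0 <= tau <= 5 / 1000 by rewrite ltW.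
have up u : u \in T -> ((sigT u).+1)%:R <= #|T|%:R * (q u + (K + 1) * tau).
  move=> uT; have /andP[h0 h1] := q01 u.
  have := rank_le q T tau (K * tau) sigT u spT (ltW t0) h0 Kt0 ordT ouT uT.
  by rewrite (_ : q u + K * tau + tau = q u + (K + 1) * tau) //; ring.
have low u : u \in T -> #|T|%:R * (q u - (K + 1) * tau) <= (sigT u)%:R.
  move=> uT; have /andP[h0 h1] := q01 u.
  have := rank_ge q T tau (K * tau) sigT u spT (ltW t0) h1 Kt0 ordT ouT uT.
  by rewrite (_ : q u - K * tau - tau = q u - (K + 1) * tau) //; ring.
have [w Ew] : exists w, w = (K + 1) * tau by exists ((K + 1) * tau).
rewrite -Ew in up low w0.
have sS u : (sigT u)%:R <= ((sigT u).+1)%:R :> R by rewrite ler_nat.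
have RT : Rs \subset T by apply/fintype.subsetP => u; rewrite inE => /andP[].
have LT : Ls \subset T by apply/fintype.subsetP => u; rewrite inE => /andP[].
have R1 : {in Rs, forall u, 95 / 100 - w <= q u}.
  move=> u; rewrite inE => /andP[uT h]; have := le_trans h (up u uT).
  by rewrite mulrC ler_pM2l //; clear; lra.
have R2 : {in T, forall u, 95 / 100 + w <= q u -> u \in Rs}.
  move=> u uT h; rewrite inE uT /= mulrC; apply: le_trans (sS u).
  by apply: le_trans (low u uT); rewrite ler_pM2l //; clear -h; lra.
have L1 : {in Ls, forall u, 95 / 100 - w <= 1 - q u}.
  move=> u; rewrite inE mulrC => /andP[uT h].
  have : #|T|%:R * (q u - w) <= #|T|%:R * (5 / 100).
    exact: le_trans (low u uT) (le_trans (sS u) h).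
  by rewrite ler_pM2l //; clear; lra.
have L2 : {in T, forall u, 95 / 100 + w <= 1 - q u -> u \in Ls}.
  move=> u uT h; rewrite inE uT /= mulrC; apply: le_trans (up u uT) _.
  by rewrite ler_pM2l //; clear -h; lra.
have q01' u : 0 <= 1 - q u <= 1 by have := q01 u; clear; lra.
have qv' u v : `|1 - q u - (1 - q v)| = `|vpos R u - vpos R v|.
  by rewrite -qv distrC; congr `|_|; ring.
have stR := psi_step rho Lam kappa e T S Rs q tau w P kp slope q01 qv dTS T0 NT spT t01 w0 RT R1 R2 dev1.
have stL := psi_step rho Lam kappa e T S Ls _ tau w P kp slope q01' qv' dTS T0 NT (spread_rev q T tau spT) t01 w0 LT L1 L2 dev2.
have [k' Ek] : exists k', k' = 2 / 100 * kappa by exists (2 / 100 * kappa).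
have [eta Ee] : exists eta, eta = 2 * (6 * tau + 3 * w) by exists (2 * (6 * tau + 3 * w)).
rewrite -Ek -Ee in stR stL.
have k'0 : 0 < k' by rewrite Ek mulr_gt0.
have Ee' : eta = (18 + 6 * K) * tau by rewrite Ee Ew; ring.
have e0 : 0 < eta by rewrite Ee' mulr_gt0 // addr_gt0 // mulr_gt0.
have he : eta <= k' / 100 by rewrite Ee' Ek; clear -kt kp t0 K0; nra.
(* [D] is twice the least gap that beats [eta]. With the factor 2 from summing votes and
   [k' = kappa / 50] this produces the 200 of the conclusion. *)
have [D ED] : exists D, D = 2 * eta / k' by exists (2 * eta / k').
have D0 : 0 < D by rewrite ED divr_gt0 // mulr_gt0.
have hD : eta < k' * D by rewrite ED mulrC divfK ?gt_eqF //; clear -e0; lra.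
have psi0 X u : 0 <= psi R e T X u by rewrite /psi divr_ge0.
have F1 := Fhat_eq1 q pR pL cR cL S tau k' eta D k'0 he hD D0 S0 stR stL (psi0 _) (psi0 _) spS t01 erefl erefl.
have := Fhat_sum_order q (Fhat pR pL cR cL) S D sigma D0 (Fhat_antisym pR pL cR cL) (Fhat_le1 pR pL cR cL) F1 ord.
rewrite (_ : 2 * D = 200 * (18 + 6 * K) / kappa * tau) //.
rewrite ED Ee' Ek; field; by rewrite !gt_eqF.
Qed.

Lemma subroutine_order {R : realType} (rho : R -> R) (Lam : R) : decay_profile rho Lam ->
  exists (K tau0 eps : R) (n0 : nat) (F : nat -> nat -> R),
  [/\ 0 < K, 0 < tau0 & 0 < eps] /\ (forall n i, `|F n i| <= 1) /\
  forall (N : nat) (e : graph N) (T : {set 'I_N}) (tau : R),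
    (n0 <= #|T|)%N -> (N <= 4 * #|T|)%N -> 1 <= #|T|%:R * tau -> tau <= tau0 ->
    well_spread T tau -> graph_regular rho F e T tau eps ->
  (forall sig, spec_ser R e T sig ->
    orders_up_to (@vpos R N) T (K * tau) sig \/
    orders_up_to (fun u => 1 - @vpos R N u) T (K * tau) sig) /\
  (forall (S : {set 'I_N}) (sig : 'I_N -> nat), (0 < #|S|)%N -> [disjoint T & S] ->
     spread (@vpos R N) T tau -> spread (@vpos R N) S tau -> ends_regular rho e T (@vpos R N) tau ->
     subroutine e T S (5 / 100 : R) (31 / 100) sig ->
     orders_up_to (@vpos R N) S (K * tau) sig \/
     orders_up_to (fun u => 1 - @vpos R N u) S (K * tau) sig).
Proof.
move=> P; have [K [tau0 [eps [n0 [F [[K0 t0 e0] [F1 H]]]]]]] := spectral_seriation_order rho Lam P.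
have [_ _ _ slope] := P.
have h2 : 0 < 2 / 100 :> R by rewrite divr_gt0.
have [kappa kp Hk] := slope (2 / 100) h2.
have [K' [K'0 EK']] : exists K', 0 < K' /\ K' = 200 * (18 + 6 * K) / kappa.
  exists (200 * (18 + 6 * K) / kappa); split; last by [].
  by apply: divr_gt0; lra.
have K10 : 0 < K + 1 by rewrite addr_gt0.
have K36 : 0 < 36 + 12 * K by rewrite addr_gt0 // mulr_gt0.
have [tau1 [p0 p1 p2 p3 p4]] : exists tau1, [/\ 0 < tau1, tau1 <= tau0, tau1 <= 5 / 1000,
    (K + 1) * tau1 <= 1 / 100 & (36 + 12 * K) * tau1 <= kappa / 5000].
  have a1 : 0 < 5 / 1000 :> R by lra.
  have a2 : 0 < 1 / 100 / (K + 1) by apply: divr_gt0; clear -K10; lra.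
  have a3 : 0 < kappa / 5000 / (36 + 12 * K) by apply: divr_gt0; clear -K36 kp; lra.
  exists (Num.min (Num.min tau0 (5 / 1000)) (Num.min (1 / 100 / (K + 1)) (kappa / 5000 / (36 + 12 * K)))).
  split; rewrite ?lt_min ?ge_min ?lexx ?orbT //.
  - by rewrite t0 a1 a2 a3.
  - by rewrite mulrC -ler_pdivlMr // ge_min; apply/orP; right; rewrite ge_min lexx.
  - by rewrite mulrC -ler_pdivlMr // ge_min; apply/orP; right; rewrite ge_min lexx orbT.
exists (K + K'), tau1, eps, (n0 + 1)%N, F; split; first by split => //; rewrite addr_gt0.
split => // N e T tau hn hN nt tt ws gr.
have T0 : (0 < #|T|)%N by clear -hn; lia.
have hn0 : (n0 <= #|T|)%N by clear -hn; lia.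
have nR : 0 < #|T|%:R :> R by rewrite ltr0n.
have tp : 0 < tau by rewrite -(pmulr_rgt0 _ nR); apply: lt_le_trans nt.
have spec sig := H N e T tau sig hn0 hN nt (le_trans tt p1) ws gr.
have weaken (q : 'I_N -> R) (S : {set 'I_N}) (a b : R) sig : a <= b -> orders_up_to q S a sig -> orders_up_to q S b sig.
  by move=> ab o u v uS vS huv; apply: o => //; apply: le_trans huv; rewrite lerD2l.
have Ka : K * tau <= (K + K') * tau by rewrite ler_pM2r // lerDl ltW.
have Kb : K' * tau <= (K + K') * tau by rewrite ler_pM2r // lerDr ltW.
split.
  by move=> sig /spec [hs|hs]; [left; exact: weaken Ka hs|right; exact: weaken Ka hs].
move=> S sig S0 dTS spT spS er [sigT [ssT /= ord]].
have ordT : is_ordering T sigT by case: ssT => lam [phi []].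
have t5 := le_trans tt p2.
have t3 : (K + 1) * tau <= 1 / 100 by apply: le_trans p3; rewrite ler_pM2l.
have t4 : (36 + 12 * K) * tau <= kappa / 5000 by apply: le_trans p4; rewrite ler_pM2l.
have [hs|hs] := spec sigT ssT; [left|right]; apply: weaken Kb _; rewrite EK'.
  apply: (subroutine_order_oriented rho Lam kappa e T S _ tau K sigT sig) => //.
  by move=> u; have /andP[/ltW -> ->] := @vpos_gt0_le1 R N u.
apply: (subroutine_order_oriented rho Lam kappa e T S _ tau K sigT sig) => //.
- by move=> u; have := @vpos_gt0_le1 R N u; clear; lra.
- by move=> u v; rewrite -[RHS]normrN; congr `|_|; ring.
- exact: spread_rev.
- exact: spread_rev.
- exact: ends_regular_rev.
Qed.

(** * Equidistribution of vertex sets *)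

Definition count_regular {R : realType} {N : nat} (T : {set 'I_N}) (delta : R) : Prop :=
  forall m, (m <= N)%N ->
    `|(#|[set u in T | (u < m)%N]|)%:R - #|T|%:R * (m%:R / N%:R)| <= #|T|%:R * delta.

Lemma card_lt_nth_enum {N : nat} (T : {set 'I_N}) (x0 : 'I_N) i : (i < #|T|)%N ->
  #|[set u in T | (u < nth x0 (enum T) i)%N]| = i.
Proof.
move=> lin.
have srt : sorted ltn (map val (enum T)).
  apply: (subseq_sorted ltn_trans (s2 := map val (enum 'I_N))).
    by apply: map_subseq; rewrite (enumT 'I_N); exact: filter_subseq.
  by rewrite val_enum_ord iota_ltn_sorted.
have lis : (i < size (map val (enum T)))%N by rewrite size_map -cardE.
have := count_lt_nth 0%N srt lis.
rewrite count_map (nth_map x0) -?cardE // => E.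
rewrite -[RHS]E -sum1_card (eq_bigl (fun u => (u \in T) && (u < nth x0 (enum T) i)%N)); last first.
  by move=> u; rewrite inE.
by rewrite -big_enum_cond sum1_count.
Qed.

(** Counts on initial segments suffice, since the element of rank [i] has exactly [i] elements of
    [T] before it. Ranks counted from 1 shift positions by a grid step, which [1 <= #|T| * delta]
    pays for. *)
Lemma count_regular_well_spread {R : realType} {N : nat} (T : {set 'I_N}) (delta : R) :
  1 <= #|T|%:R * delta -> count_regular T delta -> well_spread T (2 * delta).
Proof.
move=> d1 cr x0 i lin.
have T0 : (0 < #|T|)%N by apply: leq_ltn_trans lin.
have nR : 0 < #|T|%:R :> R by rewrite ltr0n.
have nN : (#|T| <= N)%N by rewrite -[X in (_ <= X)%N]card_ord; exact: max_card.
have NR : 0 < N%:R :> R by rewrite ltr0n (leq_trans T0).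
set u := nth x0 _ i.
have := cr u (ltnW (ltn_ord u)); rewrite card_lt_nth_enum // /vpos.
have -> : i%:R - #|T|%:R * (u%:R / N%:R) = #|T|%:R * (i%:R / #|T|%:R - u%:R / N%:R) :> R.
  by field; rewrite !gt_eqF.
rewrite normrM (ger0_norm (ltW nR)) ler_pM2l // => h.
have h1 : 1 / #|T|%:R <= delta by rewrite ler_pdivrMr // mulrC.
have h2 : 1 / N%:R <= 1 / #|T|%:R :> R by rewrite !div1r lef_pV2 ?posrE // ler_nat.
have h3 : 0 <= 1 / N%:R :> R by rewrite divr_ge0.
rewrite -[u.+1%:R]natr1 -[i.+1%:R]natr1 !mulrDl.
move: h; rewrite !ler_norml => /andP[a b]; apply/andP; split; lra.
Qed.

Lemma count_regular_spread {R : realType} {N : nat} (T : {set 'I_N}) (delta : R) :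
  (0 < #|T|)%N -> 1 <= #|T|%:R * delta -> count_regular T delta -> spread (@vpos R N) T (2 * delta).
Proof.
move=> T0 d1 cr x /andP[x0 x1].
have nR : 0 < #|T|%:R :> R by rewrite ltr0n.
have nN : (#|T| <= N)%N by rewrite -[X in (_ <= X)%N]card_ord; exact: max_card.
have NR : 0 < N%:R :> R by rewrite ltr0n (leq_trans T0).
have d0 : 0 < delta by rewrite -(pmulr_rgt0 _ nR); apply: lt_le_trans d1.
have xN : 0 <= x * N%:R by rewrite mulr_ge0.
have [m [m1 m2]] : exists m : nat, m%:R <= x * N%:R /\ x * N%:R < m.+1%:R.
  by exists (Num.truncn (x * N%:R)); have /andP[] := truncn_itv xN.
have mN : (m <= N)%N.
  by rewrite -(ler_nat R); apply: le_trans m1 _; rewrite ler_piMl.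
have := cr m mN; rewrite ler_norml => /andP[a b].
have mx : m%:R / N%:R <= x by rewrite ler_pdivrMr.
have mx' : x - 1 / N%:R <= m%:R / N%:R.
  by rewrite -[m.+1%:R]natr1 in m2; rewrite ler_pdivlMr // mulrBl divfK ?gt_eqF //; lra.
have h1 : #|T|%:R * (m%:R / N%:R) <= #|T|%:R * x by rewrite ler_pM2l.
have h2 : #|T|%:R * (x - 1 / N%:R) <= #|T|%:R * (m%:R / N%:R) by rewrite ler_pM2l.
have h3 : #|T|%:R * (1 / N%:R) <= 1 :> R by rewrite mulrA mulr1 ler_pdivrMr // mul1r ler_nat.
split.
  apply: le_trans (_ : (#|[set u in T | (u < m)%N]|)%:R <= _).
    rewrite ler_nat; apply: subset_leq_card; apply/fintype.subsetP => u; rewrite !inE => /andP[-> /=].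
    rewrite /vpos ltr_pdivrMr // => hu; rewrite -ltnS -(ltr_nat R).
    exact: lt_trans m2.
  have h4 : 0 < #|T|%:R * delta by rewrite mulr_gt0.
  by clear -a b h1 h4; lra.
apply: le_trans (_ : _ <= (#|[set u in T | (u < m)%N]|)%:R) _; last first.
  rewrite ler_nat; apply: subset_leq_card; apply/fintype.subsetP => u; rewrite !inE => /andP[-> /=].
  by move=> hu; rewrite /vpos ler_pdivrMr //; apply: le_trans m1; rewrite ler_nat.
by clear -a b h2 h3 d1; lra.
Qed.

(** * Concentration *)

(** Follows from [1 - x <= expR (- x)] and [(1 - x) * (1 + x + 2 * x ^ 2) = 1 + x ^ 2 * (1 - 2 *
    x)]. *)
Lemma expR_le_quad {R : realType} (x : R) : x <= 1 / 2 -> expR x <= 1 + x + 2 * x ^+ 2.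
Proof.
move=> x2.
have h1 : 0 < 1 - x by lra.
have h2 : 1 - x <= expR (- x) by have := expR_ge1Dx (- x); lra.
have h3 : expR x <= (1 - x)^-1.
  by rewrite -[expR x]invrK -expRN lef_pV2 ?posrE ?expR_gt0.
apply: le_trans h3 _; rewrite -div1r ler_pdivrMr //.
have := sqr_ge0 x; nra.
Qed.

Lemma bernoulli_mgf {R : realType} (w a : R) : 0 <= w <= 1 -> `|a| <= 1 / 2 ->
  w * expR (a * (1 - w)) + (1 - w) * expR (a * (0 - w)) <= expR (2 * a ^+ 2).
Proof.
move=> /andP[w0 w1]; rewrite ler_norml => /andP[a1 a2].
have e1 : a * (1 - w) <= 1 / 2 by nra.
have e2 : a * (0 - w) <= 1 / 2 by nra.
have h1 := expR_le_quad _ e1; have h2 := expR_le_quad _ e2.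
have h3 := expR_ge1Dx (2 * a ^+ 2).
have q0 := sqr_ge0 a.
have w2 : 0 <= 1 - w by lra.
have g1 := ler_wpM2l w0 h1; have g2 := ler_wpM2l w2 h2.
apply: le_trans h3; apply: le_trans (lerD g1 g2) _.
have p1 : 0 <= w * (1 - w) by rewrite mulr_ge0.
have p2 : w * (1 - w) <= 1 by nra.
have : a ^+ 2 * (w * (1 - w)) <= a ^+ 2 * 1 by rewrite ler_wpM2l.
clear; lra.
Qed.

(** Pairs not in increasing order are forced absent with weight 1, so that a sum over graphs factors
    over all ordered pairs. *)
Definition edge_weight {R : realType} {N : nat} (w : R -> R -> R) (p : 'I_N * 'I_N) (b : bool) : R :=
  if (p.1 < p.2)%N then (if b then w (vpos R p.1) (vpos R p.2) else 1 - w (vpos R p.1) (vpos R p.2))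
  else (if b then 0 else 1).

Lemma sum_prod_edges {R : realType} {N : nat} (F : 'I_N * 'I_N -> bool -> R) :
  \sum_(e : graph N) \prod_p F p (e p) = \prod_p (F p true + F p false).
Proof.
rewrite -bigA_distr_bigA; apply: eq_bigr => p _.
by rewrite big_bool.
Qed.

Lemma edge_probE {R : realType} {N : nat} (w : R -> R -> R) (e : graph N) :
  edge_prob w e = \prod_p edge_weight w p (e p).
Proof. by apply: eq_bigr => p _. Qed.

Lemma edge_prob_ge0 {R : realType} {N : nat} (rho : R -> R) (Lam : R) (e : graph N) :
  decay_profile rho Lam -> 0 <= edge_prob (wfun rho) e.
Proof.
move=> P; apply: prodr_ge0 => p _.
case: ifP => pp; last by case: (e p).
have := mean_adj_ge0_le1 rho Lam p.1 p.2 P; rewrite /mean_adj.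
have -> : (p.1 == p.2) = false by apply/negbTE/negP => /eqP E; rewrite E ltnn in pp.
by move=> /andP[h1 h2]; case: (e p); rewrite ?subr_ge0.
Qed.

Lemma sum_edge_prob {R : realType} {N : nat} (w : R -> R -> R) :
  \sum_(e : graph N) edge_prob w e = 1.
Proof.
under eq_bigr do rewrite edge_probE.
rewrite (sum_prod_edges (edge_weight w)) big1 // => p _; rewrite /edge_weight.
by case: ifP => _; rewrite ?add0r // addrC subrK.
Qed.

(** Folding the double sum onto increasing pairs exposes independent summands; the diagonal drops
    out because adjacency and mean both vanish there. *)
Lemma bilinear_adj_dev {R : realType} (rho : R -> R) {N : nat} (e : graph N) (b : 'I_N -> 'I_N -> R) :
  \sum_u \sum_v b u v * adj_dev rho e u v =
  \sum_(p : 'I_N * 'I_N | (p.1 < p.2)%N)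
    (b p.1 p.2 + b p.2 p.1) * ((e p)%:R - wfun rho (vpos R p.1) (vpos R p.2)).
Proof.
rewrite pair_bigA /=.
have dev_lt (p : 'I_N * 'I_N) : (p.1 < p.2)%N ->
    adj_dev rho e p.1 p.2 = (e p)%:R - wfun rho (vpos R p.1) (vpos R p.2).
  move=> h; rewrite /adj_dev /adj h /mean_adj -surjective_pairing.
  by have -> : (p.1 == p.2) = false by apply/negbTE/negP => /eqP E; rewrite E ltnn in h.
rewrite (bigID (fun p : 'I_N * 'I_N => (p.1 < p.2)%N)) /=.
rewrite [X in _ + X](bigID (fun p : 'I_N * 'I_N => (p.2 < p.1)%N)) /=.
rewrite [X in _ + (_ + X)]big1 ?addr0; last first.
  move=> p; rewrite -!leqNgt => /andP[h1 h2].
  have E : p.1 = p.2 by apply: val_inj; apply/eqP; rewrite eqn_leq h1 h2.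
  by rewrite E /adj_dev /adj ltnn /mean_adj eqxx subrr mulr0.
have -> : \sum_(p : 'I_N * 'I_N | ~~ (p.1 < p.2)%N && (p.2 < p.1)%N) b p.1 p.2 * adj_dev rho e p.1 p.2 =
   \sum_(p : 'I_N * 'I_N | (p.1 < p.2)%N) b p.2 p.1 * adj_dev rho e p.1 p.2.
  rewrite (reindex_inj (h := fun p : 'I_N * 'I_N => (p.2, p.1))) /=; last first.
    by move=> [a c] [a' c'] /= [-> ->].
  apply: eq_big => [p|p _]; last by rewrite adj_devC.
  by rewrite -leqNgt; case: (ltnP p.1 p.2) => h; rewrite ?andbF // ltnW.
rewrite -big_split; apply: eq_bigr => p h /=.
by rewrite dev_lt // mulrDl.
Qed.

Lemma bilinear_mgf {R : realType} (rho : R -> R) (Lam : R) {N : nat} (a : 'I_N * 'I_N -> R) :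
  decay_profile rho Lam -> (forall p, `|a p| <= 1 / 2) ->
  \sum_(e : graph N) edge_prob (wfun rho) e *
    expR (\sum_(p : 'I_N * 'I_N | (p.1 < p.2)%N) a p * ((e p)%:R - wfun rho (vpos R p.1) (vpos R p.2)))
  <= expR (2 * \sum_(p : 'I_N * 'I_N | (p.1 < p.2)%N) a p ^+ 2).
Proof.
move=> P ha.
pose F (p : 'I_N * 'I_N) (b : bool) : R := edge_weight (wfun rho) p b *
  (if (p.1 < p.2)%N then expR (a p * (b%:R - wfun rho (vpos R p.1) (vpos R p.2))) else 1).
have -> : \sum_(e : graph N) edge_prob (wfun rho) e *
    expR (\sum_(p : 'I_N * 'I_N | (p.1 < p.2)%N) a p * ((e p)%:R - wfun rho (vpos R p.1) (vpos R p.2)))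
  = \sum_(e : graph N) \prod_p F p (e p).
  apply: eq_bigr => e _; rewrite edge_probE expR_sum [X in _ * X]big_mkcond -big_split.
  by apply: eq_bigr => p _.
rewrite sum_prod_edges mulr_sumr expR_sum [leRHS]big_mkcond.
apply: ler_prod => p _; rewrite /F /edge_weight; case: ifP => pp; last first.
  by rewrite mul0r add0r mulr1 lexx ler01.
have w01 : 0 <= wfun rho (vpos R p.1) (vpos R p.2) <= 1.
  have := mean_adj_ge0_le1 rho Lam p.1 p.2 P; rewrite /mean_adj.
  by have -> : (p.1 == p.2) = false by apply/negbTE/negP => /eqP E; rewrite E ltnn in pp.
rewrite bernoulli_mgf // andbT; case/andP: w01 => w0 w1.
by rewrite addr_ge0 // mulr_ge0 ?expR_ge0 // subr_ge0.
Qed.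

Lemma bilinear_tail {R : realType} (rho : R -> R) (Lam : R) {N : nat} (b : 'I_N -> 'I_N -> R) (V t : R) :
  decay_profile rho Lam -> (forall u v, `|b u v| <= 1) -> \sum_u \sum_v b u v ^+ 2 <= V ->
  0 < V -> 0 <= t -> t <= 2 * V ->
  \sum_(e : graph N | t <= \sum_u \sum_v b u v * adj_dev rho e u v) edge_prob (wfun rho) e
    <= expR (- (t ^+ 2 / (16 * V))).
Proof.
move=> P b1 bV V0 t0 tV.
(* Folding can double a coefficient, so the exponent is at most [- (s * t) + 4 * s ^ 2 * V], which
   is least at this [s]; [t <= 2 * V] keeps the coefficients below 1/2 in absolute value, or equal
   to it. *)
have [s Es] : exists s, s = t / (8 * V) by exists (t / (8 * V)).
have s0 : 0 <= s by rewrite Es divr_ge0 // mulr_ge0 // ltW.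
have s4 : s <= 1 / 4 by rewrite Es ler_pdivrMr ?mulr_gt0 //; lra.
pose a (p : 'I_N * 'I_N) := s * (b p.1 p.2 + b p.2 p.1).
have ha p : `|a p| <= 1 / 2.
  rewrite /a normrM (ger0_norm s0).
  have : `|b p.1 p.2 + b p.2 p.1| <= 2.
    by apply: le_trans (ler_normD _ _) _; have := b1 p.1 p.2; have := b1 p.2 p.1; lra.
  have := normr_ge0 (b p.1 p.2 + b p.2 p.1); move: `|_| => z; nra.
have mgf := bilinear_mgf rho Lam a P ha.
have sa : \sum_(p : 'I_N * 'I_N | (p.1 < p.2)%N) a p ^+ 2 <= 2 * s ^+ 2 * V.
  have h1 : \sum_(p : 'I_N * 'I_N | (p.1 < p.2)%N) a p ^+ 2 <=
     \sum_(p : 'I_N * 'I_N | (p.1 < p.2)%N) 2 * s ^+ 2 * (b p.1 p.2 ^+ 2 + b p.2 p.1 ^+ 2).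
    apply: ler_sum => p _; rewrite /a.
    have : 0 <= s ^+ 2 * (b p.1 p.2 - b p.2 p.1) ^+ 2 by rewrite mulr_ge0 ?sqr_ge0.
    lra.
  apply: le_trans h1 _; rewrite -mulr_sumr; apply: ler_wpM2l; first by rewrite mulr_ge0 ?sqr_ge0.
  apply: le_trans bV; rewrite pair_bigA /= big_split /=.
  rewrite [leRHS](bigID (fun p : 'I_N * 'I_N => (p.1 < p.2)%N)) /= lerD2l.
  rewrite [leLHS](reindex_inj (h := fun p : 'I_N * 'I_N => (p.2, p.1))) /=; last first.
    by move=> [x y] [x' y'] /= [-> ->].
  rewrite [leRHS](bigID (fun p : 'I_N * 'I_N => (p.2 < p.1)%N)) /=.
  rewrite (eq_bigl (fun p : 'I_N * 'I_N => ~~ (p.1 < p.2)%N && (p.2 < p.1)%N)); last first.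
    by move=> p; rewrite -leqNgt; case: (ltnP p.2 p.1) => h; rewrite ?andbF // ltnW.
  by rewrite lerDl sumr_ge0 // => p _; rewrite sqr_ge0.
have step : \sum_(e : graph N | t <= \sum_u \sum_v b u v * adj_dev rho e u v) edge_prob (wfun rho) e <=
   expR (- (s * t)) * expR (2 * \sum_(p : 'I_N * 'I_N | (p.1 < p.2)%N) a p ^+ 2).
  apply: le_trans (ler_wpM2l (expR_ge0 _) mgf).
  rewrite mulr_sumr big_mkcond; apply: ler_sum => e _.
  have p0 := edge_prob_ge0 rho Lam e P.
  case: ifP => he; last by rewrite mulr_ge0 ?expR_ge0 // mulr_ge0 ?expR_ge0.
  rewrite mulrCA -expRD -[leLHS]mulr1; apply: ler_wpM2l => //.
  rewrite -[leLHS]expR0 ler_expR addrC subr_ge0.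
  rewrite bilinear_adj_dev in he.
  apply: le_trans (ler_wpM2l s0 he) _; rewrite mulr_sumr; apply: ler_sum => p _.
  by rewrite /a mulrA lexx.
apply: le_trans step _; rewrite -expRD ler_expR.
apply: le_trans (_ : - (s * t) + 2 * (2 * s ^+ 2 * V) <= _); first by rewrite lerD2l ler_pM2l.
rewrite Es le_eqVlt; apply/orP; left; apply/eqP; field; by rewrite gt_eqF.
Qed.

Lemma sum_exists_le {R : realType} {I E : finType} (p : E -> R) (A : I -> pred E) :
  (forall e, 0 <= p e) ->
  \sum_(e | [exists i, A i e]) p e <= \sum_(i : I) \sum_(e | A i e) p e.
Proof.
move=> p0; rewrite big_mkcond; under [leRHS]eq_bigr do rewrite big_mkcond.
rewrite exchange_big; apply: ler_sum => e _ /=; case: ifP => [/existsP [i Ai]|_]; last first.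
  by apply: sumr_ge0 => i _; case: ifP.
by rewrite (bigD1 i) //= Ai lerDl sumr_ge0 // => j _; case: ifP.
Qed.

Lemma bilinear_union_tail {R : realType} (rho : R -> R) (Lam : R) {N : nat} {I : finType}
    (b : I -> 'I_N -> 'I_N -> R) (V t : R) :
  decay_profile rho Lam -> (forall i u v, `|b i u v| <= 1) -> (forall i, \sum_u \sum_v b i u v ^+ 2 <= V) ->
  0 < V -> 0 <= t -> t <= 2 * V ->
  \sum_(e : graph N | [exists i, t <= \sum_u \sum_v b i u v * adj_dev rho e u v]) edge_prob (wfun rho) e
    <= #|I|%:R * expR (- (t ^+ 2 / (16 * V))).
Proof.
move=> P b1 bV V0 t0 tV.
apply: le_trans (sum_exists_le _ (fun i e => t <= \sum_u \sum_v b i u v * adj_dev rho e u v) _) _.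
  by move=> e; apply: (edge_prob_ge0 rho Lam e P).
rewrite mulr_natl -sumr_const; apply: ler_sum => i _.
exact: (bilinear_tail rho Lam (b i) V t P (b1 i) (bV i)).
Qed.

Definition vertex_bad {R : realType} (rho : R -> R) {N : nat} (c : 'I_N -> R) (t : R) (e : graph N) : bool :=
  ~~ [forall v, `|\sum_u c u * adj_dev rho e u v| <= t].

Lemma vertex_bad_prob {R : realType} (rho : R -> R) (Lam : R) {N : nat} (c : 'I_N -> R) (tau : R) :
  decay_profile rho Lam -> (forall u, `|c u| <= 1) -> (0 < N)%N -> 0 <= tau <= 2 ->
  \sum_(e : graph N | vertex_bad rho c (N%:R * tau) e) edge_prob (wfun rho) e
    <= 2 * N%:R * expR (- (N%:R * tau ^+ 2 / 16)).
Proof.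
move=> P c1 N0 /andP[t0 t2].
have NR : 0 < N%:R :> R by rewrite ltr0n.
(* An index is a sign and a vertex; the coefficients live on one column, so their squares sum to at
   most N. *)
pose b (i : bool * 'I_N) (u v : 'I_N) : R := sgb i.1 * c u * (v == i.2)%:R.
have sgb2 (x : bool) : `|sgb x : R| = 1 by case: x; rewrite /sgb ?normrN normr1.
have b1 i u v : `|b i u v| <= 1.
  rewrite /b !normrM sgb2 mul1r; case: (v == i.2); rewrite ?normr1 ?mulr1 ?c1 //.
  by rewrite normr0 mulr0.
have bform i (g : 'I_N -> 'I_N -> R) : \sum_u \sum_v b i u v * g u v = sgb i.1 * \sum_u c u * g u i.2.
  rewrite mulr_sumr; apply: eq_bigr => u _; rewrite (bigD1 i.2) //= big1 ?addr0.
    by rewrite /b eqxx mulr1 mulrA.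
  by move=> v /negbTE vi; rewrite /b vi mulr0 mul0r.
have bV i : \sum_u \sum_v b i u v ^+ 2 <= N%:R.
  have -> : \sum_u \sum_v b i u v ^+ 2 = \sum_u \sum_v b i u v * b i u v.
    by apply: eq_bigr => u _; apply: eq_bigr => v _; rewrite expr2.
  rewrite (bform i (b i)) mulr_sumr -[X in _ <= X%:R]card_ord -sumr_const; apply: ler_sum => u _.
  apply: le_trans (ler_norm _) _; rewrite normrM sgb2 mul1r normrM.
  exact: mulr_ile1 (normr_ge0 _) (normr_ge0 _) (c1 u) (b1 i u i.2).
have := bilinear_union_tail rho Lam b N%:R (N%:R * tau) P b1 bV NR (mulr_ge0 (ltW NR) t0).
have -> : N%:R * tau <= 2 * N%:R by rewrite mulrC ler_pM2r.
move=> /(_ isT); rewrite card_prod card_bool card_ord natrM.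
rewrite (_ : (N%:R * tau) ^+ 2 / (16 * N%:R) = N%:R * tau ^+ 2 / 16); last by field; rewrite gt_eqF.
apply: le_trans; rewrite big_mkcond [leRHS]big_mkcond; apply: ler_sum => e _.
have p0 := edge_prob_ge0 rho Lam e P.
case: ifP => [|_]; last by case: ifP.
rewrite /vertex_bad negb_forall => /existsP [v]; rewrite -ltNge => hv.
rewrite ifT //; apply/existsP; exists (0 <= \sum_u c u * adj_dev rho e u v, v).
by rewrite bform /= -norm_sgb ltW.
Qed.

(** The union over [4 ^ N] pairs of sign vectors is affordable because at level [eps * N ^ 2] the
    exponent is quadratic in N. *)
Lemma cut_bad_prob {R : realType} (rho : R -> R) (Lam : R) {N : nat} (T : {set 'I_N}) (eps : R) :
  decay_profile rho Lam -> (0 < N)%N -> 0 <= eps <= 2 ->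
  \sum_(e : graph N | [exists st : {ffun 'I_N -> bool} * {ffun 'I_N -> bool},
      eps * N%:R ^+ 2 <= \sum_(u in T) \sum_(v in T) sgb (st.1 u) * adj_dev rho e u v * sgb (st.2 v)])
      edge_prob (wfun rho) e
    <= 4 ^+ N * expR (- (eps ^+ 2 * N%:R ^+ 2 / 16)).
Proof.
move=> P N0 /andP[t0 t2].
have NR : 0 < N%:R :> R by rewrite ltr0n.
have NR2 : 0 < N%:R ^+ 2 :> R by rewrite exprn_gt0.
pose I : finType := ({ffun 'I_N -> bool} * {ffun 'I_N -> bool})%type.
pose b (i : I) (u v : 'I_N) : R :=
  if (u \in T) && (v \in T) then sgb (i.1 u) * sgb (i.2 v) else 0.
have b1 i u v : `|b i u v| <= 1.
  rewrite /b; case: ifP => _; last by rewrite normr0.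
  by rewrite normrM /sgb; do ![case: ifP => _]; rewrite ?normrN normr1 ?mulr1.
have bV i : \sum_u \sum_v b i u v ^+ 2 <= N%:R ^+ 2.
  apply: le_trans (_ : \sum_(u < N) \sum_(v < N) 1 <= _).
    apply: ler_sum => u _; apply: ler_sum => v _.
    by rewrite -real_normK ?num_real // exprn_ile1 // b1.
  by rewrite !sumr_const !card_ord expr2 -[leLHS]mulr_natr lexx.
have hE : eps * N%:R ^+ 2 <= 2 * N%:R ^+ 2 by rewrite ler_pM2r.
have := bilinear_union_tail rho Lam b (N%:R ^+ 2) (eps * N%:R ^+ 2) P b1 bV NR2 (mulr_ge0 t0 (ltW NR2)) hE.
rewrite card_prod !card_ffun card_bool card_ord -expnMn (_ : (2 * 2 = 4)%N) // natrX.
rewrite (_ : (eps * N%:R ^+ 2) ^+ 2 / (16 * N%:R ^+ 2) = eps ^+ 2 * N%:R ^+ 2 / 16); last by field; rewrite gt_eqF.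
apply: le_trans; rewrite le_eqVlt; apply/orP; left; apply/eqP; apply: eq_bigl => e.
apply: eq_existsb => st; congr (_ <= _).
rewrite big_mkcond; apply: eq_bigr => u _.
case: (boolP (u \in T)) => uT; last first.
  by rewrite big1 // => v _; rewrite /b (negbTE uT) mul0r.
rewrite big_mkcond; apply: eq_bigr => v _; rewrite /b uT /=.
by case: ifP => _; rewrite ?mul0r //; ring.
Qed.

Definition graph_ok {R : realType} (rho : R -> R) (F : nat -> nat -> R) {N : nat}
    (T : {set 'I_N}) (tau eps : R) (e : graph N) : Prop :=
  graph_regular rho F e T tau eps /\ ends_regular rho e T (@vpos R N) tau.

Lemma graph_bad_prob {R : realType} (rho : R -> R) (Lam : R) (F : nat -> nat -> R) {N : nat}
    (T : {set 'I_N}) (tau eps : R) :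
  decay_profile rho Lam -> (forall n i, `|F n i| <= 1) -> (0 < N)%N -> 0 <= tau <= 2 -> 0 <= eps <= 2 ->
  \sum_(e : graph N | ~~ `[< graph_ok rho F T tau eps e >]) edge_prob (wfun rho) e
    <= 8 * N%:R * expR (- (N%:R * tau ^+ 2 / 16)) + 4 ^+ N * expR (- (eps ^+ 2 * N%:R ^+ 2 / 16)).
Proof.
move=> P F1 N0 ht he.
(* Weights for the degrees, the reference vector and the two ends, each fixed in advance and
   extended by 0 outside its set. *)
pose c1 (u : 'I_N) : R := if u \in T then 1 else 0.
pose c2 (u : 'I_N) : R := if u \in T then F #|T| (index u (enum T)) else 0.
pose c3 (u : 'I_N) : R := if u \in [set u in T | 95 / 100 <= vpos R u] then 1 else 0.
pose c4 (u : 'I_N) : R := if u \in [set u in T | 95 / 100 <= 1 - vpos R u] then 1 else 0.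
have h1 := vertex_bad_prob rho Lam c1 tau P _ N0 ht.
have h2 := vertex_bad_prob rho Lam c2 tau P _ N0 ht.
have h3 := vertex_bad_prob rho Lam c3 tau P _ N0 ht.
have h4 := vertex_bad_prob rho Lam c4 tau P _ N0 ht.
have h5 := cut_bad_prob rho Lam T eps P N0 he.
have d1 (u : 'I_N) : `|c1 u| <= 1 by rewrite /c1; case: ifP; rewrite ?normr1 ?normr0.
have d2 (u : 'I_N) : `|c2 u| <= 1 by rewrite /c2; case: ifP; rewrite ?normr0.
have d3 (u : 'I_N) : `|c3 u| <= 1 by rewrite /c3; case: ifP; rewrite ?normr1 ?normr0.
have d4 (u : 'I_N) : `|c4 u| <= 1 by rewrite /c4; case: ifP; rewrite ?normr1 ?normr0.
apply: le_trans (_ : _ <= \sum_(e : graph N | vertex_bad rho c1 (N%:R * tau) e) edge_prob (wfun rho) e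
  + \sum_(e : graph N | vertex_bad rho c2 (N%:R * tau) e) edge_prob (wfun rho) e
  + \sum_(e : graph N | vertex_bad rho c3 (N%:R * tau) e) edge_prob (wfun rho) e
  + \sum_(e : graph N | vertex_bad rho c4 (N%:R * tau) e) edge_prob (wfun rho) e
  + \sum_(e : graph N | [exists st : {ffun 'I_N -> bool} * {ffun 'I_N -> bool},
      eps * N%:R ^+ 2 <= \sum_(u in T) \sum_(v in T) sgb (st.1 u) * adj_dev rho e u v * sgb (st.2 v)])
      edge_prob (wfun rho) e) _; last first.
  by have := h1 d1; have := h2 d2; have := h3 d3; have := h4 d4; lra.
rewrite big_mkcond [X in _ <= X + _ + _ + _ + _]big_mkcond [X in _ <= _ + X + _ + _ + _]big_mkcond.
rewrite [X in _ <= _ + _ + X + _ + _]big_mkcond [X in _ <= _ + _ + _ + X + _]big_mkcond.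
rewrite [X in _ <= _ + _ + _ + _ + X]big_mkcond -!big_split; apply: ler_sum => e _ /=.
have p0 := edge_prob_ge0 rho Lam e P.
case: ifP => [|_]; last by rewrite !addr_ge0 //; case: ifP.
move/negP => bad.
have p0' (x : bool) : 0 <= (if x then edge_prob (wfun rho) e else 0) by case: x.
case: (boolP (vertex_bad rho c1 _ e)) => [_|g1]; first by rewrite -!addrA lerDl !addr_ge0.
case: (boolP (vertex_bad rho c2 _ e)) => [_|g2]; first by rewrite add0r -!addrA lerDl !addr_ge0.
case: (boolP (vertex_bad rho c3 _ e)) => [_|g3]; first by rewrite !add0r -!addrA lerDl !addr_ge0.
case: (boolP (vertex_bad rho c4 _ e)) => [_|g4]; first by rewrite !add0r lerDl.
rewrite !add0r; case: ifP => [//|/negbT/negP g5]; exfalso; apply: bad; apply/asboolP.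
move: g1 g2 g3 g4; rewrite /vertex_bad !negbK => /forallP g1 /forallP g2 /forallP g3 /forallP g4.
have conv (A : {set 'I_N}) (f : 'I_N -> R) v :
    \sum_(u in A) f u * adj_dev rho e u v = \sum_u (if u \in A then f u else 0) * adj_dev rho e u v.
  by rewrite big_mkcond; apply: eq_bigr => u _; case: ifP; rewrite ?mul0r.
have conv1 (A : {set 'I_N}) v :
    \sum_(u in A) adj_dev rho e u v = \sum_u (if u \in A then 1 else 0) * adj_dev rho e u v.
  by rewrite big_mkcond; apply: eq_bigr => u _; case: ifP; rewrite ?mul0r ?mul1r.
split; split.
- by move=> v; rewrite conv1; exact: g1.
- by move=> v; rewrite conv; exact: g2.
- move=> s t; rewrite leNgt; apply/negP => hst; apply: g5; apply/existsP; exists (s, t) => /=; exact: ltW.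
- by move=> v; rewrite conv1; exact: g3.
- by move=> v; rewrite conv1; exact: g4.
Qed.

(** * Uniform sampling of good partitions *)

Definition part_act {N : nat} (s : {perm 'I_N}) (P : part3 N) : part3 N :=
  (s @: P.1.1, s @: P.1.2, s @: P.2).

(** Relabelling vertices permutes the good partitions, so their uniform law is exchangeable; besides
    the part sizes, this is all that the tail bounds use. *)
Definition equivariant {N : nat} (f : part3 N -> {set 'I_N}) : Prop :=
  forall (s : {perm 'I_N}) P, f (part_act s P) = s @: f P.

Lemma part_act_good {N : nat} (s : {perm 'I_N}) (P : part3 N) : good P -> good (part_act s P).
Proof.
have inj := @perm_inj _ s.
have disj (A B : {set 'I_N}) : [disjoint A & B] -> [disjoint s @: A & s @: B].
  by rewrite -!setI_eq0 -imsetI => [/eqP ->|x y _ _ /inj //]; rewrite imset0.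
case: P => [[S1 S2] S3]; rewrite /good /part_act /= => /andP[/eqP c /andP[d12 /andP[d13 /andP[d23 /and4P[h1 h2 h3 h4]]]]].
rewrite !disj // !card_imset // h1 h2 h3 h4 -!imsetU c !andbT.
by rewrite eqEcard finset.subsetT card_imset // leqnn.
Qed.

Lemma part_act_inj {N : nat} (s : {perm 'I_N}) : injective (part_act s).
Proof.
have inj := imset_inj (@perm_inj _ s).
by move=> [[A B] C] [[A' B'] C'] [] /inj -> /inj -> /inj ->.
Qed.

(* Permuting vertices makes all [x \notin B] equally likely to lie in [f P], so adding one
   element to [B] costs a factor at most [s / N]. *)
Lemma good_superset_step {N : nat} (f : part3 N -> {set 'I_N}) (s : nat) (B : {set 'I_N}) x :
  equivariant f -> (s <= N)%N -> (forall P, good P -> (#|f P| <= s)%N) -> x \notin B ->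
  (N * #|[set P | good P && (x |: B \subset f P)]| <= s * #|[set P | good P && (B \subset f P)]|)%N.
Proof.
move=> eqv sN fs xB.
pose cnt (A : {set 'I_N}) := #|[set P | good P && (A \subset f P)]|.
have cnt_le y z : y \notin B -> z \notin B -> (cnt (y |: B) <= cnt (z |: B))%N.
  move=> yB zB; rewrite /cnt -(card_imset _ (part_act_inj (tperm y z))).
  apply: subset_leq_card; apply/fintype.subsetP => Q /imsetP [P]; rewrite !inE => /andP[gP sub] ->.
  rewrite part_act_good //= eqv; apply: fintype.subset_trans (imsetS (tperm y z) sub).
  apply/fintype.subsetP => u; rewrite !inE => /orP[/eqP ->|uB].
    by apply/imsetP; exists y; rewrite ?inE ?eqxx // tpermL.
  apply/imsetP; exists u; first by rewrite !inE uB orbT.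
  by rewrite tpermD //; [apply: contraNneq yB|apply: contraNneq zB] => ->.
have cntE y : y \notin B -> cnt (y |: B) = cnt (x |: B).
  by move=> yB; apply/eqP; rewrite eqn_leq !cnt_le.
(* Double counting of the pairs formed by a good [P] with [B] inside [f P] and an element of [f P]
   outside [B]. *)
have sum1 : (\sum_(y in ~: B) cnt (y |: B) <= (s - #|B|) * cnt B)%N.
  have -> : \sum_(y in ~: B) cnt (y |: B) =
     \sum_(P in [set P | good P && (B \subset f P)]) #|f P :\: B|.
    under eq_bigr do rewrite /cnt -sum1_card big_mkcond.
    rewrite exchange_big [RHS]big_mkcond; apply: eq_bigr => P _ /=.
    rewrite inE; case: ifP => [/andP[gP BP]|nP].
      rewrite -sum1_card [LHS]big_mkcond [RHS]big_mkcond; apply: eq_bigr => y _.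
      rewrite !inE gP /= finset.subUset BP andbT finset.sub1set.
      by case: (y \in B) => //=; case: (y \in f P).
    rewrite big1 // => y _; rewrite inE; case: ifP => // /andP[gP].
    by rewrite finset.subUset gP in nP * => /andP[_ BP]; rewrite BP in nP.
  rewrite mulnC -[X in (_ <= X * _)%N]/(cnt B) /cnt -sum_nat_const; apply: leq_sum => P.
  rewrite inE => /andP[gP BP]; rewrite cardsD (finset.setIidPr BP) leq_sub2r // fs //.
have cB : (#|~: B| = N - #|B|)%N by rewrite cardsCs finset.setCK card_ord.
have sum2 : (\sum_(y in ~: B) cnt (y |: B) = (N - #|B|) * cnt (x |: B))%N.
  rewrite -cB -sum_nat_const; apply: eq_bigr => y; rewrite inE => yB; exact: cntE.
rewrite sum2 in sum1.
have BN : (#|B| < N)%N.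
  by rewrite -subn_gt0 -cB; apply/card_gt0P; exists x; rewrite inE.
have BN0 : (0 < N - #|B|)%N by rewrite subn_gt0.
rewrite -/(cnt (x |: B)) -/(cnt B) -(leq_pmul2l BN0).
(* The ratio of [s - #|B|] to [N - #|B|] is at most [s / N], because [s <= N]. *)
apply: (@leq_trans (N * (s - #|B|) * cnt B)).
  by rewrite mulnCA -mulnA leq_mul2l sum1 orbT.
rewrite mulnA leq_mul2r; apply/orP; right.
by rewrite mulnBr mulnBl leq_sub2l // (mulnC #|B| s) leq_mul2r sN orbT.
Qed.

Lemma good_superset {R : realType} {N : nat} (f : part3 N -> {set 'I_N}) (s : nat) (B : {set 'I_N}) :
  equivariant f -> (0 < N)%N -> (s <= N)%N -> (forall P, good P -> (#|f P| <= s)%N) ->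
  (#|[set P | good P && (B \subset f P)]|)%:R <= (s%:R / N%:R) ^+ #|B| * (ngood N)%:R :> R.
Proof.
move=> eqv N0 sN fs.
have NR : 0 < N%:R :> R by rewrite ltr0n.
have [k hk] := ubnP #|B|; elim: k B hk => // k IH B hk.
have [->|[x xB]] := set_0Vmem B.
  rewrite cards0 expr0 mul1r ler_nat; apply: subset_leq_card; apply/fintype.subsetP => P.
  by rewrite !inE => /andP[].
have h := good_superset_step f s (B :\ x) x eqv sN fs.
rewrite !inE eqxx in h; have {}h := h isT; rewrite finset.setD1K // in h.
have cB := cardsD1 x B; rewrite xB add1n in cB.
have IH' := IH (B :\ x); rewrite cB ltnS in hk.
have {}IH' := IH' hk.
rewrite -(ler_nat R) !natrM in h.
rewrite cB exprS -mulrA -(ler_pM2l NR); apply: le_trans h _.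
move: (_ ^+ _ * _) IH' => z IH'.
rewrite (_ : N%:R * (s%:R / N%:R * z) = s%:R * z); last by field; rewrite gt_eqF.
by apply: ler_wpM2l.
Qed.

(* Expanding the product of [1 + theta * 1_{x \in f P}] over [M] reduces the exponential
   moment to superset probabilities. *)
Lemma good_sample_mgf {R : realType} {N : nat} (f : part3 N -> {set 'I_N}) (s : nat) (M : {set 'I_N}) (lam : R) :
  equivariant f -> (0 < N)%N -> (s <= N)%N -> (forall P, good P -> (#|f P| <= s)%N) ->
  0 <= lam <= 1 / 2 ->
  \sum_(P | good P) expR (lam * #|f P :&: M|%:R)
    <= (ngood N)%:R * expR (lam * (s%:R / N%:R * #|M|%:R) + 2 * lam ^+ 2 * N%:R).
Proof.
move=> eqv N0 sN fs /andP[l0 l2].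
have NR : 0 < N%:R :> R by rewrite ltr0n.
pose theta := expR lam - 1.
have th0 : 0 <= theta by rewrite subr_ge0 -[leLHS]expR0 ler_expR.
have thle : theta <= lam + 2 * lam ^+ 2 by have := expR_le_quad lam l2; rewrite /theta; lra.
pose p : R := s%:R / N%:R.
have p0 : 0 <= p by rewrite divr_ge0.
have p1 : p <= 1 by rewrite ler_pdivrMr // mul1r ler_nat.
have expand P : expR (lam * #|f P :&: M|%:R) =
    \sum_(J : {set 'I_N}) (J \subset M)%:R * ((J \subset f P)%:R * theta ^+ #|J|).
  transitivity (\prod_(i : 'I_N) ((if (i \in f P) && (i \in M) then theta else 0) + 1)).
    rewrite mulr_natr -sumr_const expR_sum big_mkcond; apply: eq_bigr => i _.
    by rewrite inE; case: ifP => _; rewrite ?add0r // /theta subrK.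
  rewrite bigA_distr; apply: eq_bigr => J _.
  rewrite -big_mkcond /=.
  case: (boolP (J \subset M)) => JM; last first.
    have /subsetPn [i iJ iM] := JM; rewrite mul0r (bigD1 i) //= (negbTE iM) andbF mul0r //.
  case: (boolP (J \subset f P)) => JP; last first.
    have /subsetPn [i iJ iP] := JP; rewrite mul0r mulr0 (bigD1 i) //= (negbTE iP) mul0r //.
  rewrite !mul1r -prodr_const; apply: eq_bigr => i iJ.
  by rewrite (fintype.subsetP JM i iJ) (fintype.subsetP JP i iJ).
under eq_bigr do rewrite expand.
rewrite exchange_big /=.
have bound (J : {set 'I_N}) : \sum_(P | good P) (J \subset M)%:R * ((J \subset f P)%:R * theta ^+ #|J|) <=
   (ngood N)%:R * ((J \subset M)%:R * (theta * p) ^+ #|J|).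
  case: (boolP (J \subset M)) => JM; last first.
    by rewrite big1 ?mul0r ?mulr0 // => P _; rewrite mul0r.
  under eq_bigr do rewrite mul1r; rewrite -mulr_suml mul1r.
  have -> : \sum_(P | good P) (J \subset f P)%:R = #|[set P | good P && (J \subset f P)]|%:R :> R.
    rewrite -sum1_card natr_sum [RHS](eq_bigl (fun P => good P && (J \subset f P))); last by move=> P; rewrite inE.
    by rewrite [RHS]big_mkcondr /=; apply: eq_bigr => P _; case: (_ \subset _).
  have h := good_superset (R := R) f s J eqv N0 sN fs.
  have t0 : 0 <= theta ^+ #|J| by rewrite exprn_ge0.
  have := ler_wpM2r t0 h; rewrite -/p [(theta * p) ^+ _]exprMn.
  by move: (p ^+ #|J|) (theta ^+ #|J|) => a b; rewrite -mulrA (mulrC b a) mulrCA mulrA.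
apply: le_trans (ler_sum _ (fun J _ => bound J)) _.
rewrite -mulr_sumr; apply: ler_wpM2l; first by rewrite ler0n.
have -> : \sum_(J : {set 'I_N}) (J \subset M)%:R * (theta * p) ^+ #|J| =
    \prod_(i : 'I_N) ((if i \in M then theta * p else 0) + 1).
  rewrite bigA_distr; apply: eq_bigr => J _; rewrite -big_mkcond /=.
  case: (boolP (J \subset M)) => JM; last first.
    have /subsetPn [i iJ iM] := JM; rewrite mul0r (bigD1 i) //= (negbTE iM) mul0r //.
  by rewrite mul1r -prodr_const; apply: eq_bigr => i iJ; rewrite (fintype.subsetP JM i iJ).
apply: le_trans (_ : \prod_(i in M) expR (theta * p) <= _).
  rewrite [leRHS]big_mkcond; apply: ler_prod => i _; case: ifP => _; last by rewrite add0r ler01 lexx.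
  by rewrite addr_ge0 ?mulr_ge0 // addrC expR_ge1Dx.
rewrite prodr_const -expRM_natl ler_expR.
have mN : #|M|%:R <= N%:R :> R by rewrite ler_nat -[X in (_ <= X)%N]card_ord max_card.
have h1 : theta * p <= lam * p + 2 * lam ^+ 2.
  have a1 : theta * p <= (lam + 2 * lam ^+ 2) * p by rewrite ler_wpM2r.
  have a2 : 2 * lam ^+ 2 * p <= 2 * lam ^+ 2 * 1 by rewrite ler_wpM2l // mulr_ge0 ?sqr_ge0.
  lra.
have h2 : #|M|%:R * (theta * p) <= #|M|%:R * (lam * p + 2 * lam ^+ 2) by rewrite ler_wpM2l.
have h3 : 2 * lam ^+ 2 * #|M|%:R <= 2 * lam ^+ 2 * N%:R by rewrite ler_wpM2l // mulr_ge0 ?sqr_ge0.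
rewrite -/p; lra.
Qed.

Lemma good_sample_tail {R : realType} {N : nat} (f : part3 N -> {set 'I_N}) (s : nat) (M : {set 'I_N}) (t : R) :
  equivariant f -> (0 < N)%N -> (s <= N)%N -> (forall P, good P -> (#|f P| <= s)%N) ->
  0 <= t <= 2 * N%:R ->
  \sum_(P | good P && (s%:R / N%:R * #|M|%:R + t <= #|f P :&: M|%:R)) 1
    <= (ngood N)%:R * expR (- (t ^+ 2 / (8 * N%:R))).
Proof.
move=> eqv N0 sN fs /andP[t0 t2].
have NR : 0 < N%:R :> R by rewrite ltr0n.
(* Minimizes the exponent [- (lam * t) + 2 * lam ^ 2 * N]. *)
have [lam El] : exists lam, lam = t / (4 * N%:R) by exists (t / (4 * N%:R)).
have l0 : 0 <= lam by rewrite El divr_ge0 // mulr_ge0 // ltW.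
have l2 : lam <= 1 / 2 by rewrite El ler_pdivrMr ?mulr_gt0 //; lra.
have l02 : 0 <= lam <= 1 / 2 by rewrite l0 l2.
have mgf := good_sample_mgf f s M lam eqv N0 sN fs l02.
set m := s%:R / N%:R * #|M|%:R in mgf *.
have step : \sum_(P | good P && (m + t <= #|f P :&: M|%:R)) 1 <=
    expR (- (lam * (m + t))) * \sum_(P | good P) expR (lam * #|f P :&: M|%:R).
  rewrite mulr_sumr [leLHS]big_mkcondr; apply: ler_sum => P _.
  case: ifP => h; last by rewrite mulr_ge0 ?expR_ge0.
  by rewrite -expRD -[leLHS]expR0 ler_expR addrC subr_ge0 ler_wpM2l.
apply: le_trans step _; apply: le_trans (ler_wpM2l (expR_ge0 _) mgf) _.
rewrite mulrCA -expRD; apply: ler_wpM2l; first by rewrite ler0n.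
rewrite ler_expR El le_eqVlt; apply/orP; left; apply/eqP; field; by rewrite gt_eqF.
Qed.

Definition part_of {N : nat} (j : 'I_3) (P : part3 N) : {set 'I_N} :=
  if j == 0 :> nat then P.1.1 else if j == 1 :> nat then P.1.2 else P.2.

Lemma part_of_equivariant {N : nat} (j : 'I_3) : equivariant (@part_of N j).
Proof. by move=> s P; rewrite /part_of /part_act /=; do ![case: ifP => _]. Qed.

(** Superset probabilities only give upper tails; the lower tail of a part is obtained as the upper
    tail of its complement. *)
Lemma part_of_compl_equivariant {N : nat} (j : 'I_3) :
  equivariant (fun P : part3 N => ~: part_of j P).
Proof.
move=> s P; rewrite part_of_equivariant; apply/setP => u.
rewrite -[u](permKV s) !inE !(mem_imset _ _ (@perm_inj _ s)).
by rewrite !inE.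
Qed.

Lemma card_part_of {N : nat} (j : 'I_3) (P : part3 N) : good P ->
  (N %/ 3 <= #|part_of j P| <= (N %/ 3).+1)%N.
Proof.
rewrite /good => /andP[_ /andP[_ /andP[_ /andP[_ /and4P[h1 h2 h3 h4]]]]].
rewrite /part_of; case: ifP => _; last case: ifP => _.
- by rewrite h4 andbT (leq_trans h1) // (leq_trans h2).
- by rewrite (leq_trans h1 h2) (leq_trans h3).
- by rewrite h1 (leq_trans h2) // (leq_trans h3).
Qed.

Lemma card_part_of_R {R : realType} {N : nat} (j : 'I_3) (P : part3 N) : good P ->
  `|#|part_of j P|%:R - N%:R / 3| <= (1 : R).
Proof.
move=> gP; have /andP[h1 h2] := card_part_of j P gP.
have a1 : (N <= 3 * #|part_of j P| + 3)%N by lia.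
have a2 : (3 * #|part_of j P| <= N + 3)%N by lia.
rewrite -(ler_nat R) natrD natrM in a1; rewrite -(ler_nat R) natrD natrM in a2.
by rewrite ler_norml; apply/andP; split; lra.
Qed.

Lemma part_sample_tail {R : realType} {N : nat} (j : 'I_3) (M : {set 'I_N}) (t : R) :
  (0 < N)%N -> 0 <= t <= 2 * N%:R ->
  \sum_(P | good P && ~~ (`|#|part_of j P :&: M|%:R - #|M|%:R / 3| <= t + 1)) 1
    <= (ngood N)%:R * (2 * expR (- (t ^+ 2 / (8 * N%:R)))).
Proof.
move=> N0 ht.
have NR : 0 < N%:R :> R by rewrite ltr0n.
have MN : #|M|%:R <= N%:R :> R by rewrite ler_nat -[X in (_ <= X)%N]card_ord max_card.
have M0 : 0 <= #|M|%:R :> R by rewrite ler0n.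
have s1 : ((N %/ 3).+1 <= N)%N by lia.
have s2 : (N - N %/ 3 <= N)%N by lia.
have b1 (P : part3 N) : good P -> (#|part_of j P| <= (N %/ 3).+1)%N by case/(card_part_of j)/andP.
have b2 (P : part3 N) : good P -> (#|~: part_of j P| <= N - N %/ 3)%N.
  move=> gP; have /andP[h _] := card_part_of j P gP.
  have := cardsC (part_of j P); rewrite card_ord => E.
  by move: h E; move: #|part_of j P| #|~: _| => a b; clear; lia.
have t1 := good_sample_tail (@part_of N j) (N %/ 3).+1 M t (part_of_equivariant j) N0 s1 b1 ht.
have t2 := good_sample_tail _ (N - N %/ 3) M t (part_of_compl_equivariant j) N0 s2 b2 ht.
apply: le_trans (_ : _ <= (ngood N)%:R * expR (- (t ^+ 2 / (8 * N%:R))) + (ngood N)%:R * expR (- (t ^+ 2 / (8 * N%:R)))) _; last first.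
  by rewrite le_eqVlt; apply/orP; left; apply/eqP; ring.
apply: le_trans (lerD t1 t2).
rewrite [leLHS]big_mkcondr [X in _ <= X + _]big_mkcondr [X in _ <= _ + X]big_mkcondr -big_split.
apply: ler_sum => P gP /=.
case: ifP => [|_]; last by rewrite addr_ge0 //; case: ifP.
rewrite ler_norml negb_and -!ltNge => h.
have q1 : ((N %/ 3).+1)%:R / N%:R * #|M|%:R <= #|M|%:R / 3 + (1 : R).
  have a : ((N %/ 3).+1)%:R <= N%:R / 3 + (1 : R).
    have : (3 * (N %/ 3).+1 <= N + 3)%N by clear; lia.
    rewrite -(ler_nat R) natrD natrM; clear; lra.
  rewrite mulrAC ler_pdivrMr //.
  have := ler_wpM2r M0 a; lra.
have q2 : (N - N %/ 3)%:R / N%:R * #|M|%:R <= 2 * #|M|%:R / 3 + (1 : R).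
  have a : (N - N %/ 3)%:R <= 2 * N%:R / 3 + (1 : R).
    have : (3 * (N - N %/ 3) <= 2 * N + 3)%N by clear; lia.
    rewrite -(ler_nat R) natrD !natrM; clear; lra.
  rewrite mulrAC ler_pdivrMr //.
  have := ler_wpM2r M0 a; lra.
have cM : #|M|%:R = #|part_of j P :&: M|%:R + #|~: part_of j P :&: M|%:R :> R.
  rewrite -natrD; congr _%:R; rewrite -(cardsID (part_of j P) M) finset.setIC; congr (_ + _)%N.
  by apply: eq_card => u; rewrite !inE andbC.
case/orP: h => h.
  have -> : (N - N %/ 3)%:R / N%:R * #|M|%:R + t <= #|~: part_of j P :&: M|%:R.
    by move: q2 h; rewrite cM; lra.
  by rewrite lerDr; case: ifP.
have -> : ((N %/ 3).+1)%:R / N%:R * #|M|%:R + t <= #|part_of j P :&: M|%:R.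
  by move: q1 h; lra.
by rewrite lerDl; case: ifP.
Qed.

Lemma card_ord_lt {N : nat} (k : nat) : (k <= N)%N -> #|[set u : 'I_N | (u < k)%N]| = k.
Proof.
move=> kN; have [->|kN'] := eqVneq k N.
  by rewrite -[RHS]card_ord -cardsT; congr #|pred_of_set _|; apply/setP => u; rewrite !inE ltn_ord.
rewrite -sum1_card (eq_bigl (fun u : 'I_N => (u < k)%N)); last by move=> u; rewrite inE.
by rewrite -(big_ord_widen_cond N xpredT (fun=> 1%N)) ?sum1_card ?card_ord.
Qed.

Definition parts_regular {R : realType} {N : nat} (P : part3 N) (delta : R) : Prop :=
  forall j, count_regular (part_of j P) delta.

Lemma parts_irregular_count {R : realType} {N : nat} (delta : R) :
  (12 <= N)%N -> 0 <= delta <= 1 -> 24 <= N%:R * delta ->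
  \sum_(P : part3 N | good P && ~~ `[< parts_regular P delta >]) 1
    <= (ngood N)%:R * (6 * (N.+1)%:R * expR (- (N%:R * delta ^+ 2 / 512))).
Proof.
move=> N12 /andP[d0 d1] hd.
have N0 : (0 < N)%N by lia.
have NR : 0 < N%:R :> R by rewrite ltr0n.
have N12R : 12 <= N%:R :> R by rewrite (ler_nat R 12).
(* A part has at least [N / 4] vertices, so a deviation of [N * delta / 8], plus 2 for the rounding
   of sizes, stays below [delta] times the size of the part. *)
pose t := N%:R * delta / 8.
have ht : 0 <= t <= 2 * N%:R.
  rewrite /t divr_ge0 ?mulr_ge0 // ?ltW //=.
  have : N%:R * delta <= N%:R * 1 by rewrite ler_wpM2l // ltW.
  lra.
pose M (m : 'I_N.+1) : {set 'I_N} := [set u : 'I_N | (u < m)%N].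
pose bad (i : 'I_3 * 'I_N.+1) (P : part3 N) :=
  ~~ (`|#|part_of i.1 P :&: M i.2|%:R - #|M i.2|%:R / 3| <= t + 1).
have cM (m : 'I_N.+1) : #|M m| = m by apply: card_ord_lt; rewrite -ltnS ltn_ord.
apply: le_trans (_ : \sum_(P : part3 N | good P && [exists i, bad i P]) 1 <= _).
  rewrite [leLHS]big_mkcondr [leRHS]big_mkcondr; apply: ler_sum => P gP.
  case: ifP => [|_]; last by case: ifP.
  move=> /negP hP; case: ifP => // /negbT; rewrite negb_exists => /forallP hb; exfalso; apply: hP.
  apply/asboolP => j m mN.
  have mN1 : (m < N.+1)%N by [].
  have := hb (j, Ordinal mN1); rewrite negbK /= cM /=.
  have -> : part_of j P :&: M (Ordinal mN1) = [set u in part_of j P | (u < m)%N].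
    by apply/setP => u; rewrite !inE.
  have := card_part_of_R (R := R) j P gP.
  set n := #|part_of j P|%:R; set k := #|_|%:R => hn hk.
  have mR : m%:R / N%:R <= (1 : R) by rewrite ler_pdivrMr // mul1r ler_nat.
  have mR0 : 0 <= m%:R / N%:R :> R by rewrite divr_ge0.
  have E : k - n * (m%:R / N%:R) = (k - m%:R / 3) - (n - N%:R / 3) * (m%:R / N%:R).
    by field; rewrite gt_eqF.
  rewrite E; apply: le_trans (ler_normB _ _) _; rewrite normrM (ger0_norm mR0).
  have a1 : `|n - N%:R / 3| * (m%:R / N%:R) <= 1 * 1 by apply: ler_pM.
  have a2 : N%:R / 4 * delta <= n * delta.
    by apply: ler_wpM2r => //; move: hn; rewrite ler_norml => /andP[hn _]; lra.
  rewrite /t in hk; lra.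
rewrite big_mkcondl /=.
have := sum_exists_le (R := R) (fun P : part3 N => if good P then 1 else 0) bad.
have p01 (P : part3 N) : 0 <= (if good P then 1 else 0 : R) by case: ifP.
move=> /(_ p01) h.
have e1 : \sum_(P | [exists i, bad i P]) (if good P then 1 else 0 : R) =
    \sum_(P : part3 N | [exists i, bad i P]) (if good P then 1 else 0) by [].
apply: le_trans h _.
apply: le_trans (_ : \sum_(i : 'I_3 * 'I_N.+1) (ngood N)%:R * (2 * expR (- (t ^+ 2 / (8 * N%:R)))) <= _).
  apply: ler_sum => i _.
  have := part_sample_tail (R := R) i.1 (M i.2) t N0 ht.
  by rewrite [leLHS]big_mkcondl.
rewrite sumr_const card_prod !card_ord -[leLHS]mulr_natl natrM.
rewrite (_ : t ^+ 2 / (8 * N%:R) = N%:R * delta ^+ 2 / 512); last by rewrite /t; field; rewrite gt_eqF.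
rewrite le_eqVlt; apply/orP; left; apply/eqP; ring.
Qed.

(** * Alignment and merging *)

Definition near_positions {R : realType} {N : nat} (A : {set 'I_N}) (s : 'I_N -> nat)
    (q : 'I_N -> R) (xi : R) : Prop :=
  {in A, forall u, `|(s u).+1%:R / #|A|%:R - q u| <= xi}.

Definition orient {R : realType} {N : nat} (b : bool) (u : 'I_N) : R :=
  if b then 1 - vpos R u else vpos R u.

Lemma orient_itv {R : realType} {N : nat} (b : bool) (u : 'I_N) : 0 <= orient (R := R) b u <= 1.
Proof.
have h0 : 0 <= vpos R u by rewrite divr_ge0.
have h1 : vpos R u <= 1.
  by rewrite /vpos ler_pdivrMr ?mul1r ?ler_nat // ltr0n (leq_ltn_trans _ (ltn_ord u)).
by rewrite /orient; case: b; apply/andP; split; lra.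
Qed.

Lemma orient_neg {R : realType} {N : nat} (b : bool) (u : 'I_N) :
  orient (R := R) (~~ b) u = 1 - orient b u.
Proof. by rewrite /orient; case: b => //=; rewrite subKr. Qed.

Lemma orders_near {R : realType} {N : nat} (q : 'I_N -> R) (T : {set 'I_N}) (tau omega : R)
    (sig : 'I_N -> nat) :
  spread q T tau -> 0 <= tau -> 0 <= omega -> (forall u, 0 <= q u <= 1) -> is_ordering T sig ->
  orders_up_to q T omega sig -> near_positions T sig q (omega + tau + #|T|%:R^-1).
Proof.
move=> sp t0 w0 q01 ord ou u uT.
have T0 : 0 < #|T|%:R :> R by rewrite ltr0n; apply/card_gt0P; exists u.
have /andP[q0 q1] := q01 u.
have h1 := rank_le q T tau omega sig u sp t0 q0 w0 ord ou uT.
have h2 := rank_ge q T tau omega sig u sp t0 q1 w0 ord ou uT.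
have i0 : 0 < #|T|%:R^-1 :> R by rewrite invr_gt0.
rewrite ler_norml; apply/andP; split.
  suff : q u - omega - tau <= (sig u).+1%:R / #|T|%:R by lra.
  rewrite ler_pdivlMr // mulrC; apply: le_trans h2 _; by rewrite ler_nat.
suff : (sig u).+1%:R / #|T|%:R <= q u + omega + tau by lra.
by rewrite ler_pdivrMr // mulrC.
Qed.

(** Ranks counted from 1 are subtracted from [#|A| + 1], and this extra 1 costs [#|A|^-1]. *)
Lemma near_revo {R : realType} {N : nat} (A : {set 'I_N}) (s : 'I_N -> nat) (b : bool) (xi : R) :
  is_ordering A s -> near_positions A s (orient b) xi ->
  near_positions A (revo A s) (orient (~~ b)) (xi + #|A|%:R^-1).
Proof.
move=> [_ lt] h u uA; have := h u uA; have su := lt u uA.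
have A0 : 0 < #|A|%:R :> R by rewrite ltr0n; apply/card_gt0P; exists u.
rewrite orient_neg.
rewrite (_ : (revo A s u).+1%:R = #|A|%:R - (s u).+1%:R + 1); last first.
  by rewrite /revo -natr1 natrB.
move: (orient b u) => q hq.
rewrite (_ : _ - _ = #|A|%:R^-1 - ((s u).+1%:R / #|A|%:R - q)); last by field; rewrite gt_eqF.
apply: le_trans (ler_normB _ _) _.
by rewrite [`|_^-1|]ger0_norm ?invr_ge0 ?(ltW A0) // [leRHS]addrC lerD2l.
Qed.

(** A common vertex in the first quarter is at distance at least 1/2 from its mirror image, so the
    wrong orientation shows an error of at least [1 / 2 - 3 * xi], against at most [2 * xi] for the
    right one; [10 * xi < 1] separates them. *)
Lemma aligned_same {R : realType} {N : nat} (A B : {set 'I_N}) (s1 s2 : 'I_N -> nat) (b : bool)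
    (xi : R) v :
  is_ordering A s1 -> near_positions A s1 (orient b) xi -> near_positions B s2 (orient b) xi ->
  #|A|%:R^-1 <= xi -> 10 * xi < 1 -> v \in A :&: B -> vpos R v <= 1 / 4 ->
  aligned R A B s1 s2.
Proof.
move=> ord h1 h2 hA hxi vAB v4; rewrite /aligned.
have [_ lt] := ord.
have nr := near_revo A s1 b xi ord h1.
have x0 : 0 <= xi by apply: le_trans hA; rewrite invr_ge0.
have E u : u \in A -> (#|A| - s1 u)%N = (revo A s1 u).+1 by move=> /lt; rewrite /revo => h; lia.
apply: le_trans (_ : 2 * xi <= _).
  apply: bigmax_le => [|u]; first by rewrite mulr_ge0.
  rewrite inE => /andP[uA uB]; have := h1 u uA; have := h2 u uB.
  rewrite !ler_norml => /andP[a1 a2] /andP[a3 a4]; apply/andP; split; lra.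
apply: le_trans (le_bigmax_cond _ _ vAB).
move: vAB; rewrite inE => /andP[vA vB]; rewrite E //.
have := nr v vA; have := h2 v vB; rewrite orient_neg.
set y := _ / _ ; set x := _ / _.
rewrite !ler_norml => /andP[a1 a2] /andP[a3 a4].
have : 1 / 2 <= `|1 - 2 * orient (R := R) b v|.
  rewrite /orient; case: b {h1 h2 nr a1 a2 a3 a4} => /=.
    by rewrite ler0_norm; lra.
  by rewrite ger0_norm; lra.
rewrite !ler_normr => /orP[hs|hs]; apply/orP; [left|right]; lra.
Qed.

Lemma aligned_opposite {R : realType} {N : nat} (A B : {set 'I_N}) (s1 s2 : 'I_N -> nat) (b : bool)
    (xi : R) v :
  is_ordering A s1 -> near_positions A s1 (orient b) xi -> near_positions B s2 (orient (~~ b)) xi ->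
  #|A|%:R^-1 <= xi -> 10 * xi < 1 -> v \in A :&: B -> vpos R v <= 1 / 4 ->
  aligned R A B s1 s2 = false.
Proof.
move=> ord h1 h2 hA hxi vAB v4; apply/negbTE; rewrite /aligned -ltNge.
have [_ lt] := ord.
have nr := near_revo A s1 b xi ord h1.
have x0 : 0 <= xi by apply: le_trans hA; rewrite invr_ge0.
have E u : u \in A -> (#|A| - s1 u)%N = (revo A s1 u).+1 by move=> /lt; rewrite /revo => h; lia.
apply: le_lt_trans (_ : _ <= 3 * xi) _.
  apply: bigmax_le => [|u]; first by rewrite mulr_ge0.
  rewrite inE => /andP[uA uB]; have := nr u uA; have := h2 u uB; rewrite E //.
  rewrite !ler_norml => /andP[a1 a2] /andP[a3 a4]; apply/andP; split; lra.
apply: lt_le_trans (le_bigmax_cond _ _ vAB).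
move: vAB; rewrite inE => /andP[vA vB].
have := h1 v vA; have := h2 v vB; rewrite orient_neg.
set y := _ / _ ; set x := _ / _.
rewrite !ler_norml => /andP[a1 a2] /andP[a3 a4].
have : 1 / 2 <= `|1 - 2 * orient (R := R) b v|.
  rewrite /orient; case: b {h1 h2 nr a1 a2 a3 a4} => /=.
    by rewrite ler0_norm; lra.
  by rewrite ger0_norm; lra.
rewrite ler_normr ltr_normr => /orP[hs|hs]; apply/orP; [right|left]; lra.
Qed.

Lemma near_after_alignment {R : realType} {N : nat} (A B : {set 'I_N}) (s1 s2 : 'I_N -> nat)
    (b1 b2 : bool) (xi : R) v :
  is_ordering A s1 -> near_positions A s1 (orient b1) xi -> near_positions B s2 (orient b2) xi ->
  #|A|%:R^-1 <= xi -> 10 * xi < 1 -> v \in A :&: B -> vpos R v <= 1 / 4 ->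
  near_positions A (if aligned R A B s1 s2 then s1 else revo A s1) (orient b2) (2 * xi).
Proof.
move=> ord h1 h2 hA hxi vAB v4.
have x0 : 0 <= xi by apply: le_trans hA; rewrite invr_ge0.
have [Eb|Eb] := eqVneq b1 b2.
  subst b2; rewrite (aligned_same A B s1 s2 b1 xi v) // => u uA.
  by apply: le_trans (h1 u uA) _; lra.
have Eb2 : b2 = ~~ b1 by case: (b1) (b2) Eb => [] [].
subst b2; rewrite (aligned_opposite A B s1 s2 b1 xi v) // => u uA.
by apply: le_trans (near_revo A s1 b1 xi ord h1 u uA) _; lra.
Qed.

Lemma merged_near {R : realType} {N : nat} (P : part3 N) (s1 s2 s3 : 'I_N -> nat) (q : 'I_N -> R)
    (xi : R) :
  good P -> (forall u, 0 <= q u <= 1) -> 0 <= xi ->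
  near_positions P.1.1 s1 q xi -> near_positions P.1.2 s2 q xi -> near_positions P.2 s3 q xi ->
  forall u, `|(merged P s1 s2 s3 u).+1%:R - N%:R * q u| <= 3 * N%:R * xi + 5.
Proof.
rewrite /good => /and5P[/eqP cov _ _ _ /and4P[c1 c2 c3 c4]] q01 x0 h1 h2 h3 u.
have key (A : {set 'I_N}) (s : 'I_N -> nat) (j : nat) : near_positions A s q xi -> u \in A ->
    (j <= 2)%N -> (N <= 3 * #|A| + 3)%N -> (3 * #|A| <= N + 3)%N ->
    `|(3 * s u + j).+1%:R - N%:R * q u| <= 3 * N%:R * xi + 5.
  move=> h uA j2 a1 a2; have := h u uA; have /andP[q0 q1] := q01 u.
  have A0 : 0 < #|A|%:R :> R by rewrite ltr0n; apply/card_gt0P; exists u.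
  have aN : #|A|%:R <= N%:R :> R by rewrite ler_nat -[X in (_ <= X)%N]card_ord max_card.
  have jR : j%:R <= 2 :> R by rewrite (ler_nat R j 2).
  have j0 : 0 <= j%:R :> R by [].
  rewrite -(ler_nat R) natrD natrM in a1; rewrite -(ler_nat R) natrD natrM in a2.
  rewrite -[(3 * s u + j).+1%:R]natr1 natrD natrM -[(s u).+1%:R]natr1; move: (s u)%:R => x hx.
  (* The scaled position error, the mismatch between [3 * #|A|] and N, and the offset within a block
     of three; the last two cost at most 3 and 2. *)
  rewrite (_ : _ - _ = 3 * #|A|%:R * ((x + 1) / #|A|%:R - q u) + (3 * #|A|%:R - N%:R) * q u
     + (j%:R - 2)); last by field; rewrite gt_eqF.
  have b1 : `|3 * #|A|%:R * ((x + 1) / #|A|%:R - q u)| <= 3 * N%:R * xi.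
    rewrite normrM ger0_norm ?mulr_ge0 //; by apply: ler_pM; rewrite ?mulr_ge0 // ler_pM2l.
  have b2 : `|(3 * #|A|%:R - N%:R) * q u| <= 3 * 1.
    rewrite normrM; apply: ler_pM => //; last by rewrite ger0_norm.
    by rewrite ler_norml; apply/andP; split; clear -a1 a2; lra.
  have b3 : `|j%:R - 2| <= 2 :> R.
    by rewrite ler_norml; apply/andP; split; clear -jR j0; lra.
  apply: le_trans (ler_normD _ _) _; apply: le_trans (lerD (ler_normD _ _) (lexx _)) _.
  by clear -b1 b2 b3; lra.
rewrite /merged; case: ifP => u1; first by rewrite -[(3 * s1 u)%N]addn0; apply: (key _ _ 0%N h1) => //; lia.
case: ifP => u2; first by apply: (key _ _ 1%N h2) => //; lia.
have u3 : u \in P.2 by have := finset.in_setT u; rewrite -cov !inE u1 u2.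
by apply: (key _ _ 2%N h3) => //; lia.
Qed.

Lemma adist_natE {R : realType} (m n : nat) : (adist m n)%:R = `|m%:R - n%:R| :> R.
Proof.
rewrite /adist; have [mn|nm] := leqP m n.
  by rewrite (eqP (_ : m - n == 0)%N) // add0n natrB // distrC ger0_norm // subr_ge0 ler_nat.
have nm' := ltnW nm.
by rewrite (eqP (_ : n - m == 0)%N) // addn0 natrB // ger0_norm // subr_ge0 ler_nat.
Qed.

Lemma near_adist {R : realType} {N : nat} (sig : 'I_N -> nat) (b : bool) (c : R) :
  (forall u, `|(sig u).+1%:R - N%:R * orient b u| <= c) ->
  forall u : 'I_N, (adist (if b then N - (sig u).+1 else sig u)%N u)%:R <= c + 1.
Proof.
move=> h u; have := h u.
have N0 : 0 < N%:R :> R by rewrite ltr0n (leq_ltn_trans _ (ltn_ord u)).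
have Ev : N%:R * vpos R u = u%:R + 1 by rewrite /vpos mulrC divfK ?gt_eqF // natr1.
rewrite adist_natE /orient; case: b {h}; last first.
  by rewrite Ev -natr1; rewrite !ler_norml => /andP[a1 a2]; apply/andP; split; lra.
rewrite mulrBr Ev mulr1.
have uN : u%:R + 1 <= N%:R :> R by rewrite natr1 ler_nat.
have [sN|Ns] := leqP (sig u).+1 N.
  by rewrite natrB // !ler_norml => /andP[a1 a2]; apply/andP; split; lra.
(* Truncated subtraction returns 0 here, which only brings the value closer to [u]. *)
have Ns' : N%:R <= (sig u).+1%:R :> R by rewrite ler_nat ltnW.
have u0 : 0 <= u%:R :> R by [].
rewrite (eqP (_ : N - (sig u).+1 == 0)%N); last by rewrite subn_eq0 ltnW.
by rewrite !ler_norml => /andP[a1 a2]; apply/andP; split; lra.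
Qed.

Lemma bigmax_nat_le {R : realType} {N : nat} (F : 'I_N -> nat) (c : R) : 0 <= c ->
  (forall i, (F i)%:R <= c) -> (\max_i F i)%:R <= c.
Proof.
move=> c0 h; apply: (big_ind (fun k : nat => k%:R <= c)) => // x y hx hy.
by rewrite /maxn; case: ifP.
Qed.

Lemma distinf_le {R : realType} {N : nat} (sig : 'I_N -> nat) (b : bool) (c : R) : 0 <= c ->
  (forall u, `|(sig u).+1%:R - N%:R * orient b u| <= c) -> (distinf sig)%:R <= c + 1.
Proof.
move=> c0 h; have hb := near_adist sig b c h.
have c1 : 0 <= c + 1 by rewrite addr_ge0.
have := bigmax_nat_le _ _ c1 hb; rewrite /distinf; case: b {h hb} => h; apply: le_trans h.
  by rewrite ler_nat geq_minr.
by rewrite ler_nat geq_minl.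
Qed.

Lemma dist1_le {R : realType} {N : nat} (sig : 'I_N -> nat) (b : bool) (c : R) :
  (forall u, `|(sig u).+1%:R - N%:R * orient b u| <= c) -> (dist1 sig)%:R <= N%:R * (c + 1).
Proof.
move=> h; have hb := near_adist sig b c h.
have : (\sum_(u < N) adist (if b then N - (sig u).+1 else sig u)%N u)%:R <= N%:R * (c + 1).
  rewrite natr_sum; apply: le_trans (ler_sum _ (fun u _ => hb u)) _.
  by rewrite sumr_const card_ord -[leLHS]mulr_natl.
rewrite /dist1; case: b {h hb} => h; apply: le_trans h.
  by rewrite ler_nat geq_minr.
by rewrite ler_nat geq_minl.
Qed.

Lemma part_ofE {N : nat} (P : part3 N) :
  (part_of (inord 0) P = P.1.1) * (part_of (inord 1) P = P.1.2) * (part_of (inord 2) P = P.2).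
Proof. by rewrite /part_of !inordK. Qed.

(** A third of [M] is at least [N / 60], so missing [M] altogether is a deviation beyond
    [N / 100 + 1] once [N >= 200]. *)
Lemma part_miss_count {R : realType} {N : nat} (j : 'I_3) (M : {set 'I_N}) :
  (200 <= N)%N -> N%:R / 20 <= #|M|%:R :> R ->
  \sum_(P : part3 N | good P && (part_of j P :&: M == finset.set0)) 1
    <= (ngood N)%:R * (2 * expR (- (N%:R / 80 / 1000))) :> R.
Proof.
move=> N2 hM.
have NR : 200 <= N%:R :> R by rewrite (ler_nat R 200).
have ht : 0 <= (N%:R : R) / 100 <= 2 * (N%:R : R) by apply/andP; split; lra.
have N0 : (0 < N)%N by apply: leq_trans N2.
have := part_sample_tail (R := R) j M (N%:R / 100) N0 ht.
rewrite (_ : (N%:R / 100) ^+ 2 / (8 * N%:R) = N%:R / 80 / 1000); last by field; rewrite pnatr_eq0 -lt0n.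
apply: le_trans.
rewrite [leLHS]big_mkcondr [leRHS]big_mkcondr; apply: ler_sum => P gP.
case: eqP => [E|_]; last by case: ifP.
rewrite E cards0 sub0r normrN ger0_norm ?divr_ge0 // ifT //.
by rewrite -ltNge; lra.
Qed.

(** The candidates for the vertex that settles the alignment of part [j] with the reference
    ordering. *)
Definition low_part {N : nat} (j : 'I_3) (P : part3 N) : {set 'I_N} :=
  [set u in part_of j P | (u < N %/ 4)%N].

Lemma card_low_part {R : realType} {N : nat} (j : 'I_3) (P : part3 N) (delta : R) :
  (200 <= N)%N -> good P -> delta <= 1 / 100 -> parts_regular P delta ->
  N%:R / 20 <= #|low_part j P|%:R :> R.
Proof.
move=> N2 gP d1 pr.
have NR : 200 <= N%:R :> R by rewrite (ler_nat R 200).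
have N0 : 0 < N%:R :> R by lra.
have m4 : (N %/ 4 <= N)%N by exact: leq_div.
have := pr j _ m4; rewrite -/(low_part j P).
have := card_part_of_R (R := R) j P gP.
move: #|part_of j P|%:R #|low_part j P|%:R => n k.
rewrite !ler_norml => /andP[a1 a2] /andP[a3 a4].
have mR : 1 / 4 - 1 / 200 <= (N %/ 4)%:R / N%:R :> R.
  rewrite ler_pdivlMr //.
  have : (N <= 4 * (N %/ 4) + 3)%N by clear; lia.
  by rewrite -(ler_nat R) natrD natrM; clear -NR; lra.
have n0 : 0 <= n by lra.
have h1 : n * (1 / 4 - 1 / 200) <= n * ((N %/ 4)%:R / N%:R) by rewrite ler_wpM2l.
have h2 : n * delta <= n * (1 / 100) by rewrite ler_wpM2l.
lra.
Qed.

Lemma count_regular_setT {R : realType} {N : nat} (delta : R) :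
  0 <= delta -> count_regular [set: 'I_N] delta.
Proof.
move=> d0 m mN.
have -> : [set u in [set: 'I_N] | (u < m)%N] = [set u : 'I_N | (u < m)%N].
  by apply/setP => u; rewrite !inE.
rewrite card_ord_lt //.
rewrite cardsT card_ord; have [N0|N0] := eqVneq (N%:R : R) 0.
  have N0' : N = 0%N by apply/eqP; rewrite -(pnatr_eq0 R) N0.
  have -> : m = 0%N by apply/eqP; rewrite -leqn0 -N0'.
  by rewrite N0 !mul0r subrr normr0.
by rewrite mulrCA divff // mulr1 subrr normr0 mulr_ge0.
Qed.

(** The deterministic half: all randomness is in the hypotheses. Graph regularity is taken at
    [2 * delta], the scale at which counting at [delta] controls positions. *)
Lemma ordering_errors {R : realType} (rho : R -> R) (Lam : R) : decay_profile rho Lam ->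
  exists (C d0 eps : R) (n0 : nat) (F : nat -> nat -> R),
  [/\ 0 < C, 0 < d0 <= 1 / 100 & 0 < eps <= 2] /\ (forall n i, `|F n i| <= 1) /\
  forall (N : nat) (e : graph N) (delta : R),
    (n0 <= N)%N -> 4 <= N%:R * delta -> delta <= d0 ->
  (forall sig, graph_ok rho F [set: 'I_N] (2 * delta) eps e -> spec_ser R e [set: 'I_N] sig ->
     (dist1 sig)%:R <= C * N%:R ^+ 2 * delta) /\
  (forall P P' sig, good P -> good P' -> parts_regular P delta -> parts_regular P' delta ->
     (forall j, part_of (inord 1) P' :&: low_part j P != finset.set0) ->
     (forall j, graph_ok rho F (part_of j P) (2 * delta) eps e) ->
     graph_ok rho F P'.1.1 (2 * delta) eps e ->
     postproc e P P' (5 / 100 : R) (31 / 100) sig ->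
     (distinf sig)%:R <= C * N%:R * delta).
Proof.
move=> D; have [K [tau0 [eps [n0 [F [[K0 t0 e0] [F1 H]]]]]]] := subroutine_order rho Lam D.
have [eps1 [p1 p2 p3]] : exists eps1, [/\ 0 < eps1, eps1 <= 2 & eps1 <= eps].
  by exists (Num.min eps 2); split; rewrite ?lt_min ?ge_min ?e0 ?lexx ?orbT //=.
have [d0 [q1 q2 q3 q4]] : exists d0, [/\ 0 < d0, d0 <= 1 / 100, 2 * d0 <= tau0 &
    20 * (2 * K + 3) * d0 < 1].
  have a1 : 0 < tau0 / 2 by apply: divr_gt0.
  have a2 : 0 < 1 / (40 * (2 * K + 3)) by apply: divr_gt0 => //; lra.
  exists (Num.min (1 / 100) (Num.min (tau0 / 2) (1 / (40 * (2 * K + 3))))); split.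
  - by rewrite !lt_min a1 a2 andbT; lra.
  - by rewrite ge_min lexx.
  - by rewrite mulrC -ler_pdivlMr // !ge_min lexx !orbT.
  - apply: le_lt_trans (_ : 1 / 2 < 1); last by lra.
    rewrite mulrC -ler_pdivlMr; last by lra.
    rewrite !ge_min; apply/orP; right; apply/orP; right.
    by rewrite le_eqVlt; apply/orP; left; apply/eqP; field; rewrite gt_eqF //; lra.
(* The merged ranks err by [3 * N * (2 * xi) + 5], the distance adds 1, and [4 <= N * delta] bounds
   this 6 by [2 * N * delta]. *)
have [C EC] : exists C, C = 6 * (2 * K + 3) + 2 by exists (6 * (2 * K + 3) + 2).
exists C, d0, eps1, (4 * n0 + 200)%N, F; split; first by split; [lra|rewrite q1 q2|rewrite p1 p2].
split => // N e delta Nn0 Nd dd0.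
have N2 : (200 <= N)%N by apply: leq_trans Nn0; exact: leq_addl.
have Nn8 : (4 * n0 + 8 <= N)%N by apply: leq_trans Nn0; rewrite leq_add2l.
have pos4 (a : nat) : (N <= 4 * a)%N -> (0 < a)%N.
  by move=> h; clear -h Nn8; lia.
have N4 : (N <= 4 * N)%N by clear; lia.
have N0N : (n0 <= N)%N by clear -Nn8; lia.
have third (a : nat) : (N %/ 3 <= a)%N -> (N <= 4 * a)%N /\ (n0 <= a)%N.
  by move=> h; clear -h Nn8; split; lia.
have quarter (k : nat) : (k < N %/ 4)%N -> (4 * k.+1 <= N)%N by move=> h; clear -h; lia.
have NR : 200 <= N%:R :> R by rewrite (ler_nat R 200).
have NR0 : 0 < N%:R :> R by clear -NR; lra.
have dp : 0 < delta by rewrite -(pmulr_rgt0 _ NR0); clear -Nd; lra.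
(* Ordering error [K * (2 * delta)], spread error [2 * delta], and one rank step, at most
   [delta]. *)
have [xi Exi] : exists xi, xi = (2 * K + 3) * delta by exists ((2 * K + 3) * delta).
have Kd : 0 < K * delta by rewrite mulr_gt0.
have xi1 : 10 * xi < 1.
  have h : 20 * (2 * K + 3) * delta <= 20 * (2 * K + 3) * d0.
    by apply: ler_wpM2l => //; clear -K0; lra.
  rewrite Exi; clear -h q4; lra.
have dxi : delta <= xi by rewrite Exi; clear -Kd dp; lra.
have invA (A : {set 'I_N}) : (N <= 4 * #|A|)%N -> #|A|%:R^-1 <= delta.
  rewrite -(ler_nat R) natrM => h; have A0 : 0 < #|A|%:R :> R by clear -h NR; lra.
  rewrite -div1r ler_pdivrMr // mulrC.
  have h2 : N%:R * delta <= 4 * #|A|%:R * delta by rewrite ler_wpM2r // ltW.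
  clear -h2 Nd; lra.
have bigA (A : {set 'I_N}) : (N <= 4 * #|A|)%N -> 1 <= #|A|%:R * delta.
  rewrite -(ler_nat R) natrM => h.
  have h2 : N%:R * delta <= 4 * #|A|%:R * delta by rewrite ler_wpM2r // ltW.
  clear -h2 Nd; lra.
have bigA2 (A : {set 'I_N}) : (N <= 4 * #|A|)%N -> 1 <= #|A|%:R * (2 * delta).
  by move=> /bigA h; rewrite mulrCA; clear -h; lra.
have d2 : 2 * delta <= tau0 by clear -dd0 q3; lra.
have gr T : graph_ok rho F T (2 * delta) eps1 e -> graph_regular rho F e T (2 * delta) eps.
  move=> [[h1 h2 h3] _]; split => // s t; apply: le_trans (h3 s t) _.
  by rewrite ler_wpM2r // exprn_ge0 // ltW.
have oriented (A : {set 'I_N}) s : orders_up_to (@vpos R N) A (K * (2 * delta)) s \/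
    orders_up_to (fun u => 1 - @vpos R N u) A (K * (2 * delta)) s ->
    (N <= 4 * #|A|)%N -> count_regular A delta -> is_ordering A s ->
    exists b, near_positions A s (orient b) xi.
  move=> h A4 cr ord.
  have A0 := pos4 _ A4.
  have sp := count_regular_spread A delta A0 (bigA A A4) cr.
  have [b [ho hs]] : exists b, orders_up_to (orient b) A (K * (2 * delta)) s /\
      spread (orient b) A (2 * delta).
    by case: h => h; [exists false|exists true; split => //; exact: spread_rev].
  exists b => u uA.
  have t2 : 0 <= 2 * delta by clear -dp; lra.
  have w2 : 0 <= K * (2 * delta) by rewrite mulr_ge0 // ltW.
  apply: le_trans (orders_near (orient b) A (2 * delta) _ s hs t2 w2 (orient_itv b) ord ho u uA) _.
  by have h1 := invA A A4; rewrite Exi; clear -h1; lra.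
split.
  move=> sig ok ss.
  have T4 : (N <= 4 * #|[set: 'I_N]|)%N by rewrite cardsT card_ord.
  have cr : count_regular [set: 'I_N] delta by apply: count_regular_setT; exact: ltW.
  have ws := count_regular_well_spread _ _ (bigA _ T4) cr.
  have n0T : (n0 <= #|[set: 'I_N]|)%N by rewrite cardsT card_ord.
  have [h _] := H N e [set: 'I_N] (2 * delta) n0T T4 (bigA2 _ T4) d2 ws (gr _ ok).
  have ord : is_ordering [set: 'I_N] sig by case: ss => [? [? []]].
  have [b nb] := oriented _ _ (h sig ss) T4 cr ord.
  have hb u : `|(sig u).+1%:R - N%:R * orient b u| <= N%:R * xi.
    have := nb u (finset.in_setT u); rewrite cardsT card_ord => h1.
    rewrite (_ : _ - _ = N%:R * ((sig u).+1%:R / N%:R - orient b u)); last by field; rewrite gt_eqF.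
    by rewrite normrM ger0_norm ?ler_pM2l // ltW.
  apply: le_trans (dist1_le sig b _ hb) _.
  rewrite (_ : C * N%:R ^+ 2 * delta = N%:R * (C * (N%:R * delta))); last by ring.
  rewrite ler_pM2l // Exi EC.
  have h1 : 0 <= (2 * K + 3) * (N%:R * delta).
    by apply: mulr_ge0; [clear -K0; lra|clear -Nd; lra].
  clear -h1 Nd; lra.
move=> P P' sig gP gP' pr pr' meet okP okP' [s1 [s2 [s3 [sref [r1 r2 r3 rr Es]]]]].
have big j (Q : part3 N) : good Q -> (N <= 4 * #|part_of j Q|)%N /\ (n0 <= #|part_of j Q|)%N.
  move=> gQ; have /andP[h _] := card_part_of j Q gQ.
  exact: third.
have run i j (Q : part3 N) s : good Q -> parts_regular Q delta ->
    graph_ok rho F (part_of i Q) (2 * delta) eps1 e -> [disjoint part_of i Q & part_of j Q] ->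
    subroutine e (part_of i Q) (part_of j Q) (5 / 100 : R) (31 / 100) s ->
    is_ordering (part_of j Q) s /\ exists b, near_positions (part_of j Q) s (orient b) xi.
  move=> gQ prQ ok dis sub.
  have [a1 a2] := big i Q gQ; have [b1 b2] := big j Q gQ.
  have ws := count_regular_well_spread _ _ (bigA _ a1) (prQ i).
  have [_ h] := H N e _ (2 * delta) a2 a1 (bigA2 _ a1) d2 ws (gr _ ok).
  have j0 := pos4 _ b1.
  have i0 := pos4 _ a1.
  have sj := count_regular_spread _ _ j0 (bigA _ b1) (prQ j).
  have si := count_regular_spread _ _ i0 (bigA _ a1) (prQ i).
  have ord : is_ordering (part_of j Q) s by case: sub => [? [_ []]].
  split => //; apply: oriented (b1) (prQ j) ord.
  by apply: (h _ _ j0 dis si sj) sub; case: ok.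
have /and5P[_ dis12 dis13 dis23 _] := gP.
have /and5P[_ dis12' _ _ _] := gP'.
have E := part_ofE.
have [ord1 [b1 n1]] : is_ordering P.1.1 s1 /\ exists b, near_positions P.1.1 s1 (orient b) xi.
  have := run (inord 2) (inord 0) P s1 gP pr (okP _); rewrite !E; apply => //.
  by rewrite disjoint_sym.
have [ord2 [b2 n2]] : is_ordering P.1.2 s2 /\ exists b, near_positions P.1.2 s2 (orient b) xi.
  by have := run (inord 0) (inord 1) P s2 gP pr (okP _); rewrite !E; apply.
have [ord3 [b3 n3]] : is_ordering P.2 s3 /\ exists b, near_positions P.2 s3 (orient b) xi.
  by have := run (inord 1) (inord 2) P s3 gP pr (okP _); rewrite !E; apply.
have [ordr [br nr]] : is_ordering P'.1.2 sref /\ exists b, near_positions P'.1.2 sref (orient b) xi.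
  by have := run (inord 0) (inord 1) P' sref gP' pr'; rewrite !E; apply.
have fixed j s b : is_ordering (part_of j P) s -> near_positions (part_of j P) s (orient b) xi ->
    near_positions (part_of j P) (if aligned R (part_of j P) P'.1.2 s sref then s
      else revo (part_of j P) s) (orient br) (2 * xi).
  move=> ord nb; have [v] := finset.set0Pn _ (meet j).
  rewrite !E !inE => /andP[vB /andP[vA v4]].
  apply: (near_after_alignment _ _ _ _ b br xi v) => //.
  - by apply: le_trans (invA _ _) dxi; have [] := big j P gP.
  - by rewrite inE vA.
  - rewrite /vpos ler_pdivrMr //.
    have := quarter _ v4; rewrite -(ler_nat R) natrM => h; clear -h; lra.
have x0 : 0 <= 2 * xi by clear -dxi dp; lra.
have f1 := fixed (inord 0) s1 b1; have f2 := fixed (inord 1) s2 b2; have f3 := fixed (inord 2) s3 b3.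
rewrite !E in f1 f2 f3.
have hm := merged_near P _ _ _ (orient br) (2 * xi) gP (orient_itv br) x0 (f1 ord1 n1) (f2 ord2 n2) (f3 ord3 n3).
have hs u : `|(sig u).+1%:R - N%:R * orient br u| <= 3 * N%:R * (2 * xi) + 5.
  by rewrite Es; exact: hm.
have c0 : 0 <= 3 * N%:R * (2 * xi) + 5 by rewrite addr_ge0 // mulr_ge0 // mulr_ge0.
apply: le_trans (distinf_le sig br _ c0 hs) _.
rewrite Exi EC; clear -Nd; lra.
Qed.

(** * Choice of scales *)

Lemma near_ln_ge {R : realType} (K : R) : \forall N \near \oo%classic, K <= ln (N%:R : R).
Proof.
have : \forall N \near \oo%classic, expR K <= N%:R :> R by exact: nbhs_infty_ger.
apply: filterS => N h; rewrite -(expRK K) ler_ln ?posrE ?expR_gt0 //.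
by apply: lt_le_trans h; exact: expR_gt0.
Qed.

Lemma near_ln_powR_ge {R : realType} (gamma M : R) : 1 < gamma ->
  \forall N \near \oo%classic, M * ln (N%:R : R) <= ln (N%:R : R) `^ gamma.
Proof.
move=> g1.
pose K := (Num.max M 0) `^ (gamma - 1)^-1.
have g0 : 0 < gamma - 1 by lra.
have := near_ln_ge (Num.max K 1); apply: filterS => N; rewrite ge_max => /andP[hK h1].
move: (ln _) hK h1 => L hK h1.
have L0 : 0 < L by lra.
have -> : gamma = (gamma - 1) + 1 by ring.
rewrite powRD; last by rewrite (gt_eqF L0) implybT.
rewrite powRr1 ?(ltW L0) // ler_pM2r //.
apply: le_trans (_ : K `^ (gamma - 1) <= _).
  rewrite /K -powRrM mulVf ?gt_eqF // powRr1; first by rewrite le_max lexx.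
  by rewrite le_max lexx orbT.
by apply: ge0_ler_powR; rewrite ?nnegrE ?powR_ge0 // ltW.
Qed.

(** Bounding the logarithm L by [2 * gamma * expR (L / (2 * gamma))] and raising to the power
    [gamma] leaves a multiple of the square root of N. *)
Lemma near_ln_powR_le {R : realType} (gamma c : R) : 0 < gamma -> 0 < c ->
  \forall N \near \oo%classic, ln (N%:R : R) `^ gamma <= c * N%:R.
Proof.
move=> g0 c0.
pose A := (2 * gamma) `^ gamma.
have g2 : 0 < 2 * gamma by rewrite mulr_gt0.
have h0 := near_ln_ge (0 : R).
have h1 := near_ln_ge (2 * (A / c)).
have h2 : \forall N \near \oo%classic, (0 < N)%N by exact: nbhs_infty_gt.
near=> N.
have N0 : (0 < N)%N by near: N.
have EN : (N%:R : R) = expR (ln (N%:R : R)) by rewrite lnK // posrE ltr0n.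
have L0 : 0 <= ln (N%:R : R) by near: N; exact: h0.
have L1 : 2 * (A / c) <= ln (N%:R : R) by near: N; exact: h1.
rewrite [in leRHS]EN; move: (ln _) EN L0 L1 => L EN L0 L1.
have LA : L <= 2 * gamma * expR (L / (2 * gamma)).
  rewrite -ler_pdivrMl // mulrC; apply: le_trans (expR_ge1Dx _); lra.
apply: le_trans (_ : (2 * gamma * expR (L / (2 * gamma))) `^ gamma <= _).
  by apply: ge0_ler_powR; rewrite ?nnegrE ?mulr_ge0 ?expR_ge0 // ltW.
rewrite powRM ?expR_ge0 ?(ltW g2) // -/A -expRM.
have -> : L / (2 * gamma) * gamma = L / 2 by field; rewrite gt_eqF.
have -> : expR L = expR (L / 2) * expR (L / 2) by rewrite -expRD; congr expR; field.
rewrite mulrA ler_pM2r ?expR_gt0 // mulrC -ler_pdivrMr //.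
by apply: le_trans (expR_ge1Dx _); lra.
Unshelve. all: by end_near.
Qed.

Lemma expRN_le {R : realType} (y : R) : 0 <= y -> expR (- y) <= (1 + y)^-1.
Proof.
move=> y0; rewrite expRN lef_pV2 ?posrE ?expR_gt0 ?expR_ge1Dx //; lra.
Qed.

(** At this [d] the quantity [N * d ^ 2] is a constant times x, the power [gamma] of log N. Since
    [gamma > 1], x exceeds every multiple of log N, so half of the exponent absorbs the factors N of
    the union bounds and the other half is the claimed rate. The remaining terms decay at least
    exponentially in N. *)
Lemma error_budget {R : realType} (gamma epsilon C d0 k1 k2 k3 : R) :
  1 < gamma -> 0 < epsilon -> 0 < C -> 0 < d0 -> 0 < k1 -> 0 < k2 -> 0 < k3 ->
  exists2 delta0 : R, 0 < delta0 & \forall N \near \oo%classic,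
    let x := ln (N%:R : R) `^ gamma in let d := epsilon * Num.sqrt (x / N%:R) / C in
    [/\ 0 <= d, 24 <= N%:R * d, d <= d0 &
      2 * (6 * N.+1%:R * expR (- (N%:R * d ^+ 2 * k1))) + 3 * (2 * expR (- (N%:R * k2)))
      + 4 * (8 * N%:R * expR (- (N%:R * d ^+ 2 * k1))
             + 4 ^+ N * expR (- (N%:R ^+ 2 * k3)))
      < expR (- (delta0 * x))].
Proof.
move=> g1 e0 C0 dp k10 k20 k30.
have g0 : 0 < gamma by lra.
have ec0 : 0 < epsilon ^+ 2 / C ^+ 2 by rewrite divr_gt0 // exprn_gt0.
have [kap kap0 Ek] : exists2 kap, 0 < kap & kap = epsilon ^+ 2 / C ^+ 2 * k1.
  by exists (epsilon ^+ 2 / C ^+ 2 * k1) => //; exact: mulr_gt0.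
have [d1 d10 Ed1] : exists2 d1, 0 < d1 & d1 = kap / 2.
  by exists (kap / 2) => //; rewrite divr_gt0.
exists d1 => //.
have E1 := near_ln_powR_ge gamma (4 / kap) g1.
have E2 := near_ln_powR_ge gamma 1 g1.
have E3 := near_ln_ge (1 : R).
have E4 : \forall N \near \oo%classic, ln (N%:R : R) `^ gamma <= (d0 * C / epsilon) ^+ 2 * N%:R.
  by apply: near_ln_powR_le => //; rewrite exprn_gt0 // divr_gt0 // mulr_gt0.
have k2' : 0 < k2 / 2 by rewrite divr_gt0.
have E5 : \forall N \near \oo%classic, ln (N%:R : R) `^ gamma <= (Num.min (k2 / 2) 1 / d1) * N%:R.
  by apply: near_ln_powR_le => //; rewrite divr_gt0 // lt_min k2' ltr01.
(* The vertex terms have total coefficient 56 once [N.+1] is replaced by [2 * N]; from 500 on they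
   take about a ninth of the target, and the other terms half of it. *)
have [n1 En1] : exists n1 : R, n1 = 500 by exists 500.
have E6 : \forall N \near \oo%classic, Num.max (Num.max n1 ((24 * C / epsilon) ^+ 2))
    (Num.max (20 / (k2 / 2)) (8 / k3)) <= N%:R :> R by exact: nbhs_infty_ger.
near=> N.
set x := ln (N%:R : R) `^ gamma; set d := epsilon * Num.sqrt (x / N%:R) / C.
have /andP[/andP[n500 n2] /andP[n3 n4]] : ((n1 <= N%:R :> R) && ((24 * C / epsilon) ^+ 2 <= N%:R)) &&
   ((20 / (k2 / 2) <= N%:R :> R) && (8 / k3 <= N%:R)).
  by rewrite -!ge_max; near: N.
have h1 : 4 / kap * ln (N%:R : R) <= x by rewrite /x; near: N.
have h2 : 1 * ln (N%:R : R) <= x by rewrite /x; near: N.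
have h3 : 1 <= ln (N%:R : R) by near: N.
have h4 : x <= (d0 * C / epsilon) ^+ 2 * N%:R by rewrite /x; near: N.
have h5 : x <= (Num.min (k2 / 2) 1 / d1) * N%:R by rewrite /x; near: N.
clearbody x.
have N0 : 0 < N%:R :> R by clear -n500 En1; lra.
have x1 : 1 <= x by clear -h2 h3; lra.
have x0 : 0 <= x by clear -x1; lra.
have NE : N%:R * d ^+ 2 = epsilon ^+ 2 / C ^+ 2 * x.
  by rewrite /d expr_div_n [(epsilon * _) ^+ 2]exprMn sqr_sqrtr ?divr_ge0 ?(ltW N0) //; field; rewrite !gt_eqF.
have dge0 : 0 <= d by rewrite /d divr_ge0 ?mulr_ge0 ?sqrtr_ge0 // ltW.
split => //.
- have p24 : 0 <= 24 :> R by rewrite ler0n.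
  have nd0 : 0 <= N%:R * d by apply: mulr_ge0 => //; exact: ltW.
  suff h : 24 ^+ 2 <= (N%:R * d) ^+ 2 by move: h; rewrite ler_pXn2r // ?nnegrE.
  rewrite exprMn (_ : N%:R ^+ 2 * d ^+ 2 = N%:R * (N%:R * d ^+ 2)); last by ring.
  rewrite NE.
  apply: le_trans (_ : (24 * C / epsilon) ^+ 2 * (epsilon ^+ 2 / C ^+ 2 * 1) <= _).
    by rewrite le_eqVlt; apply/orP; left; apply/eqP; field; rewrite !gt_eqF.
  apply: ler_pM => //; first by rewrite exprn_ge0 // divr_ge0 ?mulr_ge0 // ltW.
    by rewrite mulr1 ltW.
  by rewrite ler_pM2l.
- suff h : d ^+ 2 <= d0 ^+ 2 by move: h; rewrite ler_pXn2r // ?nnegrE // ltW.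
  rewrite -(ler_pM2l N0) NE.
  apply: le_trans (_ : epsilon ^+ 2 / C ^+ 2 * ((d0 * C / epsilon) ^+ 2 * N%:R) <= _).
    by rewrite ler_pM2l.
  by rewrite le_eqVlt; apply/orP; left; apply/eqP; field; rewrite !gt_eqF.
rewrite NE (_ : epsilon ^+ 2 / C ^+ 2 * x * k1 = kap * x); last by rewrite Ek; ring.
clear NE; clearbody d; clear dge0.
have [Y Y0 EY] : exists2 Y, 0 < Y & Y = expR (- (d1 * x)).
  by exists (expR (- (d1 * x))) => //; exact: expR_gt0.
rewrite -EY.
have EN : (N%:R : R) = expR (ln (N%:R : R)) by rewrite lnK.
have T1 : N%:R * expR (- (kap * x)) <= Y / N%:R.
  rewrite {1 2}EN -expRN EY -!expRD ler_expR Ed1.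
  have : kap / 4 * (4 / kap * ln (N%:R : R)) <= kap / 4 * x by rewrite ler_pM2l // divr_gt0.
  rewrite (_ : kap / 4 * (4 / kap * _) = ln (N%:R : R)); last by field; rewrite gt_eqF.
  by clear; lra.
have m1 : d1 * x <= Num.min (k2 / 2) 1 * N%:R.
  by move: h5; rewrite mulrAC ler_pdivlMr // mulrC.
have m2 : d1 * x <= k2 / 2 * N%:R.
  by apply: le_trans m1 _; rewrite ler_pM2r // ge_min lexx.
have m3 : d1 * x <= N%:R.
  by apply: le_trans m1 _; rewrite ler_piMl ?(ltW N0) // ge_min lexx orbT.
have T2 : 20 * expR (- (N%:R * k2)) <= Y.
  have hy : 20 <= k2 / 2 * N%:R by move: n3; rewrite ler_pdivrMr // mulrC.
  have a1 : expR (- (k2 / 2 * N%:R)) <= (1 + k2 / 2 * N%:R)^-1.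
    by apply: expRN_le; clear -hy; lra.
  have a2 : 20 * expR (- (k2 / 2 * N%:R)) <= 1.
    rewrite -ler_pdivlMl //; apply: le_trans a1 _; rewrite mulr1 lef_pV2 ?posrE //; clear -hy; lra.
  have -> : expR (- (N%:R * k2)) = expR (- (k2 / 2 * N%:R)) * expR (- (k2 / 2 * N%:R)).
    by rewrite -expRD; congr expR; field.
  rewrite mulrA -[leRHS]mul1r; apply: ler_pM => //; rewrite ?mulr_ge0 ?expR_ge0 //.
  by rewrite EY ler_expR lerN2.
have T3 : 20 * (4 ^+ N * expR (- (N%:R ^+ 2 * k3))) <= Y.
  have a1 : 4 ^+ N <= expR (N%:R * 3) :> R.
    rewrite mulrC expRM_natr; apply: lerXn2r; rewrite ?nnegrE ?expR_ge0 //.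
    by apply: le_trans (expR_ge1Dx _); clear; lra.
  have a2 : 20 <= expR N%:R :> R.
    by apply: le_trans (expR_ge1Dx _); clear -n500 En1; lra.
  have a3 : 8 * N%:R <= N%:R ^+ 2 * k3.
    have h : 8 <= N%:R * k3 by move: n4; rewrite ler_pdivrMr.
    by rewrite expr2 mulrAC ler_pM2r.
  apply: le_trans (_ : expR N%:R * (expR (N%:R * 3) * expR (- (N%:R ^+ 2 * k3))) <= _).
    by rewrite ler_pM ?mulr_ge0 ?exprn_ge0 ?expR_ge0 // ler_wpM2r ?expR_ge0.
  rewrite -!expRD EY ler_expR; clear -a3 m3 N0; lra.
have T4 : N.+1%:R <= 2 * N%:R :> R by rewrite -natr1; clear -n500 En1; lra.
have T5 : 500 * (N%:R * expR (- (kap * x))) <= Y.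
  move: T1; rewrite ler_pdivlMr // mulrC; apply: le_trans.
  by rewrite ler_wpM2r ?mulr_ge0 ?expR_ge0 // -En1.
have T6 : N.+1%:R * expR (- (kap * x)) <= 2 * (N%:R * expR (- (kap * x))).
  by rewrite mulrA ler_wpM2r ?expR_ge0.
clear -T2 T3 T5 T6 Y0.
set a := N%:R * expR (- (kap * x)) in T5 T6 *; set b := N.+1%:R * _ in T6 *.
rewrite -[6 * _ * _]mulrA -/b -[8 * _ * _]mulrA -/a; lra.
Unshelve. all: by end_near.
Qed.

(** * Union bound over the graph and the two partitions *)

Lemma pair_union_bound {R : realType} {E P : finType} (p : E -> R) (G : pred P)
    (I1 : P -> R) (I2 : P -> P -> R) (I3 : E -> P -> P -> R) (cond : E -> P -> P -> bool)
    (g a m b : R) :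
  (forall e, 0 <= p e) -> \sum_e p e = 1 -> 0 < g -> \sum_(x | G x) 1 = g ->
  \sum_(x | G x) I1 x <= g * a ->
  (forall x, G x -> \sum_(y | G y) I2 x y <= g * m) ->
  (forall x y, \sum_e p e * I3 e x y <= b) ->
  (forall e x y, G x -> G y -> ~~ cond e x y -> 1 <= I1 x + I1 y + I2 x y + I3 e x y) ->
  (forall e x y, 0 <= I1 x + I1 y + I2 x y + I3 e x y) ->
  1 - (2 * a + m + b) <=
    \sum_e \sum_(x | G x) \sum_(y | G y) (if cond e x y then p e / g ^+ 2 else 0).
Proof.
move=> p0 p1 g0 gE h1 h2 h3 hb h0.
have gn : g != 0 by rewrite gt_eqF.
have cg (c : R) : \sum_(x | G x) c = g * c.
  by rewrite -gE mulr_suml; apply: eq_bigr => x _; rewrite mul1r.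
have q0 e : 0 <= p e / g ^+ 2 by rewrite divr_ge0 // exprn_ge0 // ltW.
(* The graph is averaged with both partitions fixed: it is independent of them, and the bound [b] is
   uniform in the partitions. *)
have inner x y : \sum_e p e * (I1 x + I1 y + I2 x y + I3 e x y) <= I1 x + I1 y + I2 x y + b.
  under eq_bigr do rewrite mulrDr.
  by rewrite big_split /= -mulr_suml p1 mul1r lerD2l.
have tot : \sum_(x | G x) \sum_(y | G y) \sum_e p e * (I1 x + I1 y + I2 x y + I3 e x y)
    <= g ^+ 2 * (2 * a + m + b).
  apply: le_trans (_ : \sum_(x | G x) (g * I1 x + g * (a + m + b)) <= _).
    apply: ler_sum => x Gx.
    apply: le_trans (ler_sum _ (fun y _ => inner x y)) _.
    rewrite !big_split /= !cg; have := h2 x Gx; lra.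
  rewrite big_split /= cg -mulr_sumr.
  have : g * (\sum_(x | G x) I1 x) <= g * (g * a) by rewrite ler_pM2l.
  lra.
(* On a bad triple the failure terms add up to at least 1, so the left side is nonpositive. *)
have low e x y : G x -> G y ->
    p e / g ^+ 2 - p e * (I1 x + I1 y + I2 x y + I3 e x y) / g ^+ 2
      <= (if cond e x y then p e / g ^+ 2 else 0).
  move=> Gx Gy; rewrite mulrAC -[X in X - _]mulr1 -mulrBr.
  case: ifP => [_|/negbT nc].
    by rewrite ler_piMr // gerBl.
  by rewrite mulr_ge0_le0 // subr_le0 hb.
apply: le_trans (_ : \sum_e \sum_(x | G x) \sum_(y | G y)
    (p e / g ^+ 2 - p e * (I1 x + I1 y + I2 x y + I3 e x y) / g ^+ 2) <= _); last first.
  by apply: ler_sum => e _; apply: ler_sum => x Gx; apply: ler_sum => y Gy; exact: low.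
have -> : \sum_e \sum_(x | G x) \sum_(y | G y)
    (p e / g ^+ 2 - p e * (I1 x + I1 y + I2 x y + I3 e x y) / g ^+ 2) =
  1 - (\sum_(x | G x) \sum_(y | G y) \sum_e p e * (I1 x + I1 y + I2 x y + I3 e x y)) / g ^+ 2.
  under eq_bigr => e _ do under eq_bigr => x _ do rewrite sumrB.
  under eq_bigr => e _ do rewrite sumrB.
  rewrite sumrB; congr (_ - _).
    under eq_bigr => e _ do rewrite !cg.
    rewrite -mulr_sumr -mulr_sumr -mulr_suml p1; field.
    by [].
  rewrite exchange_big mulr_suml; apply: eq_bigr => x _.
  rewrite exchange_big mulr_suml; apply: eq_bigr => y _.
  by rewrite mulr_suml.
rewrite lerD2l lerN2 ler_pdivrMr ?exprn_gt0 // mulrC; exact: tot.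
Qed.

Lemma ngood_gt0 (N : nat) : (0 < ngood N)%N.
Proof.
pose B m : {set 'I_N} := [set u : 'I_N | (u < m)%N].
(* Initial segments of lengths [n] and [m] delimit the parts; the bit gives the second part an extra
   vertex exactly when N leaves remainder 2. *)
pose n := (N %/ 3)%N; pose m := (2 * n + (N %% 3 == 2))%N.
have nm : (n <= m)%N by rewrite /m; lia.
have mN : (m <= N)%N by rewrite /m /n; lia.
have cB k : (k <= N)%N -> #|B k| = k by exact: card_ord_lt.
have sub : B n :&: B m = B n.
  by apply/finset.setIidPl/fintype.subsetP => u; rewrite !inE => h; exact: leq_trans h nm.
rewrite /ngood; apply/card_gt0P; exists (~: B m, B m :\: B n, B n).
have c1 : #|~: B m| = (N - m)%N by have := cardsC (B m); rewrite cB // card_ord => /(congr1 (subn^~ m)) <-; rewrite addKn.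
have c2 : #|B m :\: B n| = (m - n)%N by rewrite cardsD finset.setIC sub !cB // (leq_trans nm).
have nN := leq_trans nm mN.
rewrite inE /good /= c1 c2 (cB n nN); apply/and5P; split.
- by apply/eqP/setP => u; rewrite !inE; case: (u < m)%N (u < n)%N => [] [].
- by rewrite -setI_eq0; apply/eqP/setP => u; rewrite !inE; case: (u < m)%N; rewrite ?andbF.
- rewrite -setI_eq0; apply/eqP/setP => u; rewrite !inE; apply/negbTE; rewrite negb_and negbK.
  by case: (ltnP u n) => h; rewrite ?orbT // (leq_trans h nm).
- by rewrite -setI_eq0; apply/eqP/setP => u; rewrite !inE; case: (u < n)%N; rewrite ?andbF.
rewrite -/n; have e1 : (N = 3 * n + N %% 3)%N by rewrite /n; lia.
have r3 : (N %% 3 < 3)%N by rewrite ltn_mod.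
rewrite /m; clear -e1 r3; move: (N %% 3)%N n e1 r3 => r n -> r3.
by case: r r3 => [|[|[|r]]] //= _; apply/and4P; split; lia.
Qed.

Lemma sum_bool_cond {R : realType} {T : finType} (G B : pred T) (f : T -> R) :
  \sum_(x | G x) f x * (B x)%:R = \sum_(x | G x && B x) f x.
Proof.
rewrite [RHS]big_mkcondr; apply: eq_bigr => x _.
by case: (B x); rewrite ?mulr1 ?mulr0.
Qed.

Lemma sum_good (R : realType) (N : nat) : \sum_(P : part3 N | good P) 1 = (ngood N)%:R :> R.
Proof.
rewrite /ngood -sum1_card natr_sum; symmetry.
apply: eq_bigl => P; apply/idP/idP => h.
  by have := set_mem h.
exact/mem_set.
Qed.

Lemma sum_ge1 {R : realType} {I : finType} (B : pred I) i :
  B i -> 1 <= \sum_(j : I) ((B j)%:R : R).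
Proof. by move=> Bi; rewrite (bigD1 i) //= Bi lerDl sumr_ge0. Qed.

(** The exponent is weakened to the constant 1/512 of the partition bound, so that one budget serves
    both. *)
Lemma graph_bad_le {R : realType} (rho : R -> R) (Lam : R) (F : nat -> nat -> R) {N : nat}
    (T : {set 'I_N}) (d eps : R) :
  decay_profile rho Lam -> (forall n i, `|F n i| <= 1) -> (0 < N)%N -> 0 <= d <= 1 -> 0 <= eps <= 2 ->
  \sum_(e : graph N) edge_prob (wfun rho) e * (~~ `[< graph_ok rho F T (2 * d) eps e >])%:R
    <= 8 * N%:R * expR (- (N%:R * d ^+ 2 * (1 / 512))) + 4 ^+ N * expR (- (N%:R ^+ 2 * (eps ^+ 2 / 16))).
Proof.
move=> D F1 N0 /andP[d0 d1] he.
rewrite (sum_bool_cond xpredT) /=.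
have ht : 0 <= 2 * d <= 2 by apply/andP; split; lra.
apply: le_trans (graph_bad_prob rho Lam F T (2 * d) eps D F1 N0 ht he) _.
apply: lerD; last by rewrite le_eqVlt (_ : eps ^+ 2 * N%:R ^+ 2 / 16 = N%:R ^+ 2 * (eps ^+ 2 / 16)) ?eqxx //; ring.
rewrite ler_wpM2l // ler_expR lerN2.
have : 0 <= N%:R * d ^+ 2 by rewrite mulr_ge0 // exprn_ge0.
by rewrite exprMn mulrCA mulrA => h; clear -h; lra.
Qed.

Lemma sqrtr_scale {R : realType} (x n : R) : 0 < n -> n * Num.sqrt (x / n) = Num.sqrt (n * x).
Proof.
move=> n0; rewrite -{1}(ger0_norm (ltW n0)) -sqrtr_sqr -sqrtrM ?sqr_ge0 //.
by congr Num.sqrt; field; rewrite gt_eqF.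
Qed.

Lemma postproc_uniform_error {R : realType} (rho : R -> R) (Lam gamma epsilon : R) :
  decay_profile rho Lam -> 1 < gamma -> 0 < epsilon ->
  exists delta : R, 0 < delta /\
  exists N0 : nat, forall N : nat, (N0 <= N)%N ->
  forall sel : graph N -> part3 N -> part3 N -> ('I_N -> nat),
    (forall e P P', good P -> good P' ->
       postproc e P P' (5 / 100 : R) (31 / 100 : R) (sel e P P')) ->
    1 - (eps_gamma gamma N) `^ delta <
      \sum_(e : graph N) \sum_(P : part3 N | good P) \sum_(P' : part3 N | good P')
        (if (distinf (sel e P P'))%:R <= epsilon * Num.sqrt (N%:R * (ln (N%:R : R)) `^ gamma)
         then edge_prob (wfun rho) e / ((ngood N)%:R ^+ 2) else 0).
Proof.
move=> D g1 ep0.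
have [C [d0 [eps [n0 [F [[C0 /andP[d0p d01] /andP[e0 e2]] [F1 H]]]]]]] := ordering_errors rho Lam D.
have k1 : 0 < 1 / 512 :> R by lra.
have k2 : 0 < 1 / 80 / 1000 :> R by lra.
have k3 : 0 < eps ^+ 2 / 16 by rewrite divr_gt0 // exprn_gt0.
have [delta0 dp [N0 _ B]] := error_budget gamma epsilon C d0 _ _ _ g1 ep0 C0 d0p k1 k2 k3.
exists delta0; split => //; exists (maxn N0 (maxn n0 200)) => N.
rewrite !geq_max => /and3P[N0N n0N N200] sel Hsel.
have [] := B N N0N.
have NR : 0 < N%:R :> R by rewrite ltr0n; apply: leq_trans N200.
set x := ln _ `^ gamma; have [d Ed] : exists d, d = epsilon * Num.sqrt (x / N%:R) / C by eexists.
rewrite -Ed => dge0 Nd dd0 budget.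
have Nd4 : 4 <= N%:R * d by clear -Nd; lra.
have d1 : d <= 1 by clear -dd0 d01; lra.
have bE : C * N%:R * d = epsilon * Num.sqrt (N%:R * x).
  rewrite Ed -(sqrtr_scale x _ NR); field; by rewrite gt_eqF.
have -> : eps_gamma gamma N `^ delta0 = expR (- (delta0 * x)).
  by rewrite /eps_gamma -expRM -/x; congr expR; ring.
pose ok (T : {set 'I_N}) (e : graph N) := `[< graph_ok rho F T (2 * d) eps e >].
pose I1 (P : part3 N) : R := (~~ `[< parts_regular P d >])%:R.
(* A missing common vertex is counted only for a regular [P], whose low part is known to be large;
   an irregular [P] is already charged to [I1]. *)
pose miss (P P' : part3 N) (j : 'I_3) :=
  `[< parts_regular P d >] && (part_of (inord 1) P' :&: low_part j P == finset.set0).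
pose I2 (P P' : part3 N) : R := \sum_(j < 3) (miss P P' j)%:R.
pose I3 (e : graph N) (P P' : part3 N) : R :=
  \sum_(j < 3) (~~ ok (part_of j P) e)%:R + (~~ ok P'.1.1 e)%:R.
set a := 6 * N.+1%:R * _ in budget; set m := 2 * expR _ in budget; set b := 8 * _ * _ + _ in budget.
have N12 : (12 <= N)%N by apply: leq_trans N200.
have N0' : (0 < N)%N by apply: leq_trans N200.
have he : 0 <= eps <= 2 by rewrite (ltW e0).
have hd : 0 <= d <= 1 by rewrite dge0.
have g0 : 0 < (ngood N)%:R :> R by rewrite ltr0n ngood_gt0.
have gE : \sum_(P : part3 N | good P) 1 = (ngood N)%:R :> R.
  exact: sum_good.
have h1 : \sum_(P : part3 N | good P) I1 P <= (ngood N)%:R * a.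
  under eq_bigr do rewrite -[I1 _]mul1r.
  rewrite sum_bool_cond.
  apply: le_trans (parts_irregular_count d N12 hd Nd) _.
  by rewrite ler_pM2l // /a [1 / _]mul1r.
have h2 P : good P -> \sum_(P' : part3 N | good P') I2 P P' <= (ngood N)%:R * (3 * m).
  move=> gP; rewrite exchange_big /=.
  apply: le_trans (_ : \sum_(j < 3) (ngood N)%:R * m <= _); last first.
    by rewrite sumr_const card_ord -[leLHS]mulr_natl mulrCA.
  apply: ler_sum => j _; rewrite /miss; case: asboolP => pr /=; last first.
    by rewrite big1 // mulr_ge0 // mulr_ge0 ?expR_ge0.
  under eq_bigr do rewrite -[_%:R]mul1r.
  rewrite sum_bool_cond; apply: le_trans (part_miss_count _ _ N200 _) _.
    exact: card_low_part N200 gP (le_trans dd0 d01) pr.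
  by rewrite /m (_ : N%:R * (1 / 80 / 1000) = N%:R / 80 / 1000) // mulrA mulrA mulr1.
have h3 P P' : \sum_e edge_prob (wfun rho) e * I3 e P P' <= 4 * b.
  have hb T : \sum_e edge_prob (wfun rho) e * (~~ ok T e)%:R <= b.
    have h := graph_bad_le rho Lam F T d eps D F1 N0' hd he.
    exact: h.
  under eq_bigr => e _ do rewrite /I3 mulrDr mulr_sumr.
  rewrite big_split exchange_big /=.
  have := hb P'.1.1; have : \sum_(j < 3) \sum_e edge_prob (wfun rho) e * (~~ ok (part_of j P) e)%:R <= \sum_(j < 3) b.
    by apply: ler_sum => j _; exact: hb.
  rewrite sumr_const card_ord -[b *+ 3]mulr_natl; clear; lra.
apply: lt_le_trans (pair_union_bound (edge_prob (wfun rho)) (@good N) I1 I2 I3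
  (fun e P P' => (distinf (sel e P P'))%:R <= epsilon * Num.sqrt (N%:R * x))
  (ngood N)%:R a (3 * m) (4 * b) _ (sum_edge_prob _) g0 gE h1 h2 h3 _ _).
- by rewrite ltrD2l ltrN2; exact: budget.
- by move=> e; exact: edge_prob_ge0 D.
- move=> e P P' gP gP'; rewrite -bE; apply: contraR; rewrite -ltNge => small.
  have I1p Q : 0 <= I1 Q by exact: ler0n.
  have I2p : 0 <= I2 P P' by apply: sumr_ge0.
  have I3p : 0 <= I3 e P P' by rewrite addr_ge0 // sumr_ge0.
  have pr : parts_regular P d.
    apply: contrapT => /asboolPn h; have : I1 P = 1 by rewrite /I1 h.
    by move: (I1p P') small; clear -I2p I3p; lra.
  have pr' : parts_regular P' d.
    apply: contrapT => /asboolPn h; have : I1 P' = 1 by rewrite /I1 h.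
    by move: (I1p P) small; clear -I2p I3p; lra.
  have meet j : part_of (inord 1) P' :&: low_part j P != finset.set0.
    apply/negP => h; have mj : miss P P' j by rewrite /miss h andbT; apply/asboolP.
    have := sum_ge1 (R := R) (miss P P') j mj; rewrite -/(I2 P P').
    by move: (I1p P) (I1p P') small; clear -I3p; lra.
  have okP j : graph_ok rho F (part_of j P) (2 * d) eps e.
    apply: contrapT => /asboolPn h.
    have := sum_ge1 (R := R) (fun j => ~~ ok (part_of j P) e) j h.
    have : 0 <= (~~ ok P'.1.1 e)%:R :> R by [].
    by move: (I1p P) (I1p P') small; rewrite /I3; clear -I2p; lra.
  have okP' : graph_ok rho F P'.1.1 (2 * d) eps e.
    apply: contrapT => /asboolPn h.
    have : (~~ ok P'.1.1 e)%:R = 1 :> R by rewrite /ok h.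
    have : 0 <= \sum_(j < 3) ((~~ ok (part_of j P) e)%:R : R) by apply: sumr_ge0.
    by move: (I1p P) (I1p P') small; rewrite /I3; clear -I2p; lra.
  have [_ h] := H N e d n0N Nd4 dd0.
  exact: h gP gP' pr pr' meet okP okP' (Hsel e P P' gP gP').
- move=> e P P'; rewrite !addr_ge0 ?ler0n //; exact: sumr_ge0.
Qed.

(** With log N at most [N ^ (1/6)] the left side is at most N to the power 3/2 + 1/6 = 5/3, which
    [eta < 1/3] allows. *)
Lemma near_ln_sqrt_le {R : realType} (eta : R) : 0 < eta < 1 / 3 ->
  \forall N \near \oo%classic, Num.sqrt (N%:R * ln (N%:R : R) `^ 2) * N%:R <= N%:R `^ (2 - eta).
Proof.
move=> /andP[eta0 eta1].
have E1 : \forall N \near \oo%classic, ln (N%:R : R) `^ 6 <= 1 * N%:R by exact: near_ln_powR_le.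
have E2 := near_ln_ge (0 : R).
have E3 : \forall N \near \oo%classic, 1 <= N%:R :> R by exact: nbhs_infty_ger.
near=> N.
have h1 : ln (N%:R : R) `^ 6 <= 1 * N%:R by near: N.
have L0 : 0 <= ln (N%:R : R) by near: N.
have N1 : 1 <= N%:R :> R by near: N.
have N0 : 0 < N%:R :> R by apply: lt_le_trans N1.
move: (ln _) h1 L0 => L h1 L0.
have h2 : L <= N%:R `^ (1 / 6).
  have -> : L = (L `^ 6) `^ (1 / 6).
    by rewrite -powRrM (_ : 6 * (1 / 6) = 1) ?powRr1 //; field.
  apply: ge0_ler_powR; first by clear; lra.
  - by rewrite nnegrE powR_ge0.
  - by rewrite nnegrE (ltW N0).
  - by rewrite mul1r in h1.
have -> : Num.sqrt (N%:R * L `^ 2) = N%:R `^ (1 / 2) * L.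
  rewrite sqrtrM ?(ltW N0) // (_ : L `^ 2 = L ^+ 2); last by rewrite -powR_mulrn.
  by rewrite sqrtr_sqr ger0_norm // -powR12_sqrt ?(ltW N0) // div1r.
apply: le_trans (_ : N%:R `^ (1 / 2) * N%:R `^ (1 / 6) * N%:R `^ 1 <= _).
  by rewrite [in leRHS]powRr1 ?(ltW N0) // ler_pM2r // ler_pM2l // powR_gt0.
rewrite -!powRD ?(gt_eqF N0) ?implybT //.
by apply: ler_powR => //; lra.
Unshelve. all: by end_near.
Qed.

Lemma spectral_total_error {R : realType} (rho : R -> R) (Lam eps eta : R) :
  decay_profile rho Lam -> 0 < eps < 1 -> 0 < eta < 1 / 3 ->
  exists N0 : nat, forall N : nat, (N0 <= N)%N ->
  forall sel : graph N -> ('I_N -> nat),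
    (forall e, spec_ser R e [set: 'I_N]%SET (sel e)) ->
    1 - eps < \sum_(e : graph N | (dist1 (sel e))%:R <= 1 * (N%:R) `^ (2 - eta))
                edge_prob (wfun rho) e.
Proof.
move=> D /andP[eps0 eps1] heta.
have [C [d0 [eF [n0 [F [[C0 /andP[d0p d01] /andP[e0 e2]] [F1 H]]]]]]] := ordering_errors rho Lam D.
have k1 : 0 < 1 / 512 :> R by lra.
have k3 : 0 < eF ^+ 2 / 16 by rewrite divr_gt0 // exprn_gt0.
have g1 : 1 < 2 :> R by lra.
have [delta0 dp [NB _ B]] := error_budget 2 1 C d0 _ 1 _ g1 ltr01 C0 d0p k1 ltr01 k3.
have [N1 _ E1] := near_ln_powR_ge 2 1 g1.
have [N2 _ E2] := near_ln_ge (1 / (delta0 * eps)).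
have [N3 _ E3] := near_ln_sqrt_le eta heta.
exists (maxn (maxn n0 200) (maxn (maxn NB N1) (maxn N2 N3))) => N.
rewrite !geq_max => /andP[/andP[n0N N200] /andP[/andP[NBN N1N] /andP[N2N N3N]]] sel Hsel.
have b1 : 1 * ln (N%:R : R) <= ln (N%:R : R) `^ 2 by exact: E1.
have b2 : 1 / (delta0 * eps) <= ln (N%:R : R) by exact: E2.
have b3 : Num.sqrt (N%:R * ln (N%:R : R) `^ 2) * N%:R <= N%:R `^ (2 - eta) by exact: E3.
have [] := B N NBN; clear B E1 E2 E3.
have NR : 0 < N%:R :> R by rewrite ltr0n; apply: leq_trans N200.
move: b1 b2 b3; set x := ln _ `^ 2 => b1 b2 b3.
have [d Ed] : exists d, d = 1 * Num.sqrt (x / N%:R) / C by eexists.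
rewrite -Ed => dge0 Nd dd0 budget.
have Nd4 : 4 <= N%:R * d by clear -Nd; lra.
have bE : C * N%:R ^+ 2 * d = Num.sqrt (N%:R * x) * N%:R.
  by rewrite Ed -(sqrtr_scale x _ NR); field; rewrite gt_eqF.
have N0 : (0 < N)%N by rewrite -(ltr0n R).
have he : 0 <= eF <= 2 by rewrite (ltW e0).
have hd : 0 <= d <= 1 by rewrite dge0 /=; clear -dd0 d01; lra.
have hb := graph_bad_le rho Lam F [set: 'I_N]%SET d eF D F1 N0 hd he.
have small : expR (- (delta0 * x)) <= eps.
  have de0 : 0 < delta0 * eps by exact: mulr_gt0.
  have a1 : eps^-1 <= delta0 * x.
    rewrite -ler_pdivrMl //; apply: le_trans (_ : 1 / (delta0 * eps) <= _).
      by rewrite le_eqVlt; apply/orP; left; apply/eqP; field; rewrite !gt_eqF.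
    by clear -b1 b2; lra.
  have i0 : 0 < eps^-1 by rewrite invr_gt0.
  apply: le_trans (expRN_le _ _) _; first by clear -a1 i0; lra.
  by rewrite -[leRHS]invrK lef_pV2 ?posrE //; clear -a1 i0; lra.
rewrite (sum_bool_cond xpredT) /= in hb.
have := sum_edge_prob (N := N) (wfun rho).
rewrite (bigID (fun e => (dist1 (sel e))%:R <= 1 * (N%:R) `^ (2 - eta))) /= => tot.
have comp : \sum_(e | ~~ ((dist1 (sel e))%:R <= 1 * (N%:R) `^ (2 - eta))) edge_prob (wfun rho) e <=
    \sum_(e | ~~ `[< graph_ok rho F [set: 'I_N]%SET (2 * d) eF e >]) edge_prob (wfun rho) e.
  rewrite [leLHS]big_mkcond [leRHS]big_mkcond; apply: ler_sum => e _.
  case: ifP => bad; last by case: ifP => // _; exact: edge_prob_ge0 D.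
  rewrite ifT // ; apply: contra bad => /asboolP ok.
  have [h _] := H N e d n0N Nd4 dd0.
  by rewrite mul1r; apply: le_trans (h _ ok (Hsel e)) _; rewrite bE.
have a0 : 0 <= 2 * (6 * N.+1%:R * expR (- (N%:R * d ^+ 2 * (1 / 512)))).
  by move: (expR _) (expR_ge0 (- (N%:R * d ^+ 2 * (1 / 512)))) => E E0; rewrite !mulr_ge0.
have m0 : 0 <= 3 * (2 * expR (- (N%:R * 1))) :> R.
  by do ?apply: mulr_ge0 => //; exact: expR_ge0.
have s0 : 0 <= \sum_(e | ~~ `[< graph_ok rho F [set: 'I_N]%SET (2 * d) eF e >]) edge_prob (wfun rho) e.
  by apply: sumr_ge0 => e _; exact: edge_prob_ge0 D.
clear -tot comp hb budget small a0 m0 s0; lra.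
Qed.

Theorem theorem1 (R : realType) (rho : R -> R) :
  (forall x : R, 0 <= x <= 1 -> 0 < rho x <= 1) ->
  C1_on01 rho ->
  (forall x : R, 0 < x < 1 -> derive1 rho x < 0) ->
  (exists C : R, 0 < C /\
     forall eps eta : R, 0 < eps < 1 -> 0 < eta < 1 / 3 ->
     exists N0 : nat, forall N : nat, (N0 <= N)%N ->
     forall sel : graph N -> ('I_N -> nat),
       (forall e, spec_ser R e [set: 'I_N]%SET (sel e)) ->
       1 - eps < \sum_(e : graph N |
                        (dist1 (sel e))%:R <= C * (N%:R) `^ (2 - eta))
                   edge_prob (wfun rho) e)
  /\
  (forall gamma epsilon : R, 1 < gamma -> 0 < epsilon ->
     exists delta : R, 0 < delta /\
     exists N0 : nat, forall N : nat, (N0 <= N)%N ->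
     forall sel : graph N -> part3 N -> part3 N -> ('I_N -> nat),
       (forall e P P', good P -> good P' ->
          postproc e P P' (5 / 100 : R) (31 / 100 : R) (sel e P P')) ->
       1 - (eps_gamma gamma N) `^ delta <
         \sum_(e : graph N) \sum_(P : part3 N | good P) \sum_(P' : part3 N | good P')
           (if (distinf (sel e P P'))%:R <= epsilon * Num.sqrt (N%:R * (ln (N%:R : R)) `^ gamma)
            then edge_prob (wfun rho) e / ((ngood N)%:R ^+ 2) else 0)).
Proof.
move=> r01 c1 neg; have [Lam D] := C1_decay_profile rho r01 c1 neg; split.
  by exists 1; split=> // eps eta heps heta; exact: spectral_total_error D heps heta.
by move=> gamma epsilon hgamma hepsilon; exact: postproc_uniform_error D hgamma hepsilon.
Qed.
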